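(* Let $A \in \mathbb{Z}^{n\times n}$ be a matrix whose entries take values bounded by a polynomial in $n$, and assume that $A$ stays invertible over $\mathbb{Q}$ at all times. Then the set of positions $(s,t)$ at which $A^{-1}\in\mathbb{Q}^{n\times n}$ has a non-zero entry can be maintained in $\mathrm{DynFO}(+,\times)$ under changes that affect $\mathcal{O}\!\left(\frac{\log n}{\log\log n}\right)$ rows and columns.
   Context: The matrix $A$ is indexed by tuples over a domain of size $n$ and is given as an input relation containing $(\bar r,\bar c,\bar v)$ iff the entry at row $\bar r$, column $\bar c$ is $\bar v$ (numbers encoded as tuples of domain elements). A change replaces the matrix $A$ by $A+\Delta A$, where $\Delta A$ has non-zero entries only in the affected rows and columns. Dynamic complexity framework: a dynamic program stores auxiliary relations over the fixed domain, with a linear order and the corresponding addition and multiplication relations present at all times; after each change every auxiliary relation is redefined by a fixed first-order formula evaluated over the changed input and current auxiliary relations ($\mathrm{DynFO}(+,\times)$). A query is maintained if a designated auxiliary relation equals the query result after every sequence of changes. *)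

(* Defs.v *)
From HB Require Import structures.
From mathcomp Require Import all_boot all_order all_algebra.

Set Implicit Arguments.
Unset Strict Implicit.
Unset Printing Implicit Defensive.

Import Order.TTheory GRing.Theory Num.Theory.

Local Open Scope ring_scope.

(* Built-in arithmetic, one input relation, auxiliary relations indexed by J; *)
(* the index None is the designated answer relation.                          *)
Inductive symbol (J : Type) : Type :=
  | Le | Add | Mul | Input | Aux of option J.
Arguments Le {J}.
Arguments Add {J}.
Arguments Mul {J}.
Arguments Input {J}.

Section Vocabulary.
Variables (J : Type) (ain aout : nat) (ar : J -> nat).

Definition aux_arity (R : option J) : nat := if R is Some j then ar j else aout.

Definition arity (s : symbol J) : nat :=
  match s with
  | Le => 2
  | Add => 3
  | Mul => 3
  | Input => ain
  | Aux R => aux_arity R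
  end.

(* First-order formulas with free variables in 'I_k; a quantifier binds       *)
(* variable 0 and shifts the others.                                          *)
Inductive formula : nat -> Type :=
  | FEq k of 'I_k & 'I_k : formula k
  | FRel k (s : symbol J) of (arity s).-tuple 'I_k : formula k
  | FNot k of formula k : formula k
  | FAnd k of formula k & formula k : formula k
  | FExists k of formula k.+1 : formula k.

Definition aux_state (n : nat) : Type :=
  forall R : option J, {set (aux_arity R).-tuple 'I_n}.

(* The domain is identified with {0, ..., n-1} along its linear order.        *)
Definition interp n (I : {set ain.-tuple 'I_n}) (X : aux_state n)
    (s : symbol J) : {set (arity s).-tuple 'I_n} :=
  match s with
  | Le => [set x : 2.-tuple 'I_n | ([tnth x 0] <= [tnth x 1])%N]
  | Add => [set x : 3.-tuple 'I_n |
      [tnth x 0] + [tnth x 1] == [tnth x 2]]%N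
  | Mul => [set x : 3.-tuple 'I_n |
      [tnth x 0] * [tnth x 1] == [tnth x 2]]%N
  | Input => I
  | Aux R => X R
  end.

Fixpoint eval n (I : {set ain.-tuple 'I_n}) (X : aux_state n) k
    (f : formula k) : k.-tuple 'I_n -> bool :=
  match f in formula k return k.-tuple 'I_n -> bool with
  | FEq _ x y => fun e => tnth e x == tnth e y
  | FRel _ s xs => fun e => map_tuple (tnth e) xs \in interp I X s
  | FNot _ g => fun e => ~~ eval I X g e
  | FAnd _ g h => fun e => eval I X g e && eval I X h e
  | FExists _ g => fun e => [exists a : 'I_n, eval I X g (cons_tuple a e)]
  end.

End Vocabulary.

Record dynprog (ain aout : nat) := DynProg {
  aux : finType;
  aux_ar : aux -> nat;
  update_formula : forall R : option aux,
    formula ain aout aux_ar (aux_arity aout aux_ar R)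
}.

Section Run.
Variables (ain aout : nat) (P : dynprog ain aout) (n : nat).

Definition state : Type := aux_state aout (@aux_ar _ _ P) n.

Definition update (X : state) (I : {set ain.-tuple 'I_n}) : state :=
  fun R => [set x | eval I X (update_formula R) x].

(* Is lists the input relation after each successive change. *)
Definition run (X : state) (Is : seq {set ain.-tuple 'I_n}) : state :=
  foldl update X Is.

Definition answer (X : state) : {set aout.-tuple 'I_n} := X None.

End Run.

Section Matrices.
Variables (l d n : nat).

Definition idx : finType := {: l.-tuple 'I_n}.

Definition entry (R : Type) (A : 'M[R]_#|idx|) (r c : idx) : R :=
  A (enum_rank r) (enum_rank c).

(* An integer z with |z| < n ^ d is the (d + 1)-tuple consisting of its sign  *)
(* (0, or 1 if z < 0) and the base-n digits of |z|, least significant first.  *)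
Definition encodes (sg : 'I_n) (u : d.-tuple 'I_n) (z : int) : bool :=
  (val sg == (z < 0)%R) && (\sum_(i < d) tnth u i * n ^ i == `|z|)%N.

Definition matrix_rel (A : 'M[int]_#|idx|) :
    {set (l + (l + d.+1)).-tuple 'I_n} :=
  [set x | [exists r : idx, exists c : idx,
     exists sg : 'I_n, exists u : d.-tuple 'I_n,
       (x == cat_tuple r (cat_tuple c (cons_tuple sg u)))
       && encodes sg u (entry A r c)]].

Definition overQ (A : 'M[int]_#|idx|) : 'M[rat]_#|idx| := map_mx intr A.

Definition admissible (A : 'M[int]_#|idx|) : Prop :=
  (forall i j, `|A i j|%N < n ^ d)%N /\ overQ A \in unitmx.

(* A change is confined to the intersection of the affected rows and columns. *)
Definition affects_at_most (k : nat) (D : 'M[int]_#|idx|) : Prop :=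
  exists rows cols : {set 'I_#|idx|},
    [/\ (#|rows| <= k)%N, (#|cols| <= k)%N &
        forall i j, D i j != 0 -> i \in rows /\ j \in cols].

Definition inverse_support (A : 'M[int]_#|idx|) :
    {set (l + l).-tuple 'I_n} :=
  [set x | [exists s : idx, exists t : idx,
     (x == cat_tuple s t) && (entry (invmx (overQ A)) s t != 0)]].

End Matrices.

(* Main.v *)
(** The inverse is maintained modulo all primes [p] below a power of [n], by
    many threads indexed by [p], a residue [x] mod [p] and an age [a].  With
    [m = n ^ l] the number of rows, a thread of age [a] stores the inverse mod
    [p] of a hybrid of [x * 1] and the current matrix: the first [m ^ 2] steps
    add the entries of [A] one by one, the next [m ^ 2] steps remove the summands
    [x] from the diagonal one by one, so that age [2 m ^ 2] stores [A^-1] mod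
    [p].  Each update advances all threads by one step.  Only a thread all of
    whose hybrids were invertible survives, but seen as a polynomial in [x] the
    determinant of a hybrid is a characteristic polynomial in the first phase and
    has constant term [det A] in the second.  Hence a prime that divides neither
    a nonzero entry of [adj A] nor the last [m ^ 2 + 1] determinants leaves some
    surviving [x], and such a prime exists below a power of [n].

    One step is a change of [K = O(log n / log log n)] rows and columns.  By the
    Woodbury identity and Cramer's rule, the new entry equals [r] when one
    explicit [K * K] matrix mod [p] is regular and another one is singular.  Since
    [K ^ K] is polynomial in [n], a sequence of [K] numbers below a power of [K]
    is a single quantifiable number, which lets first-order formulas run
    computations with such small states.  To test [p | det M], make [M] diagonally
    dominant without changing it mod [p], compute the determinant modulo small
    primes from the pivots, and decide divisibility from the Chinese remainder
    representation. *)

Require Import Defs.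
From HB Require Import structures.
From mathcomp Require Import all_boot all_order all_algebra fingroup perm.
From mathcomp Require Import zify ring lra.

Set Implicit Arguments.
Unset Strict Implicit.
Unset Printing Implicit Defensive.

(** * Primes and linear algebra *)

(** A prime may divide [det A] at some moment, and the Woodbury step cannot start from a singular
    matrix; hence no single inverse mod [p] can be kept forever. The threads form a pipeline: at
    every moment there are candidates of every age, in particular of full age, and only the matrices
    of the last [2 m ^ 2] steps decide which of these are alive. Ageing changes one further entry
    per step, which costs two more affected indices.

    [k] is an arbitrary function, so [K] need not be definable. The update guesses [K] together with
    its base and power: every guess that satisfies [good_params] is sound, and some guess is large
    enough.

    Primes occur on two scales. The moduli [p] of the inverses are polynomial in [n], too large for
    the small-state computations. These use primes [q] polynomial in [K], both to decide whether [p]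
    divides a [K * K] determinant and to name the affected indices.

    Before the first change the auxiliary relations may be empty; a diagonal matrix close to the
    input then takes the place of the previous one. *)

Section Primes.

(** Vandermonde's identity writes the central binomial as the sum of the squares of the ['C(n, i)],
    whose plain sum is [2 ^ n]. *)
Lemma leq_exp2_central n : 2 ^ n <= 'C(n + n, n).
Proof.
rewrite -(binomial.Vandermonde n n n) -{1}[2]/(1 + 1) expnDn; apply: leq_sum => i _.
have le : i <= n by rewrite -ltnS.
by rewrite !exp1n !muln1 bin_sub // leq_pmulr // bin_gt0.
Qed.

(** Legendre's formula: the exponent of [p] is the sum over [k] of [(n + n) %/ p ^ k] minus twice
    [n %/ p ^ k]. Each term is 0 or 1, and 0 as soon as [p ^ k] exceeds [n + n]. *)
Lemma pfactor_central p n : prime p -> 0 < n -> p ^ logn p 'C(n + n, n) <= n + n.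
Proof.
move=> pp n0; have p1 := prime_gt1 pp; have p0 := prime_gt0 pp.
have E : logn p 'C(n + n, n) + (logn p n`! + logn p n`!) = logn p (n + n)`!.
  rewrite -(bin_fact (leq_addr n n)) addnK !lognM ?muln_gt0 ?fact_gt0 ?bin_gt0 ?leq_addr //.
have F m : m <= n + n -> logn p m`! = \sum_(1 <= k < (n + n).+1) m %/ p ^ k.
  move=> mn; rewrite logn_fact // [RHS](big_cat_nat _ (n := m.+1)) //=.
  rewrite [X in _ + X]big_nat_cond [X in _ + X]big1 ?addn0 // => k /andP[/andP[mk _] _].
  by rewrite divn_small // (leq_trans mk) // ltnW // ltn_expl.
have le : logn p 'C(n + n, n) <= \sum_(1 <= k < (n + n).+1) (p ^ k <= n + n).
  move: E; rewrite !F ?leq_addr // -big_split /=.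
  set A := \sum_(1 <= k < _) (_ + _) => E.
  rewrite -(leq_add2r A) E -big_split /=; apply: leq_sum => k _.
  have pk0 : 0 < p ^ k by rewrite expn_gt0 p0.
  have [le|gt] := leqP (p ^ k) (n + n); last by rewrite divn_small.
  have E1 := divn_eq n (p ^ k); have L1 := ltn_pmod n pk0.
  rewrite -ltnS ltn_divLR //; nia.
apply: leq_trans (_ : p ^ trunc_log p (n + n) <= _); last by apply: trunc_logP => //; lia.
rewrite leq_exp2l //; apply: leq_trans le _.
set t := trunc_log p (n + n).
have tn : t < (n + n).+1 by rewrite ltnS; apply: ltnW; apply: leq_trans (ltn_expl _ p1) _; apply: trunc_logP => //; lia.
rewrite (big_cat_nat _ (n := t.+1)) //= [X in _ + X]big_nat_cond [X in _ + X]big1 ?addn0.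
  apply: leq_trans (_ : \sum_(1 <= k < t.+1) 1 <= _); first by apply: leq_sum => k _; apply: leq_b1.
  by rewrite sum_nat_const_nat muln1 subn1.
move=> k /andP[/andP[tk _] _]; apply/eqP; rewrite eqb0 -ltnNge.
by apply: leq_trans (trunc_log_ltn _ p1) _; rewrite leq_exp2l.
Qed.

Definition primes_below N := [seq p <- iota 0 N | prime p].

Lemma mem_primes_below N p : (p \in primes_below N) = prime p && (p < N).
Proof. by rewrite mem_filter mem_iota add0n. Qed.

Lemma uniq_primes_below N : uniq (primes_below N).
Proof. by rewrite filter_uniq // iota_uniq. Qed.

(** Chebyshev's argument with [n + n = 4 ^ g]: by [pfactor_central] the central binomial is at most
    [4 ^ g] to the number of its primes, so [n <= 2 * g] times that number, and [4 * g <= 2 ^ g]. *)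
Lemma many_primes g : 3 < g -> 2 ^ g <= size (primes_below (4 ^ g)).
Proof.
move=> g4; set n := 2 ^ (g + g - 1).
have nn : n + n = 4 ^ g.
  by rewrite addnn -mul2n -expnS -[4]/(2 ^ 2) -expnM; congr (2 ^ _); lia.
have n0 : 0 < n by rewrite expn_gt0.
set C := 'C(n + n, n); have C0 : 0 < C by rewrite bin_gt0 leq_addr.
have CE : C <= (n + n) ^ size (primes C).
  rewrite {1}(prod_prime_decomp C0) prime_decompE big_map /=.
  rewrite -[X in _ <= _ ^ X]count_predT -sum1_count expn_sum.
  have : all prime (primes C) by apply/allP => p; rewrite mem_primes => /andP[].
  elim: (primes C) => [|p s IH] /=; rewrite ?big_nil // => /andP[pp ss].
  by rewrite !big_cons expn1; apply: leq_mul; [exact: pfactor_central|exact: IH].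
have sz : size (primes C) <= size (primes_below (4 ^ g)).
  apply: uniq_leq_size; first exact: primes_uniq.
  move=> p; rewrite mem_primes => /and3P[pp _ pC]; rewrite mem_primes_below pp /= -nn.
  have : p <= n + n.
    apply: leq_trans (pfactor_central pp n0); rewrite -{1}(expn1 p) leq_exp2l ?prime_gt1 //.
    by rewrite -pfactor_dvdn.
  rewrite leq_eqVlt => /orP[/eqP pe|//].
  (* [primes_below] is strict, so [p = 4 ^ g] has to be excluded: it would be even and larger than
     2. *)
  have d2 : 2 %| p by rewrite pe nn dvdn_exp //; lia.
  move: d2; rewrite dvdn_prime2 // pe nn => /eqP e2.
  by have : 4 ^ 1 <= 4 ^ g; [rewrite leq_exp2l //; lia|rewrite -e2].
have expnD_g : 4 ^ g = 2 ^ (g + g) by rewrite -[4]/(2 ^ 2) -expnM; congr (2 ^ _); lia.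
have H : 2 ^ n <= 2 ^ ((g + g) * size (primes_below (4 ^ g))).
  apply: leq_trans (leq_exp2_central n) _; apply: leq_trans CE _.
  rewrite nn expnM -expnD_g leq_pexp2l // expn_gt0 //.
move: H; rewrite leq_exp2l //; set P := size _ => H.
have gg : g <= 2 ^ (g - 2).
  have [k ->] : exists k, g = k.+4 by exists (g - 4); lia.
  have -> : k.+4 - 2 = k.+2 by lia.
  by elim: k => // k IH; rewrite expnS; lia.
have E : n = 2 * (2 ^ (g - 2) * 2 ^ g) by rewrite -expnD -expnS; congr (2 ^ _); lia.
have : 2 ^ (g - 2) * 2 ^ g <= g * P by move: H; rewrite E; lia.
have g2 : 0 < 2 ^ g by rewrite expn_gt0.
move: gg g2; move: (2 ^ (g - 2)) (2 ^ g) => x y; nia.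
Qed.

Lemma prod_primes_dvd s Z : uniq s -> all prime s -> all (dvdn^~ Z) s -> \prod_(p <- s) p %| Z.
Proof.
elim: s => [|p s IH] /=; first by rewrite big_nil dvd1n.
move=> /andP[ps us] /andP[pp sp] /andP[pZ sZ]; rewrite big_cons Gauss_dvd ?pZ ?IH //.
elim: s ps sp {us sZ IH} => [|q s IH] /=; first by rewrite big_nil coprimen1.
rewrite inE negb_or => /andP[pq ps] /andP[qp sp]; rewrite big_cons coprimeMr IH // andbT.
by rewrite prime_coprime // dvdn_prime2.
Qed.

Lemma prod_primes_ge s : all prime s -> 2 ^ size s <= \prod_(p <- s) p.
Proof.
elim: s => [|p s IH] /=; first by rewrite big_nil.
by move=> /andP[/prime_gt1 p1 sp]; rewrite big_cons expnS leq_mul ?IH.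
Qed.

Lemma size_prime_divisors s Z k : uniq s -> all prime s -> 0 < Z -> Z < 2 ^ k ->
  size [seq p <- s | p %| Z] <= k.
Proof.
move=> us sp Z0 Zk; set t := filter _ _.
have tp : all prime t by apply/allP => p; rewrite mem_filter => /andP[_ /(allP sp)].
have tZ : \prod_(p <- t) p %| Z.
  by apply: prod_primes_dvd; rewrite ?filter_uniq //; apply: filter_all.
rewrite -(@leq_exp2l 2) //; apply: leq_trans (prod_primes_ge tp) _.
by apply: leq_trans (dvdn_leq Z0 tZ) _; apply: ltnW.
Qed.

Lemma prime_avoiding s Z k : uniq s -> all prime s -> 0 < Z -> Z < 2 ^ k -> k < size s ->
  exists2 p, p \in s & ~~ (p %| Z).
Proof.
move=> us sp Z0 Zk ks; have := size_prime_divisors us sp Z0 Zk.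
rewrite size_filter => le; have E := count_predC (fun p => p %| Z) s.
have : has (predC (fun p => p %| Z)) s.
  rewrite has_count -(ltn_add2l (count (fun p => p %| Z) s)) E addn0.
  exact: leq_ltn_trans le ks.
by move=> /hasP[p ps pZ]; exists p.
Qed.

(** Used for uniqueness in [bigsum]: two numbers below [bd] that agree modulo every [q < b] differ
    by such a [z]. *)
Lemma zero_of_small_divisors b k bd z : k < size (primes_below b) -> bd <= 2 ^ k ->
  (forall q, q < b -> 0 < q -> q %| z) -> z = 0 \/ bd <= z.
Proof.
move=> kb bdk H; have [|z0] := posnP z; [by left|right].
rewrite leqNgt; apply/negP => zb.
have sp : all prime (primes_below b) by apply/allP => p; rewrite mem_primes_below => /andP[].
have [p] := prime_avoiding (uniq_primes_below b) sp z0 (leq_trans zb bdk) kb.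
by rewrite mem_primes_below => /andP[/prime_gt0 p0 pb]; rewrite H.
Qed.

(** A prime that avoids the product of all pairwise differences separates the elements of [E]. In
    [d] the truncated subtractions add up to the distance, and the diagonal factors are set to 1 to
    keep the product positive. *)
Lemma mod_injective_prime b (E : seq nat) m k : all (ltn^~ m) E -> m <= 2 ^ k ->
  size E * size E * k + 1 < size (primes_below b) ->
  exists q, [/\ prime q, q < b & {in E &, injective (modn^~ q)}].
Proof.
move=> Em mk sz; pose d x y := if x == y then 1 else (x - y) + (y - x).
have d0 x y : 0 < d x y by rewrite /d; case: eqP => // xy; lia.
pose Z := \prod_(x <- E) \prod_(y <- E) d x y.
have Z0 : 0 < Z by do 2![apply: prodn_cond_gt0 => ? _].
have m0 : 0 < 2 ^ k by rewrite expn_gt0.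
have Zle : Z <= 2 ^ (size E * size E * k).
  have H (F : nat -> nat) c : (forall x, x \in E -> F x <= 2 ^ c) -> \prod_(x <- E) F x <= 2 ^ (size E * c).
    elim: (E) => [|x s IH] HF; first by rewrite big_nil.
    rewrite big_cons /= mulSn expnD leq_mul ?HF ?mem_head // IH // => y ys.
    by apply: HF; rewrite inE ys orbT.
  rewrite -mulnA; apply: (H) => x xE; apply: (H) => y yE.
  by apply: leq_trans mk; have := allP Em _ xE; have := allP Em _ yE; rewrite /d; case: eqP => _ /=; lia.
have sp : all prime (primes_below b) by apply/allP => p; rewrite mem_primes_below => /andP[].
have [||q] := prime_avoiding (k := size E * size E * k + 1) (uniq_primes_below b) sp Z0.
- by apply: leq_ltn_trans Zle _; rewrite ltn_exp2l // addn1.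
- by [].
rewrite mem_primes_below => /andP[qp qb] qZ; exists q; split=> // x y xE yE exy.
apply/eqP/negPn/negP => nxy; move/negP: qZ; apply.
rewrite /Z (big_rem x) //= dvdn_mulr // (big_rem y) //= dvdn_mulr // /d (negbTE nxy).
have [le|/ltnW le] := leqP x y.
  by have -> : x - y = 0 by [lia]; rewrite add0n -eqn_mod_dvd //; apply/eqP; rewrite exy.
by have -> : y - x = 0 by [lia]; rewrite addn0 -eqn_mod_dvd //; apply/eqP; rewrite exy.
Qed.

End Primes.

Section LinearAlgebra.
Import Order.TTheory GRing.Theory Num.Theory.
Local Open Scope ring_scope.

(** The Leibniz sum has at most [k ^ k] terms, since permutations inject into functions, and each
    term is at most [c ^ k]. *)
Lemma det_int_bound k (M : 'M[int]_k) (c : nat) : (forall i j, `|M i j| <= c)%N ->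
  (`|\det M| <= (k * c) ^ k)%N.
Proof.
move=> Mc; rewrite -lez_nat abszE.
apply: le_trans (ler_norm_sum _ _ _) _.
apply: (@le_trans _ _ (\sum_(s : {perm 'I_k}) (c ^ k)%N%:Z)).
  apply: ler_sum => s _; rewrite normrM normrX normrN1 expr1n mul1r normr_prod.
  rewrite (_ : (c ^ k)%N%:Z = c%:Z ^+ k); last by rewrite -!natz natrX.
  rewrite -[X in _ <= _ ^+ X](card_ord k) -prodr_const.
  by apply: ler_prod => i _; rewrite normr_ge0 /= -abszE lez_nat.
rewrite sumr_const -mulr_natl -natz -natrM !natz lez_nat.
rewrite expnMn leq_mul2r; apply/orP; right.
have inj : injective (fun s : {perm 'I_k} => finfun s).
  by move=> s1 s2 /ffunP E; apply/permP => i; have := E i; rewrite !ffunE.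
by have := leq_card _ inj; rewrite card_ffun card_ord.
Qed.

(** In a kernel vector over the rationals, the row of a coordinate of largest absolute value
    contradicts dominance. *)
Lemma diag_dominant_det k (M : 'M[int]_k) :
  (forall i, \sum_(j | j != i) `|M i j| < `|M i i|) -> \det M != 0.
Proof.
move=> HM; apply/negP => /eqP d0.
have : \det (map_mx (intr : int -> rat) M) = 0 by rewrite det_map_mx d0.
(* [det0P] yields a vector in the left kernel, whereas dominance is by rows; hence the transpose. *)
move=> dQ; have /det0P[v v0 vM] : \det (map_mx (intr : int -> rat) M)^T == 0 by rewrite det_tr dQ.
have [i0] : exists i, v 0 i != 0.
  apply/existsP; apply: contraNT v0; rewrite negb_exists => /forallP H.
  by apply/eqP/rowP => i; rewrite mxE; apply/eqP; have := H i; rewrite negbK.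
move=> vi0; pose i := [arg max_(i > i0) `|v 0 i|]%O.
have imax j : `|v 0 j| <= `|v 0 i| by rewrite /i; case: arg_maxP => // x _; apply.
have vi : 0 < `|v 0 i| by apply: lt_le_trans (imax i0); rewrite normr_gt0.
have := congr1 (fun A : 'rV_k => A 0 i) vM; rewrite !mxE (bigD1 i) //= !mxE => /eqP.
rewrite addr_eq0 => /eqP E.
have : `|v 0 i| * `|(M i i)%:~R| <= `|v 0 i| * \sum_(j | j != i) `|(M i j)%:~R : rat|.
  rewrite -normrM E normrN; apply: le_trans (ler_norm_sum _ _ _) _.
  by rewrite mulr_sumr; apply: ler_sum => j _; rewrite !mxE normrM ler_wpM2r.
rewrite ler_pM2l // => H; have := HM i; rewrite ltNge => /negP; apply.
rewrite -(ler_int rat) intr_norm; apply: le_trans H _.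
by rewrite rmorph_sum; apply: ler_sum => j _; rewrite /= intr_norm.
Qed.

Section LeadingMinors.
Variable R : comNzRingType.
Variable A : nat -> nat -> R.
Definition lmx k : 'M[R]_k := \matrix_(i, j) A i j.

(** Cramer's rule for the last coordinate: the cofactor at the last diagonal position is the
    previous leading minor. *)
Lemma lmx_pivot k (v : 'cV[R]_k.+1) : lmx k.+1 *m v = delta_mx ord_max 0 ->
  \det (lmx k.+1) * v ord_max 0 = \det (lmx k).
Proof.
move=> Hv; have := congr1 (mulmx (\adj (lmx k.+1))) Hv.
rewrite mulmxA mul_adj_mx mul_scalar_mx => /(congr1 (fun B : 'cV_k.+1 => B ord_max 0)).
rewrite !mxE (bigD1 ord_max) //= !mxE !eqxx mulr1 big1 ?addr0; last first.
  by move=> i ni; rewrite !mxE (negbTE ni) mulr0.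
move=> ->; rewrite /cofactor addnn -signr_odd odd_double expr0 mul1r; congr (\det _).
apply/matrixP => i j; rewrite !mxE /lift /=; congr (A _ _).
  by rewrite /bump leqNgt ltn_ord.
by rewrite /bump leqNgt ltn_ord.
Qed.

(** The quotients of consecutive minors telescope. Guessed solutions of the [k] systems thus certify
    the inverse of the determinant without any elimination. *)
Lemma lmx_pivots k (v : forall i, 'cV[R]_i.+1) :
  (forall i, (i < k)%N -> lmx i.+1 *m v i = delta_mx ord_max 0) ->
  \det (lmx k) * \prod_(i < k) v i ord_max 0 = 1.
Proof.
elim: k => [|k IH] Hv; first by rewrite det_mx00 big_ord0 mulr1.
rewrite big_ord_recr /= [_ * v k _ _]mulrC mulrA lmx_pivot ?Hv //.
by apply: IH => i ik; apply: Hv; apply: ltnW.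
Qed.

End LeadingMinors.

Lemma lmx_solvable (F : fieldType) (A : nat -> nat -> F) k : \det (lmx A k.+1) != 0 ->
  exists v : 'cV_k.+1, lmx A k.+1 *m v = delta_mx ord_max 0.
Proof.
move=> dA; exists (invmx (lmx A k.+1) *m delta_mx ord_max 0).
by rewrite mulmxA mulmxV ?mul1mx // unitmxE unitfE.
Qed.

Section Woodbury.
Variables (F : fieldType) (m k : nat).
Variables (B D : 'M[F]_m) (P : 'M[F]_(m, k)).
Hypotheses (Bu : B \in unitmx) (DP : D *m (P *m P^T) = D).
Let N := invmx B.
Let G : 'M[F]_k := 1%:M + P^T *m N *m D *m P.

(** Kernel vectors correspond: [P^T] sends the kernel of [B + D] to that of [G], and [z] in the
    kernel of [G] comes from [- N D P z]. For a 0/1 selection matrix [P], the hypothesis [DP] says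
    that [D] vanishes in the columns that are not selected. *)
Lemma woodbury_unit : (G \in unitmx) = (B + D \in unitmx).
Proof.
have unitP r (M : 'M[F]_r) : reflect (forall z : 'cV_r, M *m z = 0 -> z = 0) (M \in unitmx).
  apply: (iffP idP) => [Mu z Mz|H].
    by rewrite -(mul1mx z) -(mulVmx Mu) -mulmxA Mz mulmx0.
  rewrite -unitmx_tr -row_free_unit -kermx_eq0; apply/eqP/row_matrixP => i; rewrite row0.
  apply: trmx_inj; rewrite trmx0; apply: H.
  by apply: trmx_inj; rewrite trmx_mul trmxK trmx0 -row_mul mulmx_ker row0.
have NB : N *m B = 1%:M by apply: mulVmx.
apply/unitP/unitP => H z Hz.
  have Hz' : z + N *m D *m z = 0.
    by rewrite -{1}(mul1mx z) -NB -!mulmxA -mulmxDr -mulmxDl Hz mulmx0.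
  have Pz : P^T *m z = 0.
    apply: H; rewrite mulmxDl mul1mx -!mulmxA (mulmxA P) (mulmxA D) DP.
    by rewrite (mulmxA N) -mulmxDr Hz' mulmx0.
  have Dz : D *m z = 0 by rewrite -DP -!mulmxA Pz !mulmx0.
  by rewrite -Hz' -mulmxA Dz mulmx0 addr0.
pose y := - (N *m D *m P *m z).
have Py : P^T *m y = z.
  have := Hz; rewrite mulmxDl mul1mx => /eqP; rewrite addr_eq0 => /eqP ->.
  by rewrite /y mulmxN !mulmxA.
rewrite -Py [y]H ?mulmx0 //.
rewrite mulmxDl; have -> : D *m y = D *m P *m z by rewrite -[in LHS]DP -!mulmxA Py.
by rewrite /y mulmxN !mulmxA /N mulmxV // mul1mx addNr.
Qed.

(** The selected coordinates of a column of the new inverse solve a system of size [k] built from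
    the old inverse; this is the system to which Cramer's rule is applied. *)
Lemma woodbury_solution (t : 'cV[F]_m) : B + D \in unitmx ->
  G *m (P^T *m (invmx (B + D) *m t)) = P^T *m (N *m t).
Proof.
move=> Hu; set y := invmx _ *m t.
have Hy : (B + D) *m y = t by rewrite /y mulmxA mulmxV // mul1mx.
rewrite /G mulmxDl mul1mx -!mulmxA (mulmxA P) (mulmxA D) DP -mulmxDr; congr (_ *m _).
by rewrite -Hy mulmxDl mulmxDr [N *m (B *m _)]mulmxA /N mulVmx // mul1mx.
Qed.

End Woodbury.

(* Cramer: replacing column [a] by [c - r * column] gives a singular matrix
   exactly when [r] is the [a]-th coordinate of the solution. *)
Lemma cramer_singular (F : fieldType) k (G : 'M[F]_k) (z c : 'cV[F]_k) (a : 'I_k) (r : F) :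
  G \in unitmx -> G *m z = c ->
  (\det (\matrix_(i, j) (if j == a then c i 0 - r * G i j else G i j)) == 0) = (z a 0 == r).
Proof.
move=> Gu Gz; set M := \matrix_(i, j) _.
(* The identity with column [a] replaced by [z - r e_a]; its determinant is [z a 0 - r]. *)
pose E : 'M[F]_k := \matrix_(i, j) (if j == a then z i 0 - r * (i == a)%:R else (i == j)%:R).
have -> : M = G *m E.
  apply/matrixP => i j; rewrite !mxE; case: eqP => [->|ja].
    rewrite -Gz mxE [RHS](eq_bigr (fun l => G i l * z l 0 - G i l * r * (l == a)%:R)); last first.
      by move=> l _; rewrite /E mxE eqxx mulrBr mulrA.
    rewrite sumrB; congr (_ - _); rewrite (bigD1 a) //= eqxx mulr1 big1 ?addr0 1?mulrC // => l la.
    by rewrite (negbTE la) mulr0.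
  rewrite (bigD1 j) //= /E !mxE; move/eqP/negbTE: (ja) => ->; rewrite eqxx mulr1 big1 ?addr0 // => l la.
  by rewrite !mxE; move/eqP/negbTE: (ja) => ->; rewrite (negbTE la) mulr0.
rewrite det_mulmx mulf_eq0; move: Gu; rewrite unitmxE unitfE => /negbTE -> /=.
suff -> : \det E = z a 0 - r by rewrite subr_eq0.
rewrite (expand_det_row _ a) (bigD1 a) //= big1 ?addr0; last first.
  by move=> j ja; rewrite !mxE (negbTE ja) eq_sym (negbTE ja) mul0r.
rewrite !mxE !eqxx mulr1 /cofactor addnn -signr_odd odd_double expr0 mul1r.
rewrite (_ : row' _ _ = 1%:M) ?det1 ?mulr1 //.
apply/matrixP => i j; rewrite !mxE.
have /negbTE -> : lift a j != a by rewrite eq_sym neq_lift.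
by rewrite (inj_eq lift_inj).
Qed.

(* Chinese remainder representation: [p] divides [D] exactly when the sum of
   the fractions [c q / q] is close to an integer. *)
Lemma crr_dvd (qs : seq nat) (p H b : nat) (D : int) (c : nat -> nat) :
  let Q := (\prod_(q <- qs) q)%N in
  let S := (\sum_(q <- qs) (c q * H) %/ q)%N in
  uniq qs -> all prime qs -> prime p -> p \notin qs -> (size qs <= b)%N ->
  H = (p * (4 * b + 8) + 1)%N -> (H * `|D| <= Q)%N ->
  (forall q, q \in qs -> (q%:Z %| (c q * p * (Q %/ q))%N%:Z - D)%Z) ->
  (p%:Z %| D)%Z <-> ((S + b + 1) %% H <= b + 2)%N.
Proof.
move=> Q S uq pq pp pqs szb HE HD Hc.
pose u := (\sum_(q <- qs) c q * (Q %/ q))%N.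
have Qq q : q \in qs -> (q %| Q)%N by move=> qi; rewrite /Q (big_rem q) //= dvdn_mulr.
have q0 q : q \in qs -> (0 < q)%N by move=> /(allP pq)/prime_gt0.
have Q0 : (0 < Q)%N.
  by rewrite /Q big_seq_cond; apply: prodn_cond_gt0 => q /andP[/q0].
(* Modulo [q] only the summand of [q] survives in [p * u], so [p * u] and [D] agree modulo [Q]. As
   [p] is prime to [Q], it divides [D] exactly when it divides [t]. *)
have [t Ht] : exists t : int, (p * u)%N%:Z = D + t * Q%:Z.
  suff /dvdzP[t Ht] : (Q%:Z %| (p * u)%N%:Z - D)%Z by exists t; rewrite -Ht addrC subrK.
  rewrite dvdzE /=; apply: prod_primes_dvd => //; apply/allP => q qi.
  have : (q%:Z %| (p * u)%N%:Z - D)%Z; last by rewrite dvdzE.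
  rewrite /u (big_rem q) //= mulnDr PoszD addrAC rpredD //.
    by rewrite mulnA [(p * _)%N]mulnC Hc.
  rewrite dvdzE /= dvdn_mull // big_seq; apply: dvdn_sum.
  move=> q'; rewrite mem_rem_uniq // inE => /andP[nq q'i].
  rewrite dvdn_mull //; have : (q %| Q)%N := Qq q qi.
  rewrite -{1}(divnK (Qq q' q'i)) Euclid_dvdM ?(allP pq) // => /orP[//|].
  by rewrite dvdn_prime2 ?(allP pq) // eq_sym (negbTE nq).
(* [S] approximates [H * u / Q] from below; rounding loses at most one per prime, hence at most
   [b]. *)
have L1 : (S * Q <= H * u)%N.
  rewrite /S /u big_distrl big_distrr /= big_seq [X in (_ <= X)%N]big_seq; apply: leq_sum => q qi.
  move: (Q %/ q)%N (divnK (Qq q qi)) => y <-.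
  rewrite mulnA mulnAC (_ : (H * _)%N = (c q * H * y)%N); last by ring.
  by rewrite leq_mul2r leq_trunc_div orbT.
have L2 : (H * u <= (S + b) * Q)%N.
  apply: (@leq_trans ((S + size qs) * Q)%N); last by rewrite leq_mul2r leq_add2l szb orbT.
  rewrite /S /u -sum1_size -big_split /= big_distrl big_distrr /= big_seq [X in (_ <= X)%N]big_seq; apply: leq_sum => q qi.
  move: (Q %/ q)%N (divnK (Qq q qi)) => y <-.
  rewrite [X in (_ <= X)%N]mulnA [X in (_ <= X)%N]mulnAC (_ : (H * _)%N = (c q * H * y)%N); last by ring.
  by rewrite leq_mul2r ltnW ?orbT // addn1 ltn_ceil // q0.
have p1 := prime_gt1 pp.
have Ap : (p%:Z %| D)%Z = (p%:Z %| t)%Z.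
  have cop : coprimez p%:Z Q%:Z.
    rewrite coprimezE /= prime_coprime //.
    apply/negP; rewrite Euclid_dvd_prod // big_has => /hasP[q qi].
    by rewrite dvdn_prime2 ?(allP pq q qi) // => /eqP e; move: pqs; rewrite e qi.
  have pu : (p%:Z %| (p * u)%N%:Z)%Z by rewrite PoszM dvdz_mulr.
  rewrite -(Gauss_dvdzl t cop); apply/idP/idP => dv.
    by rewrite (_ : t * Q%:Z = (p * u)%N%:Z - D) ?rpredB // Ht addrAC subrr add0r.
  by rewrite (_ : D = (p * u)%N%:Z - t * Q%:Z) ?rpredB // Ht addrK.
have b0 : (b + 2 < H)%N by rewrite HE; nia.
have modE (t' : int) (x r : nat) : (x%:Z = H%:Z * t' + r%:Z) -> (r < H)%N -> (x %% H = r)%N.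
  move=> E rH; have t0 : 0 <= t' by nia.
  by case: t' t0 E => // t' _ E; have -> : x = (t' * H + r)%N by [lia]; rewrite modnMDl modn_small.
have Qz : 0 < Q%:Z by [].
(* If [p] divides [t], then [u] is within [Q / H] of [t' * Q], so [S] lies between [H * t' - 1 - b]
   and [H * t' + 1]. Adding [b + 1] makes the residue range over 0 to [b + 2]. *)
rewrite Ap; split.
  move=> /dvdzP[t' tE].
  have E : D = p%:Z * (u%:Z - t' * Q%:Z) by rewrite mulrBr -PoszM Ht tE; ring.
  set dl := u%:Z - t' * Q%:Z in E.
  have Hdl : H%:Z * `|dl| <= Q%:Z.
    have : (H * `|dl| <= Q)%N by apply: leq_trans HD; rewrite E abszM leq_mul2l leq_pmull ?orbT //=; lia.
    by rewrite -lez_nat PoszM abszE.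
  have S1 : S%:Z <= H%:Z * t' + 1.
    rewrite -(ler_pM2r Qz); apply: (@le_trans _ _ (H%:Z * u%:Z)); first by rewrite -!PoszM lez_nat.
    have -> : u%:Z = dl + t' * Q%:Z by rewrite /dl subrK.
    have : H%:Z * dl <= H%:Z * `|dl| by rewrite ler_wpM2l // ler_norm.
    have -> : H%:Z * (dl + t' * Q%:Z) = H%:Z * dl + H%:Z * t' * Q%:Z by ring.
    have -> : (H%:Z * t' + 1) * Q%:Z = Q%:Z + H%:Z * t' * Q%:Z by ring.
    rewrite lerD2r; lia.
  have S2 : H%:Z * t' - 1 <= S%:Z + b%:Z.
    rewrite -(ler_pM2r Qz); apply: (@le_trans _ _ (H%:Z * u%:Z)); last by rewrite -PoszD -!PoszM lez_nat.
    have -> : u%:Z = dl + t' * Q%:Z by rewrite /dl subrK.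
    have : - (H%:Z * `|dl|) <= H%:Z * dl by rewrite -mulrN ler_wpM2l // lerNl -normrN ler_norm.
    have -> : H%:Z * (dl + t' * Q%:Z) = H%:Z * dl + H%:Z * t' * Q%:Z by ring.
    have -> : (H%:Z * t' - 1) * Q%:Z = - Q%:Z + H%:Z * t' * Q%:Z by ring.
    rewrite lerD2r; lia.
  pose r := absz (S%:Z + b%:Z + 1 - H%:Z * t')%R.
  have rE : r%:Z = S%:Z + b%:Z + 1 - H%:Z * t' by rewrite /r gez0_abs //; lia.
  by rewrite (modE t' _ r) //; lia.
(* Otherwise the fractional part of [u / Q] is about [r / p] with [0 < r < p]. Since [H] is just
   above [p * (4 * b + 8)], scaling by [H] keeps it [4 * b + 8] away from both ends, more than
   rounding can undo. *)
move=> Hm; apply/negPn/negP => nt.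
have pz : 0 < p%:Z by rewrite ltz_nat ltnW.
have tE := divz_eq t p%:Z; have r0 := modz_ge0 t (lt0r_neq0 pz); have rp := ltz_pmod t pz.
have rn : (t %% p)%Z != 0 by apply: contra nt => /eqP e; apply/dvdz_mod0P.
set t' := (t %/ p)%Z in tE; set r := (t %% p)%Z in tE r0 rp rn.
have rz : 1 <= r by lia.
have HDz : H%:Z * `|D| <= Q%:Z by rewrite -abszE -PoszM lez_nat.
have Hu : p%:Z * (H%:Z * u%:Z) = H%:Z * D + H%:Z * t * Q%:Z.
  have -> : p%:Z * (H%:Z * u%:Z) = H%:Z * (p * u)%N%:Z by rewrite PoszM; ring.
  by rewrite Ht; ring.
have S1 : p%:Z * S%:Z <= H%:Z * t + 1.
  rewrite -(ler_pM2r Qz) -mulrA; apply: (@le_trans _ _ (p%:Z * (H%:Z * u%:Z))).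
    by rewrite ler_pM2l // -!PoszM lez_nat.
  have : H%:Z * D <= H%:Z * `|D| by rewrite ler_wpM2l // ler_norm.
  rewrite Hu mulrDl mul1r [_ + Q%:Z]addrC lerD2r; lia.
have S2 : H%:Z * t - 1 <= p%:Z * (S%:Z + b%:Z).
  rewrite -(ler_pM2r Qz) -mulrA; apply: (@le_trans _ _ (p%:Z * (H%:Z * u%:Z))); last first.
    by rewrite ler_pM2l // -PoszD -!PoszM lez_nat.
  have : - (H%:Z * `|D|) <= H%:Z * D by rewrite -mulrN ler_wpM2l // lerNl -normrN ler_norm.
  rewrite Hu mulrBl mul1r [_ - Q%:Z]addrC lerD2r; lia.
have Hz : H%:Z = p%:Z * (4 * b%:Z + 8) + 1 by rewrite HE; lia.
have S3 : S%:Z <= H%:Z * t' + H%:Z - (4 * b%:Z + 8).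
  rewrite -(ler_pM2l pz); apply: le_trans S1 _; rewrite tE.
  have : H%:Z * r <= H%:Z * (p%:Z - 1) by rewrite ler_wpM2l //; lia.
  have -> : p%:Z * (H%:Z * t' + H%:Z - (4 * b%:Z + 8)) = H%:Z * (t' * p%:Z) + (H%:Z * (p%:Z - 1) + 1) by rewrite !Hz; ring.
  rewrite mulrDr; lia.
have S4 : H%:Z * t' + (4 * b%:Z + 8) <= S%:Z + b%:Z.
  rewrite -(ler_pM2l pz); apply: le_trans S2; rewrite tE.
  have : H%:Z <= H%:Z * r by rewrite ler_peMr.
  have -> : p%:Z * (H%:Z * t' + (4 * b%:Z + 8)) = H%:Z * (t' * p%:Z) + (H%:Z - 1) by rewrite !Hz; ring.
  rewrite mulrDr; lia.
pose x := absz (S%:Z + b%:Z + 1 - H%:Z * t')%R.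
have xE : x%:Z = S%:Z + b%:Z + 1 - H%:Z * t' by rewrite /x gez0_abs //; lia.
by move: Hm; rewrite (modE t' _ x) //; lia.
Qed.

End LinearAlgebra.

From mathcomp Require Import all_classical.

(** * First-order definable numbers *)

Section Definability.
Variables (J : Type) (ain aout : nat) (ar : J -> nat).
Notation form := (formula ain aout ar).

Definition rlift k k' (f : 'I_k -> 'I_k') (i : 'I_k.+1) : 'I_k'.+1 :=
  if unlift ord0 i is Some j then lift ord0 (f j) else ord0.

Fixpoint frename k (f : form k) : forall k', ('I_k -> 'I_k') -> form k' :=
  match f in formula _ _ _ k return forall k', ('I_k -> 'I_k') -> form k' with
  | FEq _ x y => fun k' h => FEq ain aout ar (h x) (h y)
  | FRel _ s xs => fun k' h => FRel (map_tuple h xs)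
  | FNot _ g => fun k' h => FNot (frename g h)
  | FAnd _ g1 g2 => fun k' h => FAnd (frename g1 h) (frename g2 h)
  | FExists _ g => fun k' h => FExists (frename g (rlift h))
  end.

Lemma eval_frename n (I : {set ain.-tuple 'I_n}) (X : aux_state aout ar n) k
    (f : form k) k' (h : 'I_k -> 'I_k') (e : k'.-tuple 'I_n) :
  eval I X (frename f h) e = eval I X f [tuple tnth e (h i) | i < k].
Proof.
elim: f k' h e => {k} [k x y|k s xs|k g IH|k g1 IH1 g2 IH2|k g IH] k' h e /=.
- by rewrite !tnth_mktuple.
- rewrite (_ : map_tuple _ (map_tuple _ _) = map_tuple (tnth [tuple tnth e (h i) | i < k]) xs) //.
  by apply: eq_from_tnth => i; rewrite !tnth_map tnth_ord_tuple.
- by rewrite IH.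
- by rewrite IH1 IH2.
- apply: eq_existsb => a; rewrite IH; congr (eval _ _ _ _).
  apply: eq_from_tnth => i; rewrite tnth_mktuple /rlift.
  by case: unliftP => [j|] ->; rewrite ?tnth0 // !tnthS tnth_mktuple.
Qed.

(* A finite structure with an assignment of [r] variables, so that definability
   is uniform in the size of the domain; sizes below 2 are left out. *)
Record world r := World {
  wn : nat;
  wI : {set ain.-tuple 'I_wn};
  wX : aux_state aout ar wn;
  we : r.-tuple 'I_wn }.
Arguments World {r wn} _ _ _.

Lemma World_eq r n (I : {set ain.-tuple 'I_n}) (X : aux_state aout ar n)
    (e e' : r.-tuple 'I_n) : tval e = tval e' -> World I X e = World I X e'.
Proof. by move=> /val_inj->. Qed.

Definition sat r (f : form r) (w : world r) := eval (wI w) (wX w) f (we w).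

Definition wren r r' (h : 'I_r -> 'I_r') (w : world r') : world r :=
  World (wI w) (wX w) [tuple tnth (we w) (h i) | i < r].

Lemma wren_comp r r' r'' (h : 'I_r -> 'I_r') (h' : 'I_r' -> 'I_r'') w :
  wren h (wren h' w) = wren (h' \o h) w.
Proof.
congr World; apply: eq_from_tnth => i.
by rewrite !tnth_mktuple.
Qed.

Definition dpred r (P : world r -> Prop) :=
  exists f : form r, forall w, 1 < wn w -> (sat f w <-> P w).

Lemma dpred_ext r (P Q : world r -> Prop) :
  (forall w, 1 < wn w -> (P w <-> Q w)) -> dpred P -> dpred Q.
Proof. by move=> PQ [f fP]; exists f => w w1; rewrite fP // PQ. Qed.

Lemma dpred_wk r r' (h : 'I_r -> 'I_r') (P : world r -> Prop) :
  dpred P -> dpred (fun w => P (wren h w)).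
Proof.
move=> [f fP]; exists (frename f h) => w w1.
by rewrite -(fP (wren h w)) // /sat eval_frename.
Qed.

Lemma dpred_not r (P : world r -> Prop) : dpred P -> dpred (fun w => ~ P w).
Proof.
move=> [f fP]; exists (FNot f) => w w1; rewrite -(fP w w1) /sat /=.
by split=> /negP.
Qed.

Lemma dpred_and r (P Q : world r -> Prop) :
  dpred P -> dpred Q -> dpred (fun w => P w /\ Q w).
Proof.
move=> [f fP] [g gQ]; exists (FAnd f g) => w w1.
by rewrite -(fP w w1) -(gQ w w1) /sat /=; split=> /andP.
Qed.

Lemma dpred_or r (P Q : world r -> Prop) :
  dpred P -> dpred Q -> dpred (fun w => P w \/ Q w).
Proof.
move=> dP dQ; apply: (@dpred_ext _ (fun w => ~ (~ P w /\ ~ Q w))).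
  by move=> w _; split=> [/not_andP[]/contrapT|[]]; tauto.
by apply/dpred_not/dpred_and; apply: dpred_not.
Qed.

Lemma dpred_imp r (P Q : world r -> Prop) :
  dpred P -> dpred Q -> dpred (fun w => P w -> Q w).
Proof.
move=> dP dQ; apply: (@dpred_ext _ (fun w => ~ P w \/ Q w)).
  by move=> w _; split=> [[]//|PQ]; have [/PQ|] := pselect (P w); tauto.
by apply/dpred_or => //; apply: dpred_not.
Qed.

Lemma dpred_iff r (P Q : world r -> Prop) :
  dpred P -> dpred Q -> dpred (fun w => P w <-> Q w).
Proof. by move=> dP dQ; apply: dpred_and; apply: dpred_imp. Qed.

Definition wcat r c (w : world r) (u : c.-tuple 'I_(wn w)) : world (c + r) :=
  World (wI w) (wX w) (cat_tuple u (we w)).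

Lemma dpred_extup r c (Q : world (c + r) -> Prop) :
  dpred Q -> dpred (fun w => exists u : c.-tuple 'I_(wn w), Q (wcat u)).
Proof.
have wcatE (w : world r) n (u : n.-tuple _) v :
    tval v = tval u ++ we w -> World (wI w) (wX w) v = wcat u.
  exact: World_eq.
elim: c Q => [|c IH] Q [f fQ].
  exists f => w w1; rewrite /sat; split=> [Hf|[u]].
    exists [tuple]; have -> : @wcat r 0 w [tuple] = w by case: w {w1 Hf} => n I X e; apply: (@World_eq r).
    exact/fQ.
  have -> : wcat u = w by case: w {w1} u => n I X e u; apply: (@World_eq r); rewrite /= (tuple0 u).
  by move/fQ; apply.
have [|g gP] := IH (fun w => exists a, Q (World (wI w) (wX w) (cons_tuple a (we w)))).
  exists (FExists f) => w w1; rewrite /sat /=.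
  split=> [/existsP[a Ha]|[a Ha]]; first by exists a; apply/fQ.
  by apply/existsP; exists a; apply/(fQ (World _ _ _)).
exists g => w w1; rewrite gP //; split.
  move=> [u [a Qa]]; exists (cons_tuple a u).
  by rewrite -(wcatE w c.+1 (cons_tuple a u) (cons_tuple a (cat_tuple u (we w)))).
move=> [u]; case/tupleP: u => a u Qa; exists u, a.
by rewrite (wcatE w c.+1 [tuple of a :: u] (cons_tuple a (cat_tuple u (we w)))).
Qed.

Definition dval n (u : seq 'I_n) : nat := foldr (fun (a : 'I_n) acc => a + n * acc) 0 u.
Definition numv r (vs : seq 'I_r) (w : world r) : nat :=
  dval [seq tnth (we w) i | i <- vs].

Lemma dval_lt n (u : seq 'I_n) : dval u < n ^ size u.
Proof.
elim: u => //= a u IH; rewrite expnS.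
have := ltn_ord a; move: IH; set y := dval u; set z := n ^ size u => yz an.
by apply: (@leq_trans (n + n * y)); [rewrite ltn_add2r | rewrite -mulnS leq_mul2l yz orbT].
Qed.

Lemma dval_surj n c y : 0 < n -> y < n ^ c -> exists u : c.-tuple 'I_n, dval u = y.
Proof.
move=> n0; elim: c y => [|c IH] y.
  by rewrite expn0 ltnS leqn0 => /eqP->; exists [tuple].
rewrite expnS => Hy.
have /IH[u Hu] : y %/ n < n ^ c by rewrite ltn_divLR // mulnC.
exists (cons_tuple (Ordinal (ltn_pmod y n0)) u) => /=.
by rewrite Hu addnC mulnC -divn_eq.
Qed.

Lemma dval_inj n (u v : seq 'I_n) : size u = size v -> dval u = dval v -> u = v.
Proof.
elim: u v => [|a u IH] [|b v] //= [Huv].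
have [an bn] := (ltn_ord a, ltn_ord b).
have n0 : 0 < n by apply: leq_ltn_trans an.
move=> H; have ab : a = b.
  apply: val_inj => /=; move/(congr1 (modn^~ n)): H.
  by rewrite !(addnC (nat_of_ord _)) ![n * _]mulnC !modnMDl !modn_small.
rewrite ab in H *; congr cons; apply: IH => //.
by move/addnI/eqP: H; rewrite eqn_pmul2l // => /eqP.
Qed.

(* A number-valued function of worlds is definable when it is polynomially
   bounded and its graph, on blocks of base-[n] digits, is definable. *)
Definition dterm r (t : world r -> nat) :=
  exists c, (forall w, 1 < wn w -> t w < wn w ^ c) /\
    forall r' (h : 'I_r -> 'I_r') (vs : seq 'I_r'), size vs = c ->
    dpred (fun w => numv vs w = t (wren h w)).

Lemma dpred_false r : dpred (fun w : world r => False).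
Proof.
have dQ : dpred (fun w : world (1 + r) => ~ (tnth (we w) ord0 = tnth (we w) ord0)).
  by apply: dpred_not; exists (FEq _ _ _ ord0 ord0) => w _; rewrite /sat /=; split=> // _.
by apply: dpred_ext (dpred_extup dQ) => w _; split=> // -[u]; case.
Qed.

Lemma dpred_const r (P : Prop) : dpred (fun w : world r => P).
Proof.
have [HP|HP] := pselect P.
  by apply: dpred_ext (dpred_not (@dpred_false r)) => w _; tauto.
by apply: dpred_ext (@dpred_false r) => w _; tauto.
Qed.

Lemma dpred_veq r (i j : 'I_r) : dpred (fun w => tnth (we w) i = tnth (we w) j :> nat).
Proof.
exists (FEq _ _ _ i j) => w _; rewrite /sat /=.
by split=> [/eqP->|/val_inj->].
Qed.

Lemma dpred_vle r (i j : 'I_r) : dpred (fun w => tnth (we w) i <= tnth (we w) j).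
Proof.
by exists (@FRel J ain aout ar r Le [tuple i; j]) => w _; rewrite /sat /= inE !tnth_map /=.
Qed.

Lemma dpred_vadd r (i j k : 'I_r) :
  dpred (fun w => tnth (we w) i + tnth (we w) j = tnth (we w) k).
Proof.
exists (@FRel J ain aout ar r Add [tuple i; j; k]) => w _; rewrite /sat /= inE !tnth_map /=.
by split=> /eqP.
Qed.

Lemma dpred_vmul r (i j k : 'I_r) :
  dpred (fun w => tnth (we w) i * tnth (we w) j = tnth (we w) k).
Proof.
exists (@FRel J ain aout ar r Mul [tuple i; j; k]) => w _; rewrite /sat /= inE !tnth_map /=.
by split=> /eqP.
Qed.

Lemma numv_cons r (i : 'I_r) vs w : numv (i :: vs) w = tnth (we w) i + wn w * numv vs w.
Proof. by []. Qed.

Lemma numv_wren r r' (h : 'I_r -> 'I_r') vs w :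
  numv vs (wren h w) = numv (map h vs) w.
Proof.
rewrite /numv -map_comp; congr dval; apply: eq_map => i /=.
by rewrite tnth_mktuple.
Qed.

Lemma numv_lt r (vs : seq 'I_r) w : numv vs w < wn w ^ size vs.
Proof. by rewrite -(size_map (fun i => tnth (we w) i)) dval_lt. Qed.

Definition uvars c r : seq 'I_(c + r) := [seq lshift r i | i <- enum 'I_c].

Lemma size_uvars c r : size (uvars c r) = c.
Proof. by rewrite size_map size_enum_ord. Qed.

Lemma numv_uvars c r (w : world r) (u : c.-tuple 'I_(wn w)) :
  numv (uvars c r) (wcat u) = dval u.
Proof.
rewrite /numv -map_comp; congr dval.
rewrite -[in RHS](map_tnth_enum u); apply: eq_map => i /=.
by rewrite tnth_lshift.
Qed.

Lemma wren_wcat c r (w : world r) (u : c.-tuple 'I_(wn w)) :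
  wren (@rshift c r) (wcat u) = w.
Proof.
case: w u => n I X e u; apply: World_eq; congr tval.
by apply: eq_from_tnth => i; rewrite tnth_mktuple /= tnth_rshift.
Qed.

Lemma dterm_wk r r' (h : 'I_r -> 'I_r') (t : world r -> nat) :
  dterm t -> dterm (fun w => t (wren h w)).
Proof.
move=> [c [tb tP]]; exists c; split=> [w w1|r'' h' vs sz]; first exact: tb (wren h w) _.
apply: dpred_ext (tP _ (h' \o h) vs sz) => w _.
by rewrite wren_comp.
Qed.

Lemma dpred_nat_vlt r (i j : 'I_r) : dpred (fun w => tnth (we w) i < tnth (we w) j).
Proof.
apply: dpred_ext (dpred_not (dpred_vle j i)) => w _.
by rewrite ltnNge; split=> /negP.
Qed.

Lemma dpred_v0 r (i : 'I_r) : dpred (fun w => tnth (we w) i = 0 :> nat).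
Proof.
apply: dpred_ext (dpred_vadd i i i) => w w1; lia.
Qed.

Lemma dpred_exv r (Q : world (1 + r) -> Prop) :
  dpred Q -> dpred (fun w => exists a : 'I_(wn w), Q (@wcat r 1 w [tuple a])).
Proof.
move=> /dpred_extup; apply: dpred_ext => w _; split=> [[u]|[a]].
  by case/tupleP: u => a u; rewrite (tuple0 u) => Ha; exists a; have -> : [tuple a] = [tuple of a :: [tuple]] by apply: val_inj.
by exists [tuple a].
Qed.

Lemma tnth_wcat0 r (w : world r) a : tnth (we (@wcat r 1 w [tuple a])) (lshift r ord0) = a.
Proof. by rewrite /= tnth_lshift. Qed.

Lemma tnth_wcatS r (w : world r) a i : tnth (we (@wcat r 1 w [tuple a])) (rshift 1 i) = tnth (we w) i.
Proof. by rewrite /= tnth_rshift. Qed.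

(** The vocabulary has no constants; 1 is recognised as the neutral element of the built-in
    multiplication. *)
Lemma dpred_v1 r (i : 'I_r) : dpred (fun w => tnth (we w) i = 1 :> nat).
Proof.
pose Q (w : world (1 + r)) := ~ (tnth (we w) (lshift r ord0) * tnth (we w) (rshift 1 i) = tnth (we w) (lshift r ord0)).
have dQ : dpred Q by apply: dpred_not; apply: dpred_vmul.
apply: dpred_ext (dpred_not (dpred_exv dQ)) => w w1; rewrite /Q.
split=> [H|Hi [a]]; last by rewrite tnth_wcat0 tnth_wcatS Hi muln1.
have {}H (a : 'I_(wn w)) : (a * tnth (we w) i)%N = a.
  by apply: contrapT => Ha; apply: H; exists a; rewrite tnth_wcat0 tnth_wcatS.
by have := H (Ordinal w1); rewrite mul1n.
Qed.

Lemma dpred_vsucc r (i j : 'I_r) : dpred (fun w => (tnth (we w) i).+1 = tnth (we w) j :> nat).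
Proof.
pose Q (w : world (1 + r)) := tnth (we w) (lshift r ord0) = 1 :> nat /\ tnth (we w) (rshift 1 i) + tnth (we w) (lshift r ord0) = tnth (we w) (rshift 1 j).
have dQ : dpred Q by apply: dpred_and; [apply: dpred_v1|apply: dpred_vadd].
apply: dpred_ext (dpred_exv dQ) => w w1; rewrite /Q; split=> [[a]|H].
  by rewrite tnth_wcat0 !tnth_wcatS => -[-> <-]; rewrite addn1.
by exists (Ordinal w1); rewrite tnth_wcat0 !tnth_wcatS /= addn1.
Qed.

(** [b] and [b'] are the carries in and out. A sum outside the domain is invisible to [Add], so an
    outgoing carry is expressed through the complement: [i + j + 1 = k + n] means
    [k + (n - 1 - j) = i]. *)
Lemma dpred_vaddc r (b b' : bool) (i j k : 'I_r) :
  dpred (fun w => tnth (we w) i + tnth (we w) j + b = tnth (we w) k + wn w * b').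
Proof.
have dmax (s : nat) (y z : 'I_s) : dpred (fun w => tnth (we w) y + tnth (we w) z = (wn w).-1).
  pose Q2 (w : world (1 + (1 + s))) := tnth (we w) (rshift 1 (lshift s ord0)) < tnth (we w) (lshift _ ord0).
  have dQ2 : dpred Q2 by apply: dpred_nat_vlt.
  pose Q (w : world (1 + s)) := tnth (we w) (rshift 1 y) + tnth (we w) (rshift 1 z) = tnth (we w) (lshift s ord0) /\
     ~ (exists a : 'I_(wn w), Q2 (@wcat (1 + s) 1 w [tuple a])).
  have dQ : dpred Q by apply: dpred_and (dpred_vadd _ _ _) (dpred_not (dpred_exv dQ2)).
  apply: dpred_ext (dpred_exv dQ) => w w1; rewrite /Q /Q2; split=> [[a]|H].
    rewrite !tnth_wcatS tnth_wcat0 => -[-> Ha].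
    have lt1 : (wn w).-1 < wn w by lia.
    have : ~ (a < (wn w).-1).
      by move=> aw; apply: Ha; exists (Ordinal lt1); rewrite tnth_wcat0 tnth_wcatS tnth_wcat0.
    by move: lt1 (ltn_ord a); rewrite /=; clear; move: (a : nat) => a0; lia.
  have lt1 : (wn w).-1 < wn w by lia.
  exists (Ordinal lt1); rewrite !tnth_wcatS tnth_wcat0; split=> // -[a].
  by rewrite tnth_wcat0 tnth_wcatS tnth_wcat0 /=; have := ltn_ord a; rewrite /=; lia.
have tE r' (w : world r') (y : 'I_(wn w)) : y < wn w by [].
case: b'; case: b.
- pose Q (w : world (1 + r)) := tnth (we w) (lshift r ord0) + tnth (we w) (rshift 1 j) = (wn w).-1 /\
    tnth (we w) (rshift 1 k) + tnth (we w) (lshift r ord0) = tnth (we w) (rshift 1 i).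
  have dQ : dpred Q by apply: dpred_and; [apply: dmax|apply: dpred_vadd].
  apply: dpred_ext (dpred_exv dQ) => w w1; rewrite /Q.
  have E (a : 'I_(wn w)) : Q (@wcat r 1 w [tuple a]) <-> a + tnth (we w) j = (wn w).-1 /\ tnth (we w) k + a = tnth (we w) i.
    by rewrite /Q !tnth_wcatS tnth_wcat0.
  split=> [[a /E]|H]; first by move: (tE _ _ (tnth (we w) j)); lia.
  have lt1 : (wn w).-1 - tnth (we w) j < wn w by lia.
  by exists (Ordinal lt1); apply/E; move: (tE _ _ (tnth (we w) j)); rewrite [Ordinal lt1 : nat]/=; lia.
- pose Q2 (w : world (1 + (1 + r))) := tnth (we w) (rshift 1 (rshift 1 k)) + tnth (we w) (rshift 1 (lshift r ord0)) = tnth (we w) (lshift _ ord0) /\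
     (tnth (we w) (lshift _ ord0)).+1 = tnth (we w) (rshift 1 (rshift 1 i)).
  have dQ2 : dpred Q2 by apply: dpred_and; [apply: dpred_vadd|apply: dpred_vsucc].
  pose Q (w : world (1 + r)) := tnth (we w) (lshift r ord0) + tnth (we w) (rshift 1 j) = (wn w).-1 /\
   exists a : 'I_(wn w), Q2 (@wcat (1 + r) 1 w [tuple a]).
  have dQ : dpred Q by apply: dpred_and (dmax _ _ _) (dpred_exv dQ2).
  apply: dpred_ext (dpred_exv dQ) => w w1.
  have E (a : 'I_(wn w)) : Q (@wcat r 1 w [tuple a]) <-> a + tnth (we w) j = (wn w).-1 /\
      exists a2 : 'I_(wn w), tnth (we w) k + a = a2 /\ a2.+1 = tnth (we w) i.
    rewrite /Q !tnth_wcatS tnth_wcat0; split=> -[-> [a2]]; rewrite ?/Q2.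
      by rewrite !tnth_wcatS !tnth_wcat0 => H; split=> //; exists a2.
    by move=> H; split=> //; exists a2; rewrite /Q2 !tnth_wcatS !tnth_wcat0.
  split=> [[a /E [H1 [a2 H2]]]|H]; first by move: (tE _ _ (tnth (we w) j)); lia.
  have lt1 : (wn w).-1 - tnth (we w) j < wn w by lia.
  have lt2 : (tnth (we w) i).-1 < wn w by move: (tE _ _ (tnth (we w) i)); lia.
  have lj := tE _ _ (tnth (we w) j); have li := tE _ _ (tnth (we w) i).
  by exists (Ordinal lt1); apply/E; split; [rewrite [Ordinal lt1 : nat]/=; lia|exists (Ordinal lt2)];
    rewrite [Ordinal lt1 : nat]/= [Ordinal lt2 : nat]/=; lia.
- pose Q (w : world (1 + r)) := tnth (we w) (rshift 1 i) + tnth (we w) (rshift 1 j) = tnth (we w) (lshift r ord0) /\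
     (tnth (we w) (lshift r ord0)).+1 = tnth (we w) (rshift 1 k).
  have dQ : dpred Q by apply: dpred_and; [apply: dpred_vadd|apply: dpred_vsucc].
  apply: dpred_ext (dpred_exv dQ) => w w1.
  have E (a : 'I_(wn w)) : Q (@wcat r 1 w [tuple a]) <-> tnth (we w) i + tnth (we w) j = a /\ a.+1 = tnth (we w) k.
    by rewrite /Q !tnth_wcatS tnth_wcat0.
  split=> [[a /E]|H]; first lia.
  have lt1 : tnth (we w) i + tnth (we w) j < wn w by move: (tE _ _ (tnth (we w) k)); lia.
  by exists (Ordinal lt1); apply/E; rewrite [Ordinal lt1 : nat]/=; lia.
- by apply: dpred_ext (dpred_vadd i j k) => w _; lia.
Qed.

Lemma dpred_eqv r (vs vs' : seq 'I_r) : size vs = size vs' ->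
  dpred (fun w => numv vs w = numv vs' w).
Proof.
elim: vs vs' => [|i vs IH] [|j vs'] //=; first by move=> _; apply: dpred_ext (@dpred_const _ True) => w _.
move=> [sz].
apply: dpred_ext (dpred_and (dpred_veq i j) (IH _ sz)) => w w1.
split=> [[H1 H2]|]; first by rewrite !numv_cons H1 H2.
move=> /dval_inj; rewrite /= !size_map sz => /(_ erefl) [-> H].
by rewrite /numv H.
Qed.

Lemma dpred_ltv r (vs vs' : seq 'I_r) : size vs = size vs' ->
  dpred (fun w => numv vs w < numv vs' w).
Proof.
elim: vs vs' => [|i vs IH] [|j vs'] //=.
  by move=> _; apply: dpred_ext (@dpred_const _ False) => w _; rewrite /numv.
move=> [sz].
apply: dpred_ext (dpred_or (IH _ sz) (dpred_and (dpred_eqv sz) (dpred_nat_vlt i j))) => w w1.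
rewrite !numv_cons; have := ltn_ord (tnth (we w) i); have := ltn_ord (tnth (we w) j).
move: (wn w) (numv vs w) (numv vs' w) (nat_of_ord (tnth (we w) i)) (nat_of_ord (tnth (we w) j)) => n a a' x y yn xn.
by split=> [|H]; [case; [nia|move=> []; nia]|have [aa|aa|aa] := ltngtP a a'; [left|nia|right; split=> //; nia]].
Qed.

(** School addition; the carry at each of the constantly many positions is guessed by a
    disjunction. *)
Lemma dpred_addv r (b : bool) (vs vs' vs'' : seq 'I_r) : size vs = size vs' -> size vs'' = (size vs).+1 ->
  dpred (fun w => numv vs w + numv vs' w + b = numv vs'' w).
Proof.
elim: vs vs' vs'' b => [|i vs IH] [|j vs'] [|k vs''] b //=.
  case: vs'' => // _ _; case: b.
    by apply: dpred_ext (dpred_v1 k) => w _; rewrite /numv /= muln0; lia.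
  by apply: dpred_ext (dpred_v0 k) => w _; rewrite /numv /= muln0; lia.
move=> [sz] [sz'].
pose R b' := dpred_and (dpred_vaddc b b' i j k) (IH vs' vs'' b' sz sz').
apply: dpred_ext (dpred_or (R true) (R false)) => w w1; rewrite !numv_cons.
have := ltn_ord (tnth (we w) i); have := ltn_ord (tnth (we w) j); have := ltn_ord (tnth (we w) k).
move: (numv vs w) (numv vs' w) (numv vs'' w) (nat_of_ord (tnth (we w) i)) (nat_of_ord (tnth (we w) j)) (nat_of_ord (tnth (we w) k)) w1.
move: (wn w) => n A B C x y z n1 zn yn xn; split.
  by move=> [[H1 H2]|[H1 H2]]; nia.
move=> H.
have [xy|xy] := leqP n (x + y + b); [left|right].
  have : n * (A + B + 1) + (x + y + b - n) = n * C + z by nia.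
  move/(congr1 (fun u => (u %/ n, u %% n))); rewrite ![n * _]mulnC !divnMDl ?modnMDl; try lia.
  rewrite !divn_small ?modn_small; try (by lia); try (by move: xn yn; case: (b) xy; lia).
  by case; lia.
have : n * (A + B) + (x + y + b) = n * C + z by nia.
move/(congr1 (fun u => (u %/ n, u %% n))); rewrite ![n * _]mulnC !divnMDl ?modnMDl; try lia.
rewrite !divn_small ?modn_small; try lia.
by case; lia.
Qed.

(* The additional leading digits are zero. *)
Lemma dterm_raise r (t : world r -> nat) c :
  (exists c0, c0 <= c /\ (forall w, 1 < wn w -> t w < wn w ^ c0) /\
    forall r' (h : 'I_r -> 'I_r') (vs : seq 'I_r'), size vs = c0 ->
    dpred (fun w => numv vs w = t (wren h w))) ->
  (forall w, 1 < wn w -> t w < wn w ^ c) /\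
    forall r' (h : 'I_r -> 'I_r') (vs : seq 'I_r'), size vs = c ->
    dpred (fun w => numv vs w = t (wren h w)).
Proof.
move=> [c0 [le [tb tP]]]; elim: c le => [|c IH].
  by rewrite leqn0 => /eqP le0; subst c0.
rewrite leq_eqVlt => /orP[/eqP<-//|]; rewrite ltnS => /IH[tb' tP'].
split=> [w w1|r' h vs]; first by apply: leq_trans (tb' w w1) _; rewrite leq_exp2l.
case/lastP: vs => // vs i; rewrite size_rcons => -[sz].
apply: dpred_ext (dpred_and (dpred_v0 i) (tP' _ h _ sz)) => w w1.
have -> : numv (rcons vs i) w = numv vs w + wn w ^ c * tnth (we w) i.
  rewrite -{}sz; elim: (vs) => [|j us IHu]; first by rewrite /numv /= muln0 !mul1n addn0.
  by rewrite rcons_cons !numv_cons IHu /= expnS mulnDr addnA mulnA.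
have tlt := tb' (wren h w) w1; have n0 : 0 < wn w ^ c by rewrite expn_gt0; lia.
split=> [[-> ->]|H]; first by rewrite muln0 addn0.
have i0 : tnth (we w) i = 0 :> nat.
  move: H tlt; case: (tnth (we w) i : nat) => // k; rewrite /= mulnS; lia.
by split=> //; rewrite -H i0 muln0 addn0.
Qed.

Lemma dterm_deg r (t1 t2 : world r -> nat) : dterm t1 -> dterm t2 ->
  exists c,
  ((forall w, 1 < wn w -> t1 w < wn w ^ c) /\
    forall r' (h : 'I_r -> 'I_r') (vs : seq 'I_r'), size vs = c ->
    dpred (fun w => numv vs w = t1 (wren h w))) /\
  ((forall w, 1 < wn w -> t2 w < wn w ^ c) /\
    forall r' (h : 'I_r -> 'I_r') (vs : seq 'I_r'), size vs = c ->
    dpred (fun w => numv vs w = t2 (wren h w))).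
Proof.
move=> [c1 H1] [c2 H2]; exists (maxn c1 c2).
split; apply: dterm_raise; [exists c1|exists c2]; split=> //; lia.
Qed.

(** Both values are quantified as digit blocks, padded to a common length. *)
Lemma dpred_blocks r (t1 t2 : world r -> nat) (S : nat -> nat -> nat -> Prop) :
  dterm t1 -> dterm t2 ->
  (forall r' (vs vs' : seq 'I_r'), size vs = size vs' ->
     dpred (fun w => S (wn w) (numv vs w) (numv vs' w))) ->
  dpred (fun w => S (wn w) (t1 w) (t2 w)).
Proof.
move=> d1 d2 dS; have [c [[b1 p1] [b2 p2]]] := dterm_deg d1 d2.
pose us := uvars c (c + r); pose us' := map (@rshift c (c + r)) (uvars c r).
have szu : size us = c by rewrite size_uvars.
have szu' : size us' = c by rewrite size_map size_uvars.
pose h := @rshift c (c + r) \o @rshift c r.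
have dQ := dpred_and (p1 _ h us szu) (dpred_and (p2 _ h us' szu') (dS _ us us' (etrans szu (esym szu')))).
apply: dpred_ext (dpred_extup (dpred_extup dQ)) => w w1.
have E1 (u' : c.-tuple 'I_(wn w)) (u : c.-tuple 'I_(wn w)) : numv us (@wcat _ c (wcat u') u) = dval u by exact: numv_uvars.
have E2 (u' : c.-tuple 'I_(wn w)) (u : c.-tuple 'I_(wn w)) : numv us' (@wcat _ c (wcat u') u) = dval u'.
  by rewrite -numv_wren wren_wcat numv_uvars.
have E3 (u' : c.-tuple 'I_(wn w)) (u : c.-tuple 'I_(wn w)) : wren h (@wcat _ c (wcat u') u) = w.
  by rewrite -wren_comp !wren_wcat.
split=> [[u' [u]]|HS]; first by rewrite E1 E2 E3 => -[-> [->]].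
have [u Hu] := @dval_surj _ c _ (ltnW w1) (b1 w w1).
have [u' Hu'] := @dval_surj _ c _ (ltnW w1) (b2 w w1).
by exists u', u; rewrite E1 E2 E3 Hu Hu'.
Qed.

Lemma dpred_eq r (t1 t2 : world r -> nat) : dterm t1 -> dterm t2 -> dpred (fun w => t1 w = t2 w).
Proof. by move=> d1 d2; apply: (dpred_blocks (S := fun _ x y => x = y)) => // *; apply: dpred_eqv. Qed.

Lemma dpred_lt r (t1 t2 : world r -> nat) : dterm t1 -> dterm t2 -> dpred (fun w => t1 w < t2 w).
Proof. by move=> d1 d2; apply: (dpred_blocks (S := fun _ x y => x < y)) => // *; apply: dpred_ltv. Qed.

Lemma dpred_le r (t1 t2 : world r -> nat) : dterm t1 -> dterm t2 -> dpred (fun w => t1 w <= t2 w).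
Proof.
move=> d1 d2; apply: dpred_ext (dpred_not (dpred_lt d2 d1)) => w _.
lia.
Qed.

Lemma dterm_numv r (vs : seq 'I_r) : dterm (numv vs).
Proof.
exists (size vs); split=> [w _|r' h us sz]; first exact: numv_lt.
apply: dpred_ext (dpred_eqv (etrans sz (esym (size_map h vs)))) => w _.
by rewrite numv_wren.
Qed.

Lemma dterm_var r (i : 'I_r) : dterm (fun w => tnth (we w) i : nat).
Proof.
have [c [b H]] := dterm_numv [:: i]; exists c; split=> [w w1|r' h vs sz].
  by have := b w w1; rewrite /numv /= muln0 addn0.
by apply: dpred_ext (H _ h vs sz) => w _; rewrite /numv /= muln0 addn0.
Qed.

Lemma dterm_ext r (t t' : world r -> nat) : (forall w, 1 < wn w -> t w = t' w) -> dterm t -> dterm t'.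
Proof.
move=> tt [c [b H]]; exists c; split=> [w w1|r' h vs sz]; first by rewrite -tt ?b.
by apply: dpred_ext (H _ h vs sz) => w w1; rewrite tt.
Qed.

(* Closed under renaming of the variables: the parameters may then be terms over
   any extension of the assignment, as in the scope of a quantifier. *)
Definition dp1 r (P : world r -> nat -> Prop) := forall r' (h : 'I_r -> 'I_r') x,
  dterm x -> dpred (fun w => P (wren h w) (x w)).
Definition dp2 r (P : world r -> nat -> nat -> Prop) := forall r' (h : 'I_r -> 'I_r') x y,
  dterm x -> dterm y -> dpred (fun w => P (wren h w) (x w) (y w)).
Definition dt1 r (F : world r -> nat -> nat) := forall r' (h : 'I_r -> 'I_r') x,
  dterm x -> dterm (fun w => F (wren h w) (x w)).
Definition dt2 r (F : world r -> nat -> nat -> nat) := forall r' (h : 'I_r -> 'I_r') x y,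
  dterm x -> dterm y -> dterm (fun w => F (wren h w) (x w) (y w)).

Lemma dp1_wk r r' (h : 'I_r -> 'I_r') P : dp1 P -> dp1 (fun w => P (wren h w)).
Proof. by move=> dP r'' h' x dx; apply: dpred_ext (dP _ (h' \o h) x dx) => w _; rewrite wren_comp. Qed.
Lemma dp2_wk r r' (h : 'I_r -> 'I_r') P : dp2 P -> dp2 (fun w => P (wren h w)).
Proof. by move=> dP r'' h' x y dx dy; apply: dpred_ext (dP _ (h' \o h) x y dx dy) => w _; rewrite wren_comp. Qed.
Lemma dt1_wk r r' (h : 'I_r -> 'I_r') P : dt1 P -> dt1 (fun w => P (wren h w)).
Proof. by move=> dP r'' h' x dx; apply: dterm_ext (dP _ (h' \o h) x dx) => w _; rewrite wren_comp. Qed.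
Lemma dt2_wk r r' (h : 'I_r -> 'I_r') P : dt2 P -> dt2 (fun w => P (wren h w)).
Proof. by move=> dP r'' h' x y dx dy; apply: dterm_ext (dP _ (h' \o h) x y dx dy) => w _; rewrite wren_comp. Qed.

Lemma dpred_ex r (t : world r -> nat) (P : world r -> nat -> Prop) :
  dterm t -> dp1 P -> dpred (fun w => exists y, y < t w /\ P w y).
Proof.
move=> dt dP; have [c [b _]] := dt.
pose h := @rshift c r.
have dQ := dpred_and (dpred_lt (dterm_numv (uvars c r)) (dterm_wk h dt)) (dP _ h _ (dterm_numv (uvars c r))).
apply: dpred_ext (dpred_extup dQ) => w w1; split=> [[u]|[y [yt Py]]].
  by rewrite wren_wcat numv_uvars => H; exists (dval u).
have [u Hu] := @dval_surj _ c _ (ltnW w1) (ltn_trans yt (b w w1)).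
by exists u; rewrite wren_wcat numv_uvars Hu.
Qed.

Lemma dpred_all r (t : world r -> nat) (P : world r -> nat -> Prop) :
  dterm t -> dp1 P -> dpred (fun w => forall y, y < t w -> P w y).
Proof.
move=> dt dP; have dnP : dp1 (fun w y => ~ P w y) by move=> r' h x dx; apply/dpred_not/dP.
apply: dpred_ext (dpred_not (dpred_ex dt dnP)) => w _; split=> [H y yt|H [y [/H]]//].
by apply: contrapT => Py; apply: H; exists y.
Qed.

Lemma dterm_graph r (B t : world r -> nat) : dterm B ->
  (forall w, 1 < wn w -> t w <= B w) -> dp1 (fun w y => t w = y) -> dterm t.
Proof.
move=> [c [b _]] tB dt; exists c; split=> [w w1|r' h vs sz]; first exact: leq_ltn_trans (tB w w1) (b w w1).
by apply: dpred_ext (dt _ h _ (dterm_numv vs)) => w _; split.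
Qed.

Lemma dterm0 r : dterm (fun _ : world r => 0).
Proof. by apply: dterm_ext (@dterm_numv r [::]) => w _. Qed.

Lemma dterm_add r (t1 t2 : world r -> nat) : dterm t1 -> dterm t2 -> dterm (fun w => t1 w + t2 w).
Proof.
move=> d1 d2; have [c [[b1 p1] [b2 p2]]] := dterm_deg d1 d2.
exists c.+1; split=> [w w1|r' h vs sz].
  by have := b1 w w1; have := b2 w w1; rewrite expnS; move: (wn w ^ c) => z; nia.
pose us := uvars c (c + r'); pose us' := map (@rshift c (c + r')) (uvars c r').
pose vs' := map (@rshift c (c + r')) (map (@rshift c r') vs).
have szu : size us = c by rewrite size_uvars.
have szu' : size us' = c by rewrite size_map size_uvars.
pose h' := @rshift c (c + r') \o (@rshift c r' \o h).
have szv : size vs' = (size us).+1 by rewrite szu !size_map.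
have dQ := dpred_and (p1 _ h' us szu) (dpred_and (p2 _ h' us' szu') (dpred_addv false (etrans szu (esym szu')) szv)).
apply: dpred_ext (dpred_extup (dpred_extup dQ)) => w w1.
have E1 (u' : c.-tuple 'I_(wn w)) (u : c.-tuple 'I_(wn w)) : numv us (@wcat _ c (wcat u') u) = dval u by exact: numv_uvars.
have E2 (u' : c.-tuple 'I_(wn w)) (u : c.-tuple 'I_(wn w)) : numv us' (@wcat _ c (wcat u') u) = dval u'.
  by rewrite -numv_wren wren_wcat numv_uvars.
have E3 (u' : c.-tuple 'I_(wn w)) (u : c.-tuple 'I_(wn w)) : wren h' (@wcat _ c (wcat u') u) = wren h w.
  by rewrite -wren_comp wren_wcat -wren_comp wren_wcat.
have E4 (u' : c.-tuple 'I_(wn w)) (u : c.-tuple 'I_(wn w)) : numv vs' (@wcat _ c (wcat u') u) = numv vs w.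
  by rewrite -!numv_wren !wren_wcat.
split=> [[u' [u]]|HS]; first by rewrite E1 E2 E3 E4 addn0 => -[-> [->]].
have [u Hu] := @dval_surj _ c _ (ltnW w1) (b1 (wren h w) w1).
have [u' Hu'] := @dval_surj _ c _ (ltnW w1) (b2 (wren h w) w1).
by exists u', u; rewrite E1 E2 E3 E4 addn0 Hu Hu'.
Qed.

Lemma dterm_mulwn r (t : world r -> nat) : dterm t -> dterm (fun w => wn w * t w).
Proof.
move=> [c [b p]]; exists c.+1; split=> [w w1|r' h [|i vs] //= [sz]].
  by rewrite expnS ltn_pmul2l ?b //; lia.
apply: dpred_ext (dpred_and (dpred_v0 i) (p _ h vs sz)) => w w1; rewrite numv_cons.
split=> [[-> ->] //|/=]; have := ltn_ord (tnth (we w) i).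
move: w1; move: (wn w) (numv vs w) (t _) (nat_of_ord (tnth (we w) i)) => n a y x n1 xn H.
have xa : x = 0.
  by move/(congr1 (modn^~ n)): H; rewrite addnC mulnC modnMDl modnMr modn_small.
by split=> //; apply/eqP; rewrite -(@eqn_pmul2l n) -?H ?xa //; lia.
Qed.

Lemma dterm1 r : dterm (fun _ : world r => 1).
Proof.
exists 1; split=> [w w1|r' h [|i []] // _]; first by rewrite expn1.
by apply: dpred_ext (dpred_v1 i) => w _; rewrite /numv /= muln0 addn0.
Qed.

Lemma dterm_const r k : dterm (fun _ : world r => k).
Proof.
elim: k => [|k IH]; first exact: dterm0.
by apply: dterm_ext (dterm_add IH (@dterm1 r)) => w _; rewrite addn1.
Qed.

Lemma dterm_wn r : dterm (fun w : world r => wn w).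
Proof. by apply: dterm_ext (dterm_mulwn (@dterm1 r)) => w _; rewrite muln1. Qed.

Lemma dterm_modwn r (t : world r -> nat) : dterm t -> dterm (fun w => t w %% wn w).
Proof.
move=> dt; apply: (dterm_graph (@dterm_wn r)) => [w w1|r' h x dx]; first by rewrite ltnW // ltn_mod; lia.
have dQ : dp1 (fun w y => x w < wn w /\ t (wren h w) = x w + wn w * y).
  move=> r'' h' y dy; apply: dpred_and; first by apply: dpred_lt; [apply: dterm_wk|apply: dterm_wn].
  apply: dpred_eq; first exact: (dterm_wk h' (dterm_wk h dt)).
  by apply: dterm_add; [apply: dterm_wk|apply: dterm_mulwn].
have ds : dterm (fun w => t (wren h w) + 1) by apply: dterm_add; [apply: dterm_wk|apply: dterm1].
apply: dpred_ext (dpred_ex ds dQ) => w w1; rewrite /=; split=> [[y [_ [xw ->]]]|<-].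
  by rewrite addnC mulnC modnMDl modn_small.
exists (t (wren h w) %/ wn w); rewrite addn1 ltnS leq_div ltn_mod; split=> //.
by split; [lia|rewrite addnC mulnC -divn_eq].
Qed.

Lemma dterm_divwn r (t : world r -> nat) : dterm t -> dterm (fun w => t w %/ wn w).
Proof.
move=> dt; apply: (dterm_graph dt) => [w w1|r' h x dx]; first exact: leq_div.
apply: dpred_ext (dpred_eq (dterm_wk h dt) (dterm_add (dterm_modwn (dterm_wk h dt)) (dterm_mulwn dx))) => w w1 /=.
rewrite {1}(divn_eq (t (wren h w)) (wn w)) addnC; split=> [/addnI/eqP|<-]; last by rewrite mulnC.
by rewrite mulnC eqn_pmul2l; [move/eqP|lia].
Qed.

(* A term of degree [c] is reached from digits by [x |-> d + n x]. *)
Lemma dterm_digit_ind r (T : (world r -> nat) -> Prop) :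
  (forall t t', (forall w, 1 < wn w -> t w = t' w) -> T t -> T t') ->
  T (fun _ => 0) ->
  (forall d t, dterm d -> dterm t -> (forall w, 1 < wn w -> d w < wn w) -> T t ->
     T (fun w => d w + wn w * t w)) ->
  forall t, dterm t -> T t.
Proof.
move=> Text T0 TS t dt; have [c [b _]] := dt; elim: c t dt b => [|c IH] t dt b.
  by apply: Text T0 => w w1; have := b w w1; rewrite expn0; lia.
apply: (@Text (fun w => t w %% wn w + wn w * (t w %/ wn w))).
  by move=> w _; rewrite addnC mulnC -divn_eq.
apply: TS; [exact: dterm_modwn|exact: dterm_divwn| |apply: IH; [exact: dterm_divwn|]] => w w1.
  by rewrite ltn_mod; lia.
by rewrite ltn_divLR -?expnSr ?b //; lia.
Qed.

End Definability.

Section Renaming.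
Variables (J : Type) (ain aout : nat) (ar : J -> nat).
Notation W := (world ain aout ar).

(** Inside nested quantifiers worlds appear as [wren h (wren h0 w)]. Abstracting the composite lets
    one closure lemma serve every nesting depth. *)
Definition renaming r r' (a : W r' -> W r) := exists h : 'I_r -> 'I_r', forall w, a w = wren h w.

Lemma wren_id r (w : W r) : wren id w = w.
Proof.
case: w => n I X e; apply: (@World_eq _ _ _ _ r); congr tval.
by apply: eq_from_tnth => i; rewrite tnth_mktuple.
Qed.

Lemma renaming_id r : renaming (fun w : W r => w).
Proof. by exists id => w; rewrite wren_id. Qed.

Lemma renaming_wren r r' r'' (h : 'I_r -> 'I_r') (a : W r'' -> W r') :
  renaming a -> renaming (fun w => wren h (a w)).
Proof. by move=> [h' ah]; exists (h' \o h) => w; rewrite ah wren_comp. Qed.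

Lemma renaming_comp r r' r'' (al : W r' -> W r) (be : W r'' -> W r') :
  renaming al -> renaming be -> renaming (fun w => al (be w)).
Proof. by move=> [h ah] [h' bh]; exists (h' \o h) => w; rewrite ah bh wren_comp. Qed.

Lemma dterm_ren r r' (t : W r -> nat) (a : W r' -> W r) : dterm t -> renaming a -> dterm (fun w => t (a w)).
Proof. by move=> dt [h ah]; apply: dterm_ext (dterm_wk h dt) => w _; rewrite ah. Qed.
Lemma dpred_ren r r' (t : W r -> Prop) (a : W r' -> W r) : dpred t -> renaming a -> dpred (fun w => t (a w)).
Proof. by move=> dt [h ah]; apply: dpred_ext (dpred_wk h dt) => w _; rewrite ah. Qed.
Lemma dp1_ren r r' P (a : W r' -> W r) : dp1 P -> renaming a -> dp1 (fun w => P (a w)).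
Proof. by move=> dP [h ah] r'' h' x dx; apply: dpred_ext (dp1_wk h dP h' dx) => w _; rewrite ah. Qed.
Lemma dp2_ren r r' P (a : W r' -> W r) : dp2 P -> renaming a -> dp2 (fun w => P (a w)).
Proof. by move=> dP [h ah] r'' h' x y dx dy; apply: dpred_ext (dp2_wk h dP h' dx dy) => w _; rewrite ah. Qed.
Lemma dt1_ren r r' P (a : W r' -> W r) : dt1 P -> renaming a -> dt1 (fun w => P (a w)).
Proof. by move=> dP [h ah] r'' h' x dx; apply: dterm_ext (dt1_wk h dP h' dx) => w _; rewrite ah. Qed.
Lemma dt2_ren r r' P (a : W r' -> W r) : dt2 P -> renaming a -> dt2 (fun w => P (a w)).
Proof. by move=> dP [h ah] r'' h' x y dx dy; apply: dterm_ext (dt2_wk h dP h' dx dy) => w _; rewrite ah. Qed.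

Lemma dp1_at r (P : W r -> nat -> Prop) x : dp1 P -> dterm x -> dpred (fun w => P w (x w)).
Proof. by move=> dP dx; apply: dpred_ext (dP _ id _ dx) => w _; rewrite wren_id. Qed.
Lemma dp2_at r (P : W r -> nat -> nat -> Prop) x y : dp2 P -> dterm x -> dterm y -> dpred (fun w => P w (x w) (y w)).
Proof. by move=> dP dx dy; apply: dpred_ext (dP _ id _ _ dx dy) => w _; rewrite wren_id. Qed.
Lemma dt1_at r (P : W r -> nat -> nat) x : dt1 P -> dterm x -> dterm (fun w => P w (x w)).
Proof. by move=> dP dx; apply: dterm_ext (dP _ id _ dx) => w _; rewrite wren_id. Qed.
Lemma dt2_at r (P : W r -> nat -> nat -> nat) x y : dt2 P -> dterm x -> dterm y -> dterm (fun w => P w (x w) (y w)).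
Proof. by move=> dP dx dy; apply: dterm_ext (dP _ id _ _ dx dy) => w _; rewrite wren_id. Qed.

Lemma dterm_wn_ren r r' (a : W r' -> W r) : renaming a -> dterm (fun w => wn (a w)).
Proof. by move=> ra; apply: (dterm_ren (dterm_wn _ _ _ _) ra). Qed.

Lemma dterm_sub r (x y : W r -> nat) : dterm x -> dterm y -> dterm (fun w => x w - y w).
Proof.
move=> dx dy; apply: (dterm_graph dx) => [w _|r' h z dz]; first exact: leq_subr.
have dx' := dterm_wk h dx; have dy' := dterm_wk h dy.
apply: dpred_ext (dpred_or (dpred_and (dpred_le dy' dx') (dpred_eq (dterm_add dz dy') dx'))
  (dpred_and (dpred_lt dx' dy') (dpred_eq dz (dterm0 _ _ _ _)))) => w _ /=; lia.
Qed.

(** What the built-in relation sees of multiplication; 0 is the default value for a product outside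
    the domain. *)
Definition smul n x y := if [&& x < n, y < n & x * y < n] then x * y else 0.

Lemma dterm_smul r (x y : W r -> nat) : dterm x -> dterm y -> dterm (fun w => smul (wn w) (x w) (y w)).
Proof.
move=> dx dy; apply: (dterm_graph (dterm_wn _ _ _ _)) => [w _|r' h z dz].
  by rewrite /smul; case: ifP => // /and3P[_ _ /ltnW].
pose i1 := Ordinal (erefl : 0 < 3); pose i2 := Ordinal (erefl : 1 < 3); pose i3 := Ordinal (erefl : 2 < 3).
have D s (f g k : W s -> nat) : dterm f -> dterm g -> dterm k ->
    dpred (fun w => f w < wn w /\ g w < wn w /\ k w < wn w /\ f w * g w = k w).
  move=> df dg dk.
  have dv (i : 'I_3) (t : W s -> nat) : dterm t -> dpred (fun w : W (3 + s) => tnth (we w) (lshift s i) = t (wren (@rshift 3 s) w) :> nat).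
    by move=> dt; apply: dpred_eq; [apply: dterm_var|apply: dterm_wk].
  have dQ := dpred_and (dv i1 _ df) (dpred_and (dv i2 _ dg) (dpred_and (dv i3 _ dk)
    (dpred_vmul _ _ _ (lshift s i1) (lshift s i2) (lshift s i3)))).
  apply: dpred_ext (dpred_extup dQ) => w w1.
  have E (u : 3.-tuple 'I_(wn w)) i : tnth (we (wcat u)) (lshift s i) = tnth u i by rewrite /= tnth_lshift.
  split=> [[u]|[H1 [H2 [H3 H4]]]].
    rewrite wren_wcat !E => -[<- [<- [<- H4]]].
    by have L (a : 'I_(wn w)) : a < wn w := ltn_ord a; split; [exact: L|split; [exact: L|split; [exact: L|]]].
  exists [tuple Ordinal H1; Ordinal H2; Ordinal H3].
  by rewrite wren_wcat !E.
have dx' := dterm_wk h dx; have dy' := dterm_wk h dy.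
have dn : dterm (fun w : W r' => wn w) by apply: dterm_wn.
have d0 : dterm (fun w : W r' => 0) by apply: dterm0.
have dex : dp1 (fun w : W r' => fun k => x (wren h w) < wn w /\ y (wren h w) < wn w /\ k < wn w /\ x (wren h w) * y (wren h w) = k).
  move=> r'' h' k dk; have := D _ _ _ _ (dterm_wk h' dx') (dterm_wk h' dy') dk.
  by apply: dpred_ext.
apply: dpred_ext (dpred_or (D _ _ _ _ dx' dy' dz) (dpred_and (dpred_not (dpred_ex dn dex)) (dpred_eq dz d0))) => w w1 /=.
rewrite /smul; split.
  case=> [[-> [-> [H1 H2]]]|[H1 H2]]; first by rewrite H2 H1.
  by case: ifP => // /and3P[? ? ?]; case: H1; exists (x (wren h w) * y (wren h w)).
case: ifP => [/and3P[? ? ?] <-|H <-]; [by left|right; split=> // -[k [? [? [? [? ?]]]]]].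
by move/negP: H; apply; apply/and3P; split=> //; lia.
Qed.

End Renaming.

(** * Proof search for definability *)

Ltac dren := cbv beta; match goal with
  | H : renaming ?al |- renaming ?al => exact H
  | |- renaming (fun w => w) => exact: renaming_id
  | |- renaming (fun w => wren ?h (@?a w)) => refine (@renaming_wren _ _ _ _ _ _ _ h a _); dren
  | H : renaming ?al |- renaming (fun w => ?al (@?b w)) => refine (renaming_comp (al := al) (be := b) H _); dren
  end.

(* Hooks of [dstep]: [dmul] is extended globally, [dext] inside sections. *)
Ltac dext := fail.
Ltac dmul := fail.

Ltac dintro := match goal with
  | |- dp1 _ => let h := fresh "h" in let x := fresh "x" in let dx := fresh "dx" in intros ? h x dx; cbv beta
  | |- dp2 _ => let h := fresh "h" in let x := fresh "x" in let y := fresh "y" in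
      let dx := fresh "dx" in let dy := fresh "dy" in intros ? h x y dx dy; cbv beta
  | |- dt1 _ => let h := fresh "h" in let x := fresh "x" in let dx := fresh "dx" in intros ? h x dx; cbv beta
  | |- dt2 _ => let h := fresh "h" in let x := fresh "x" in let y := fresh "y" in
      let dx := fresh "dx" in let dy := fresh "dy" in intros ? h x y dx dy; cbv beta
  end.

Ltac dstep := cbv beta; match goal with
  | |- renaming _ => dren
  | H : dterm ?t |- dterm ?t => exact H
  | H : dpred ?t |- dpred ?t => exact H
  | H : dt1 ?t |- dt1 ?t => exact H
  | H : dt2 ?t |- dt2 ?t => exact H
  | H : dp1 ?t |- dp1 ?t => exact H
  | H : dp2 ?t |- dp2 ?t => exact H
  | |- dterm (@wn _ _ _ _ _) => exact: dterm_wn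
  | |- dterm (fun _ => ?k) => exact: dterm_const
  | |- dterm (fun w => wn (@?a w)) => refine (@dterm_wn_ren _ _ _ _ _ _ a _)
  | H : dterm ?t |- dterm (fun w => ?t (@?a w)) => refine (dterm_ren (a := a) H _)
  | H : dpred ?t |- dpred (fun w => ?t (@?a w)) => refine (dpred_ren (a := a) H _)
  | H : dp1 ?t |- dp1 (fun w => ?t (@?a w)) => refine (dp1_ren (a := a) H _)
  | H : dp1 ?t |- dp1 (fun w y => ?t (@?a w) y) => refine (dp1_ren (a := a) H _)
  | H : dp2 ?t |- dp2 (fun w => ?t (@?a w)) => refine (dp2_ren (a := a) H _)
  | H : dp2 ?t |- dp2 (fun w y z => ?t (@?a w) y z) => refine (dp2_ren (a := a) H _)
  | H : dt1 ?t |- dt1 (fun w => ?t (@?a w)) => refine (dt1_ren (a := a) H _)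
  | H : dt1 ?t |- dt1 (fun w y => ?t (@?a w) y) => refine (dt1_ren (a := a) H _)
  | H : dt2 ?t |- dt2 (fun w => ?t (@?a w)) => refine (dt2_ren (a := a) H _)
  | H : dt2 ?t |- dt2 (fun w y z => ?t (@?a w) y z) => refine (dt2_ren (a := a) H _)
  | H : dt1 ?t |- dterm (fun w => ?t (@?a w) (@?x w)) => refine (@dt1_at _ _ _ _ _ (fun w => t (a w)) x _ _)
  | H : dt2 ?t |- dterm (fun w => ?t (@?a w) (@?x w) (@?y w)) => refine (@dt2_at _ _ _ _ _ (fun w => t (a w)) x y _ _ _)
  | H : dp1 ?t |- dpred (fun w => ?t (@?a w) (@?x w)) => refine (@dp1_at _ _ _ _ _ (fun w => t (a w)) x _ _)
  | H : dp2 ?t |- dpred (fun w => ?t (@?a w) (@?x w) (@?y w)) => refine (@dp2_at _ _ _ _ _ (fun w => t (a w)) x y _ _ _)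
  | |- dp1 _ => dintro
  | |- dp2 _ => dintro
  | |- dt1 _ => dintro
  | |- dt2 _ => dintro
  | |- dpred (fun _ => ?P) => exact: dpred_const
  | |- dpred (fun w => ~ _) => refine (dpred_not _)
  | |- dpred (fun w => _ /\ _) => refine (dpred_and _ _)
  | |- dpred (fun w => _ \/ _) => refine (dpred_or _ _)
  | |- dpred (fun w => _ <-> _) => refine (dpred_iff _ _)
  | |- dpred (fun w => exists y, is_true (y < @?t w) /\ @?P w y) => refine (@dpred_ex _ _ _ _ _ t P _ _)
  | |- dpred (fun w => forall y, is_true (y < @?t w) -> @?P w y) => refine (@dpred_all _ _ _ _ _ t P _ _)
  | |- dpred (fun w => is_true (_ < _)) => refine (dpred_lt _ _)
  | |- dpred (fun w => is_true (_ <= _)) => refine (dpred_le _ _)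
  | |- dpred (fun w => @eq nat _ _) => refine (dpred_eq _ _)
  | |- dpred (fun w => @?P w -> @?Q w) => refine (@dpred_imp _ _ _ _ _ P Q _ _)
  | |- dterm (fun w => _ + _) => refine (dterm_add _ _)
  | |- dterm (fun w => _ - _) => refine (dterm_sub _ _)
  | |- _ => dmul
  | |- _ => dext
  end.
Ltac dfn := repeat dstep.

(** * Multiplication beyond the domain *)

Section Multiplication.
Variables (J : Type) (ain aout : nat) (ar : J -> nat).
Notation W := (world ain aout ar).

(** For [n > 1] the largest [s] with [s * s < n]: products of numbers up to [s] stay inside the
    domain. *)
Definition rt n := find (fun s => n <= s.+1 * s.+1) (iota 0 n).

Lemma rtP n : 1 < n -> [/\ 0 < rt n, rt n * rt n < n & n <= (rt n).+1 * (rt n).+1].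
Proof.
move=> n1.
have hasP : has (fun s => n <= s.+1 * s.+1) (iota 0 n).
  by apply/hasP; exists n.-1; [rewrite mem_iota; lia|nia].
have := nth_find 0 hasP; rewrite -/(rt n) nth_iota; last by move: hasP; rewrite has_find size_iota.
rewrite add0n => H2; have H1 : rt n * rt n < n.
  case E : (rt n) => [|s]; first lia.
  have ls : s < rt n by rewrite E.
  have := before_find 0 (ls : s < find _ _); rewrite nth_iota ?add0n; last first.
    by apply: (leq_trans ls); rewrite /rt -[X in _ <= X](size_iota 0 n) find_size.
  by rewrite leqNgt => /negbFE.
split=> //; case E : (rt n) => //; move: H2; rewrite E /=; lia.
Qed.

Lemma rt_uniq n s : 1 < n -> s * s < n -> n <= s.+1 * s.+1 -> rt n = s.
Proof. move=> n1 H1 H2; have [_ H3 H4] := rtP n1; nia. Qed.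

(** Distinguishes a true product 0 from the default value 0. *)
Lemma smul_gt0 n x y : x < n -> y < n -> (x * y < n) <-> (x = 0 \/ y = 0 \/ 0 < smul n x y).
Proof.
move=> xn yn; rewrite /smul xn yn /=; case: ifP => H; split=> //.
  by case: (x) (y) H => [|x'] [|y'] H; [left|left|right;left|right;right; lia].
by case=> [x0|[y0|//]]; move: H; rewrite ?x0 ?y0 ?muln0; lia.
Qed.

Local Ltac dext ::= match goal with
  | |- dterm (fun w => smul _ _ _) => refine (dterm_smul _ _)
  | |- dterm (fun w => wn w * _) => refine (dterm_mulwn _)
  end.

Lemma dpred_smul_lt r (x y : W r -> nat) : dterm x -> dterm y ->
  dpred (fun w => x w < wn w /\ y w < wn w /\ x w * y w < wn w).
Proof.
move=> dx dy; have D : dpred (fun w => x w < wn w /\ y w < wn w /\ (x w = 0 \/ y w = 0 \/ 0 < smul (wn w) (x w) (y w))) by dfn.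
by apply: dpred_ext D => w _; split=> -[xn [yn H]]; (split=> //; split=> //); apply/(smul_gt0 xn yn).
Qed.

Lemma dterm_rt r : dterm (fun w : W r => rt (wn w)).
Proof.
apply: (dterm_graph (dterm_wn _ _ _ _)) => [w w1|r' h z dz]; first by have [] := rtP w1; nia.
have D1 : dpred (fun w => z w < wn w /\ z w < wn w /\ z w * z w < wn w) by apply: dpred_smul_lt; dfn.
have D2 : dpred (fun w => z w + 1 < wn w /\ z w + 1 < wn w /\ (z w + 1) * (z w + 1) < wn w) by apply: dpred_smul_lt; dfn.
apply: dpred_ext (dpred_and D1 (dpred_not D2)) => w w1 /=; split=> [[[H1 [_ H2]] H3]|<-].
  by apply: rt_uniq => //; apply: contrapT => H; apply: H3; rewrite addn1; split; [nia|split; nia].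
by have [] := rtP w1; rewrite addn1 => H1 H2 H3; split; [split; [nia|split=> //; nia]|case=> _ [_]; lia].
Qed.

(* [x * y] for digits, in terms of products below [n] and of shifts: write
   [x = s a + b1 + b2] with [s = rt n] and use [s ^ 2 = n - e], [e <= 3 s]. *)
Definition sdiv n x := x %/ rt n.
Definition smod n x := x - smul n (rt n) (sdiv n x).
Definition exc n := n - smul n (rt n) (rt n).
(** The excess [n - s ^ 2] can be as large as [2 * s + 1]; it is cut into three pieces of size at
    most [s], to which [smul] applies. *)
Definition exc1 n := minn (exc n) (rt n).
Definition exc2 n := minn (exc n - exc1 n) (rt n).
Definition exc3 n := exc n - exc1 n - exc2 n.
(** For [y = s * a + c] the product [s * y] is [s ^ 2 * a + s * c], where [s ^ 2 * a] is the shift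
    [n * a] minus the three pieces of the excess times [a]. [mulrt2] applies the same identity once
    more. *)
Definition mulrt n y := n * sdiv n y + smul n (rt n) (smod n y) -
  (smul n (exc1 n) (sdiv n y) + smul n (exc2 n) (sdiv n y) + smul n (exc3 n) (sdiv n y)).
Definition mulrt2 n y := n * smul n (rt n) (sdiv n y) + mulrt n (smul n (rt n) (smod n y)) -
  (mulrt n (smul n (exc1 n) (sdiv n y)) + mulrt n (smul n (exc2 n) (sdiv n y)) + mulrt n (smul n (exc3 n) (sdiv n y))).
(** The quotient by [s] can reach [s + 2]. It is capped at [s], and the remainder, at most [2 * s],
    is split into [lo1] and [lo2]. *)
Definition hi n x := minn (sdiv n x) (rt n).
Definition lo n x := x - smul n (rt n) (hi n x).
Definition lo1 n x := minn (lo n x) (rt n).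
Definition lo2 n x := lo n x - lo1 n x.
Definition digmul n x y :=
  mulrt2 n (smul n (hi n x) (hi n y)) +
  (mulrt n (smul n (hi n x) (lo1 n y)) + mulrt n (smul n (hi n x) (lo2 n y)) +
   mulrt n (smul n (hi n y) (lo1 n x)) + mulrt n (smul n (hi n y) (lo2 n x))) +
  (smul n (lo1 n x) (lo1 n y) + smul n (lo1 n x) (lo2 n y) +
   smul n (lo2 n x) (lo1 n y) + smul n (lo2 n x) (lo2 n y)).

Section Arith.
Variables (n : nat) (n1 : 1 < n).
Let s := rt n.

Lemma smulE x y : x <= s -> y <= s -> smul n x y = x * y.
Proof.
move=> xs ys; have [s0 H1 H2] := rtP n1; rewrite -/s in s0 H1 H2.
have : x * y <= s * s by apply: leq_mul.
by rewrite /smul => H; rewrite !ifT //; apply/and3P; split; nia.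
Qed.

Lemma excP : [/\ exc1 n <= s, exc2 n <= s, exc3 n <= s & s * s + exc1 n + exc2 n + exc3 n = n].
Proof.
have [s0 H1 H2] := rtP n1; rewrite -/s in s0 H1 H2.
rewrite /exc3 /exc2 /exc1 /exc -/s smulE //.
split; try lia; nia.
Qed.

Lemma sdivP x : x <= s * s -> [/\ sdiv n x <= s, smod n x <= s & x = s * sdiv n x + smod n x].
Proof.
have [s0 H1 H2] := rtP n1; rewrite -/s in s0 H1 H2.
move=> xs; have dv : sdiv n x <= s by rewrite /sdiv -/s leq_divLR; [exact: leq_trans xs _ | rewrite /s; apply: dvdnn]||
   (rewrite /sdiv -/s; apply: (@leq_trans (s * s %/ s)); [exact: leq_div2r|rewrite mulnK]).
rewrite /smod -/s smulE //; have E := divn_eq x s; have L := ltn_pmod x s0.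
rewrite /sdiv -/s in dv *; split=> //; nia.
Qed.

Lemma mulrt_aux k t a b c d m : t * t + a + b + c = k ->
  k * d + t * m - (a * d + b * d + c * d) = t * (t * d + m).
Proof. by move=> <-; apply: (canLR (addnK _)); ring. Qed.

Lemma mulrt2_aux k t a b c d m : t * t + a + b + c = k ->
  k * (t * d) + t * (t * m) - (t * (a * d) + t * (b * d) + t * (c * d)) = t * (t * (t * d + m)).
Proof. by move=> <-; apply: (canLR (addnK _)); ring. Qed.

Lemma mulrtE y : y <= s * s -> mulrt n y = s * y.
Proof.
move=> /sdivP[H1 H2 H3]; have [e1 e2 e3 E] := excP.
by rewrite /mulrt -/s !smulE // [in RHS]H3 (mulrt_aux _ _ E).
Qed.

Lemma mulrt2E y : y <= s * s -> mulrt2 n y = s * (s * y).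
Proof.
move=> /sdivP[H1 H2 H3]; have [e1 e2 e3 E] := excP.
rewrite /mulrt2 -/s !smulE // !mulrtE; try exact: leq_mul.
by rewrite [in RHS]H3 (mulrt2_aux _ _ E).
Qed.

Lemma hiloP x : x < n -> [/\ hi n x <= s, lo1 n x <= s, lo2 n x <= s & x = s * hi n x + lo1 n x + lo2 n x].
Proof.
have [s0 H1 H2] := rtP n1; rewrite -/s in s0 H1 H2 => xn.
have hs : hi n x <= s by rewrite /hi -/s; lia.
have E := divn_eq x s; have L := ltn_pmod x s0.
rewrite /lo2 /lo1 /lo -/s smulE //.
have E2 : hi n x = minn (x %/ s) s by [].
have [le|gt] := leqP (x %/ s) s.
  have E3 : hi n x = x %/ s by rewrite E2; lia.
  rewrite E3 in hs *; split=> //; nia.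
have E3 : hi n x = s by rewrite E2; lia.
rewrite E3; split=> //; nia.
Qed.

Lemma digmulE x y : x < n -> y < n -> digmul n x y = x * y.
Proof.
move=> /hiloP[hx x1 x2 Ex] /hiloP[hy y1 y2 Ey]; rewrite /digmul.
rewrite !smulE // mulrt2E ?leq_mul // !mulrtE ?leq_mul //.
by rewrite [in RHS]Ex [in RHS]Ey; ring.
Qed.

End Arith.

Lemma dterm_minn r (x y : W r -> nat) : dterm x -> dterm y -> dterm (fun w => minn (x w) (y w)).
Proof.
move=> dx dy; have D : dterm (fun w => x w - (x w - y w)) by dfn.
by apply: dterm_ext D => w _; lia.
Qed.

Lemma dterm_sdiv r (x : W r -> nat) : dterm x -> dterm (fun w => sdiv (wn w) (minn (x w) (wn w - 1))).
Proof.
move=> dx; apply: (dterm_graph dx) => [w w1|r' h z dz]; first by apply: leq_trans (leq_div _ _) _; lia.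
have drt := dterm_rt r'.
have dm : dterm (fun w => minn (x (wren h w)) (wn w - 1)) by apply: dterm_minn; dfn.
have D : dpred (fun w => z w < wn w /\ rt (wn w) < wn w /\ z w * rt (wn w) < wn w) by apply: dpred_smul_lt.
have D2 : dpred (fun w => smul (wn w) (z w) (rt (wn w)) <= minn (x (wren h w)) (wn w - 1) /\
    minn (x (wren h w)) (wn w - 1) < smul (wn w) (z w) (rt (wn w)) + rt (wn w)) by dfn.
apply: dpred_ext (dpred_and D D2) => w w1 /=.
have [s0 H1 H2] := rtP w1; rewrite /sdiv.
set y := minn _ _; have yn : y < wn w by rewrite /y; lia.
have E := divn_eq y (rt (wn w)); have L := ltn_pmod y s0.
split=> [[[zn [rn lt]]]|<-].
  rewrite /smul zn rn lt /= => -[H3 H4]; nia.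
have lt : y %/ rt (wn w) * rt (wn w) < wn w by lia.
have dn : y %/ rt (wn w) < wn w by apply: leq_ltn_trans (leq_div _ _) yn.
rewrite /smul dn lt; have -> : rt (wn w) < wn w by nia.
by rewrite /=; split=> //; split; lia.
Qed.

Lemma dterm_digmul r (x y : W r -> nat) : dterm x -> dterm y ->
  (forall w, 1 < wn w -> x w < wn w) -> (forall w, 1 < wn w -> y w < wn w) ->
  dterm (fun w => x w * y w).
Proof.
have drt := dterm_rt.
pose cl n x := minn x (n - 1).
have dsdiv s (t : W s -> nat) : dterm t -> dterm (fun w => sdiv (wn w) (cl (wn w) (t w))) by apply: dterm_sdiv.
have dsdiv' s (t : W s -> nat) : (forall w, 1 < wn w -> t w < wn w) -> dterm t -> dterm (fun w => sdiv (wn w) (t w)).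
  by move=> tn /dsdiv; apply: dterm_ext => w w1; rewrite /cl; have := tn w w1 => lt; have -> : minn (t w) (wn w - 1) = t w by lia.
have sn n a b : 1 < n -> smul n a b < n by move=> n1; rewrite /smul; case: ifP => [/and3P[]|] //; lia.
have dsmul s (a b : W s -> nat) : dterm a -> dterm b -> dterm (fun w => smul (wn w) (a w) (b w)) by apply: dterm_smul.
have dmin s (a b : W s -> nat) : dterm a -> dterm b -> dterm (fun w => minn (a w) (b w)) by apply: dterm_minn.
have dsub s (a b : W s -> nat) : dterm a -> dterm b -> dterm (fun w => a w - b w) by apply: dterm_sub.
have dsmod s (t : W s -> nat) : (forall w, 1 < wn w -> t w < wn w) -> dterm t -> dterm (fun w => smod (wn w) (t w)).
  by move=> tn dt; apply: dsub => //; apply: dsmul => //; apply: dsdiv'.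
have dn s : dterm (fun w : W s => wn w) by apply: dterm_wn.
have de s : dterm (fun w : W s => exc (wn w)) by apply: (dsub) => //; apply: dsmul.
have de1 s : dterm (fun w : W s => exc1 (wn w)) by apply: dmin.
have de2 s : dterm (fun w : W s => exc2 (wn w)) by apply: dmin => //; apply: dsub.
have de3 s : dterm (fun w : W s => exc3 (wn w)) by apply: (dsub) => //; apply: dsub.
have dmulrt s (t : W s -> nat) : (forall w, 1 < wn w -> t w < wn w) -> dterm t -> dterm (fun w => mulrt (wn w) (t w)).
  move=> tn dt; have d1 := dsdiv' _ _ tn dt; have d2 := dsmod _ _ tn dt.
  apply: dsub; first by apply: dterm_add; [apply: dterm_mulwn|apply: dsmul].
  by apply: dterm_add; [apply: dterm_add|]; apply: dsmul.
have dmulrt' s (a b : W s -> nat) : dterm a -> dterm b -> dterm (fun w => mulrt (wn w) (smul (wn w) (a w) (b w))).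
  by move=> da db; apply: dmulrt; [move=> w w1; apply: sn|apply: dsmul].
have dmulrt2 s (t : W s -> nat) : (forall w, 1 < wn w -> t w < wn w) -> dterm t -> dterm (fun w => mulrt2 (wn w) (t w)).
  move=> tn dt; have d1 := dsdiv' _ _ tn dt; have d2 := dsmod _ _ tn dt.
  apply: dsub; first by apply: dterm_add; [apply: dterm_mulwn; apply: dsmul|apply: dmulrt'].
  by apply: dterm_add; [apply: dterm_add|]; apply: dmulrt'.
move=> dx dy xn yn.
have dhi (t : W r -> nat) : (forall w, 1 < wn w -> t w < wn w) -> dterm t -> dterm (fun w => hi (wn w) (t w)).
  by move=> tn dt; apply: dmin => //; apply: dsdiv'.
have dlo (t : W r -> nat) : (forall w, 1 < wn w -> t w < wn w) -> dterm t -> dterm (fun w => lo (wn w) (t w)).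
  by move=> tn dt; apply: dsub => //; apply: dsmul => //; apply: dhi.
have dlo1 (t : W r -> nat) : (forall w, 1 < wn w -> t w < wn w) -> dterm t -> dterm (fun w => lo1 (wn w) (t w)).
  by move=> tn dt; apply: dmin => //; apply: dlo.
have dlo2 (t : W r -> nat) : (forall w, 1 < wn w -> t w < wn w) -> dterm t -> dterm (fun w => lo2 (wn w) (t w)).
  by move=> tn dt; apply: dsub => //; [apply: dlo|apply: dlo1].
have D : dterm (fun w => digmul (wn w) (x w) (y w)).
  have h1 := dhi _ xn dx; have h2 := dhi _ yn dy; have l1 := dlo1 _ xn dx; have l2 := dlo1 _ yn dy.
  have l3 := dlo2 _ xn dx; have l4 := dlo2 _ yn dy.
  apply: dterm_add; [apply: dterm_add; [|repeat apply: dterm_add]|repeat apply: dterm_add]; try exact: dmulrt'; try exact: dsmul.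
  by apply: dmulrt2; [move=> w w1; apply: sn|apply: dsmul].
by apply: dterm_ext D => w w1; rewrite digmulE ?xn ?yn.
Qed.

Lemma dterm_mul r (x y : W r -> nat) : dterm x -> dterm y -> dterm (fun w => x w * y w).
Proof.
move=> dx dy; move: x dx; apply: (dterm_digit_ind (T := fun x => dterm (fun w => x w * y w))) => [t t' tt'||d t dd dt dn IH].
- by apply: dterm_ext => w w1; rewrite tt'.
- by apply: dterm_ext (dterm0 _ _ _ _) => w _.
have D : dterm (fun w => d w * y w).
  move: y dy {IH}; apply: (dterm_digit_ind (T := fun y => dterm (fun w => d w * y w))) => [t1 t' tt'||e u de du en IH].
  - by apply: dterm_ext => w w1; rewrite tt'.
  - by apply: dterm_ext (dterm0 _ _ _ _) => w _; rewrite muln0.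
  apply: dterm_ext (dterm_add (dterm_digmul dd de dn en) (dterm_mulwn IH)) => w _.
  by rewrite mulnDr mulnCA.
by apply: dterm_ext (dterm_add D (dterm_mulwn IH)) => w _; rewrite mulnDl mulnA.
Qed.

End Multiplication.

Ltac dmul ::= match goal with
  | |- dterm (fun w => _ * _) => refine (dterm_mul _ _)
  | |- dterm (fun w => minn _ _) => refine (dterm_minn _ _)
  end.

(** * Bounded search and closure under arithmetic *)

Definition mu (b : nat) (P : nat -> Prop) : nat := find (fun y => `[<P y>]) (iota 0 b).
Definition ite (P : Prop) (x y : nat) : nat := if `[<P>] then x else y.

Lemma iteT (P : Prop) x y : P -> ite P x y = x.
Proof. by move=> HP; rewrite /ite asboolT. Qed.
Lemma iteF (P : Prop) x y : ~ P -> ite P x y = y.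
Proof. by move=> HP; rewrite /ite asboolF. Qed.

(** The bound is attained exactly when the search fails, because [find] then returns the length of
    the list. *)
Lemma mu_le b P : mu b P <= b.
Proof. by rewrite -[X in _ <= X](size_iota 0 b) find_size. Qed.

Lemma mu_min b P z : z < mu b P -> ~ P z.
Proof.
move=> zm Pz; have := before_find 0 zm; rewrite nth_iota ?add0n; first by rewrite asboolT.
exact: leq_trans zm (mu_le _ _).
Qed.

Lemma muP b P : mu b P < b -> P (mu b P).
Proof.
move=> lt; have h : has (fun y => `[<P y>]) (iota 0 b) by rewrite has_find size_iota.
by have := nth_find 0 h; rewrite nth_iota // add0n => /asboolP.
Qed.

Lemma mu_lt b P y : y < b -> P y -> mu b P < b.
Proof.
move=> yb Py; rewrite ltnNge; apply/negP => le.
exact: (mu_min (leq_trans yb le)).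
Qed.

Lemma mu_ex b P : (exists2 y, y < b & P y) -> mu b P < b /\ P (mu b P).
Proof. by move=> [y yb Py]; have lt := mu_lt yb Py; split=> //; apply: muP. Qed.

Lemma mu_eq b P y : y < b -> P y -> (forall z, z < b -> P z -> z = y) -> mu b P = y.
Proof. by move=> yb Py U; apply: U; [exact: mu_lt yb Py|exact: muP (mu_lt yb Py)]. Qed.

Lemma muE b P y : mu b P = y <->
  (y < b /\ P y /\ (forall z, z < y -> ~ P z)) \/ (y = b /\ (forall z, z < b -> ~ P z)).
Proof.
split=> [<-|].
  have := mu_le b P; rewrite leq_eqVlt => /orP[/eqP e|lt]; [right|left].
    by split=> // z zb; apply: (@mu_min b); rewrite e.
  by split=> //; split; [exact: muP|move=> z; exact: mu_min].
case=> [[yb [Py H]]|[-> H]].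
  have [le m] := mu_ex (ex_intro2 (fun y => y < b) P y yb Py).
  have [lt|gt|//] := ltngtP (mu b P) y; first by case: (H _ lt).
  by case: (mu_min gt).
apply/eqP; rewrite eqn_leq mu_le leqNgt; apply/negP => lt.
exact: (H _ lt (muP lt)).
Qed.

Section Closure.
Variables (J : Type) (ain aout : nat) (ar : J -> nat).
Notation W := (world ain aout ar).

Lemma dterm_succ r (x : W r -> nat) : dterm x -> dterm (fun w => (x w).+1).
Proof. by move=> dx; apply: dterm_ext (dterm_add dx (dterm1 _ _ _ _)) => w _; rewrite addn1. Qed.

Lemma dterm_divn r (x y : W r -> nat) : dterm x -> dterm y -> dterm (fun w => x w %/ y w).
Proof.
move=> dx dy; apply: (dterm_graph dx) => [w _|r' h z dz]; first exact: leq_div.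
have D : dpred (fun w => (y (wren h w) = 0 /\ z w = 0) \/ (0 < y (wren h w) /\
  z w * y (wren h w) <= x (wren h w) /\ x (wren h w) < z w * y (wren h w) + y (wren h w))) by dfn.
apply: dpred_ext D => w _; move: (x _) (y _) (z _) => a c d.
case: (posnP c) => [->|c0]; first by rewrite divn0; lia.
have E := divn_eq a c; have L := ltn_pmod a c0.
split=> [|<-]; [case=> [[]|[_ [H1 H2]]]|right]; [lia|nia|].
by split=> //; split; lia.
Qed.

Lemma dterm_modn r (x y : W r -> nat) : dterm x -> dterm y -> dterm (fun w => x w %% y w).
Proof.
move=> dx dy; have dd := dterm_divn dx dy.
apply: dterm_ext (dterm_sub dx (dterm_mul dd dy)) => w _.
by rewrite {1}(divn_eq (x w) (y w)) addKn.
Qed.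

Lemma dpred_dvdn r (x y : W r -> nat) : dterm x -> dterm y -> dpred (fun w => x w %| y w).
Proof.
move=> dx dy; have dm := dterm_modn dy dx; have D : dpred (fun w => y w %% x w = 0) by dfn.
by apply: dpred_ext D => w _; rewrite /dvdn; split=> /eqP.
Qed.

Lemma dpred_eqb r (x y : W r -> nat) : dterm x -> dterm y -> dpred (fun w => x w == y w).
Proof. by move=> dx dy; apply: dpred_ext (dpred_eq dx dy) => w _; split=> /eqP. Qed.

Lemma dterm_expc r (x : W r -> nat) k : dterm x -> dterm (fun w => x w ^ k).
Proof.
move=> dx; elim: k => [|k IH]; first by apply: dterm_ext (dterm1 _ _ _ _).
by apply: dterm_ext (dterm_mul dx IH) => w _; rewrite expnS.
Qed.

Lemma dterm_mu r (b : W r -> nat) P : dterm b -> dp1 P -> dterm (fun w => mu (b w) (P w)).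
Proof.
move=> db dP; apply: (dterm_graph db) => [w _|r' h z dz]; first exact: mu_le.
have D : dpred (fun w =>
   (z w < b (wren h w) /\ P (wren h w) (z w) /\ (forall y, y < z w -> ~ P (wren h w) y)) \/
   (z w = b (wren h w) /\ (forall y, y < b (wren h w) -> ~ P (wren h w) y))) by dfn.
by apply: dpred_ext D => w _; rewrite muE.
Qed.

Lemma dterm_ite r P (x y : W r -> nat) : dpred P -> dterm x -> dterm y -> dterm (fun w => ite (P w) (x w) (y w)).
Proof.
move=> dP dx dy; apply: (dterm_graph (dterm_add dx dy)) => [w _|r' h z dz].
  by rewrite /ite; case: asboolP => _; lia.
have D : dpred (fun w => (P (wren h w) /\ x (wren h w) = z w) \/ (~ P (wren h w) /\ y (wren h w) = z w)) by dfn.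
by apply: dpred_ext D => w _; rewrite /ite; case: asboolP => H; tauto.
Qed.

Lemma dpred_prime r (x : W r -> nat) : dterm x -> dpred (fun w => prime (x w)).
Proof.
move=> dx; have ddv := dpred_dvdn.
have D : dpred (fun w => 1 < x w /\ forall d, d < x w -> (d %| x w) -> d = 1).
  dfn; apply: dpred_dvdn; dfn.
apply: dpred_ext D => w _; split=> [[x1 H]|/primeP[x1 H]].
  apply/primeP; split=> // d dd; have dx0 : d <= x w by apply: dvdn_leq => //; lia.
  move: dx0; rewrite leq_eqVlt => /orP[->|lt]; first by rewrite orbT.
  by rewrite (H _ lt dd).
split=> // d lt /H /orP[/eqP//|/eqP e]; lia.
Qed.

Definition relnum r (w : W r) (s : symbol J) (y : nat) : Prop :=
  exists u : (arity ain aout ar s).-tuple 'I_(wn w), u \in interp (wI w) (wX w) s /\ dval u = y.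

Lemma dpred_relnum r s (y : W r -> nat) : dterm y -> dpred (fun w => relnum w s (y w)).
Proof.
move=> dy; set c := arity ain aout ar s.
have D1 : dpred (fun w : W (c + r) => numv (uvars c r) w = y (wren (@rshift c r) w)).
  by apply: dpred_eq; [apply: dterm_numv|apply: dterm_wk].
have D2 : dpred (fun w : W (c + r) => map_tuple (tnth (we w)) [tuple lshift r i | i < c] \in interp (wI w) (wX w) s).
  by exists (@FRel J ain aout ar (c + r) s [tuple lshift r i | i < c]) => w w1.
apply: dpred_ext (dpred_extup (dpred_and D1 D2)) => w w1; rewrite /relnum.
have E (u : c.-tuple 'I_(wn w)) : map_tuple (tnth (we (wcat u))) [tuple lshift r i | i < c] = u.
  by apply: eq_from_tnth => i; rewrite tnth_map tnth_mktuple /= tnth_lshift.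
by split=> -[u]; rewrite ?E ?numv_uvars ?wren_wcat => -[H1 H2]; exists u; rewrite ?E ?numv_uvars ?wren_wcat.
Qed.

Lemma dp1_relnum r s : dp1 (fun (w : W r) y => relnum w s y).
Proof. by move=> r' h y dy; apply: dpred_ext (dpred_relnum s dy) => w w1. Qed.

End Closure.

Ltac dmul ::= match goal with
  | |- dterm (fun w => _ * _) => refine (dterm_mul _ _)
  | |- dterm (fun w => minn _ _) => refine (dterm_minn _ _)
  | |- dterm (fun w => S _) => refine (dterm_succ _)
  | |- dterm (fun w => _ %/ _) => refine (dterm_divn _ _)
  | |- dterm (fun w => _ %% _) => refine (dterm_modn _ _)
  | |- dterm (fun w => _ ^ _) => refine (dterm_expc _ _)
  | |- dterm (fun w => mu (@?b w) (@?P w)) => refine (@dterm_mu _ _ _ _ _ b P _ _)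
  | |- dterm (fun w => ite _ _ _) => refine (dterm_ite _ _ _)
  | |- dpred (fun w => is_true (_ %| _)) => refine (dpred_dvdn _ _)
  | |- dpred (fun w => is_true (_ == _)) => refine (dpred_eqb _ _)
  | |- dpred (fun w => is_true (prime _)) => refine (dpred_prime _)
  end.

(** * Computations with small states *)

Definition pow2 x := 0 < x /\ forall d, d < x.+1 -> (d %| x) -> d = 1 \/ (2 %| d).
(* For [b = 2 ^ e], a power [x] of 2 with [b - 1 | x - 1] is a power of [b]. *)
Definition pw b x := pow2 x /\ (b - 1 %| x - 1).
Definition dgv b w x := (w %/ x) %% b.
(* [powr b i x] says [x = b ^ i]; the witness lists 0, 1, ..., i in base [b]. *)
Definition powr b i x := pw b x /\ exists w, w < b * x /\
  (dgv b w 1 = 0 /\ (forall y, y < x -> pw b y -> dgv b w (y * b) = (dgv b w y).+1) /\ dgv b w x = i).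
Definition expb b B i := mu B.+1 (powr b i).
Definition dg b B w i := dgv b w (expb b B i).
(* [K] steps of the automaton [F] on states below [b = B ^ (1 / K)], whose run is
   one number below [b * B]; [lev] nests this to make [K ^ c] steps. *)
Definition blk b B K (F : nat -> nat -> nat) i s := mu b (fun s' => exists w, w < b * B /\
  (dg b B w 0 = s /\ dg b B w K = s' /\ forall j, j < K -> dg b B w j.+1 = F (i + j) (dg b B w j))).
Fixpoint lev b B K c F : nat -> nat -> nat :=
  if c is c'.+1 then fun i s => blk b B K (lev b B K c' F) (K * i) s else F.
(** Always [K ^ L] steps; those from [T] on add 0, so that [T] need not be a power of [K]. *)
Definition summod L b B K T q f := lev b B K L (fun i s => (s + ite (i < T) (f i) 0) %% q) 0 0.
Definition prodmod L b B K T q f := lev b B K L (fun i s => (s * ite (i < T) (f i) 1) %% q) 0 (1 %% q).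
(* Determined by its residues since the lcm of the [q < b] exceeds [bd]. *)
Definition bigsum L b B K bd T f := mu bd (fun y => forall q, q < b -> 0 < q -> y %% q = summod L b B K T q f).

Section SmallStateClosure.
Variables (J : Type) (ain aout : nat) (ar : J -> nat).
Notation W := (world ain aout ar).

Lemma dpred_pow2 r (x : W r -> nat) : dterm x -> dpred (fun w => pow2 (x w)).
Proof. by move=> dx; rewrite /pow2; dfn. Qed.
Lemma dterm_dg r (b B w i : W r -> nat) : dterm b -> dterm B -> dterm w -> dterm i ->
  dterm (fun v => dg (b v) (B v) (w v) (i v)).
Proof. by move=> db dB dw di; rewrite /dg /expb /powr /pw /pow2 /dgv; dfn. Qed.
Lemma dpred_powr r (b i x : W r -> nat) : dterm b -> dterm i -> dterm x -> dpred (fun v => powr (b v) (i v) (x v)).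
Proof. by move=> db di dx; rewrite /powr /pw /pow2 /dgv; dfn. Qed.

Local Ltac dext ::= match goal with
  | |- dterm (fun w => dg _ _ _ _) => refine (dterm_dg _ _ _ _)
  end.

Lemma dterm_blk r (b B K i s : W r -> nat) F : dterm b -> dterm B -> dterm K -> dt2 F -> dterm i -> dterm s ->
  dterm (fun w => blk (b w) (B w) (K w) (F w) (i w) (s w)).
Proof. by move=> db dB dK dF di ds; rewrite /blk; dfn. Qed.

(** The number [c] of levels is a constant of the program, so each level may unfold into a further
    layer of the formula. *)
Lemma dterm_lev r (b B K i s : W r -> nat) c F : dterm b -> dterm B -> dterm K -> dt2 F -> dterm i -> dterm s ->
  dterm (fun w => lev (b w) (B w) (K w) c (F w) (i w) (s w)).
Proof.
elim: c r b B K F i s => [|c IH] r b B K F i s db dB dK dF di ds /=; first by dfn.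
apply: (dterm_blk (F := fun w => lev (b w) (B w) (K w) c (F w))) => //; last by dfn.
by move=> r' h x y dx dy; apply: (IH _ (fun w => b (wren h w)) (fun w => B (wren h w)) (fun w => K (wren h w)) (fun w => F (wren h w))); dfn.
Qed.

Lemma dterm_summod L r (b B K T q : W r -> nat) f : dterm b -> dterm B -> dterm K -> dterm T -> dterm q -> dt1 f ->
  dterm (fun w => summod L (b w) (B w) (K w) (T w) (q w) (f w)).
Proof.
move=> db dB dK dT dq df; rewrite /summod.
by apply: (dterm_lev L (F := fun w i s => (s + ite (i < T w) (f w i) 0) %% q w) (i := fun=> 0) (s := fun=> 0)); dfn.
Qed.
Lemma dterm_prodmod L r (b B K T q : W r -> nat) f : dterm b -> dterm B -> dterm K -> dterm T -> dterm q -> dt1 f ->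
  dterm (fun w => prodmod L (b w) (B w) (K w) (T w) (q w) (f w)).
Proof.
move=> db dB dK dT dq df; rewrite /prodmod.
by apply: (dterm_lev L (F := fun w i s => (s * ite (i < T w) (f w i) 1) %% q w) (i := fun=> 0) (s := fun w => 1 %% q w)); dfn.
Qed.

Lemma dterm_bigsum L r (b B K T bd : W r -> nat) f : dterm b -> dterm B -> dterm K -> dterm bd -> dterm T -> dt1 f ->
  dterm (fun w => bigsum L (b w) (B w) (K w) (bd w) (T w) (f w)).
Proof.
move=> db dB dK dbd dT df; rewrite /bigsum.
apply: dterm_mu => //; dfn.
by apply: (dterm_summod L (b := fun w => b (wren h (wren h0 w))) (B := fun w => B (wren h (wren h0 w)))
  (K := fun w => K (wren h (wren h0 w))) (T := fun w => T (wren h (wren h0 w))) (f := fun w => f (wren h (wren h0 w)))); dfn.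
Qed.

End SmallStateClosure.

(** * Correctness of the small-state computations *)

Lemma pow2P x : pow2 x <-> exists j, x = 2 ^ j.
Proof.
split=> [[x0 H]|[j ->]].
  have [k] := ubnP x; elim: k x x0 H => // k IH x x0 H xk.
  have [x1|x1] := leqP x 1; first by exists 0; lia.
  have [|d2] := H x (ltnSn x) (dvdnn x); first lia.
  have x2 : x = 2 * (x %/ 2) by rewrite mulnC divnK.
  have [j Hj] : exists j, x %/ 2 = 2 ^ j.
    apply: IH; [lia| |lia] => d _ dd; apply: H; last by rewrite x2; apply: dvdn_mull.
    by rewrite ltnS; apply: dvdn_leq; [lia|rewrite x2; apply: dvdn_mull].
  by exists j.+1; rewrite x2 Hj expnS.
split=> [|d _ dd]; first by rewrite expn_gt0.
by move/(dvdn_pfactor d j (isT : prime 2)): dd => [[|m] _ ->]; [left|right; rewrite expnS dvdn_mulr].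
Qed.

(** Writing the exponent as [e * j + r] with [r < e], the power of 2 is [2 ^ r] modulo [b - 1];
    since [2 ^ r < b], divisibility forces [2 ^ r = 1]. *)
Lemma pwP e b x : 0 < e -> b = 2 ^ e -> pw b x <-> exists j, x = b ^ j.
Proof.
move=> e0 bE; have b2 : 1 < b by rewrite bE -{1}(expn0 2) ltn_exp2l.
have geo j : b - 1 %| b ^ j - 1.
  by rewrite !subn1 predn_exp dvdn_mulr.
split=> [[/pow2P[t ->]]|[j ->]]; last first.
  by split; [apply/pow2P; exists (e * j); rewrite bE expnM|].
rewrite {1}(divn_eq t e) mulnC expnD expnM -bE => H.
exists (t %/ e); rewrite {1}(divn_eq t e) mulnC expnD expnM -bE.
set r := t %% e; have re : r < e by rewrite ltn_pmod.
have rb : 2 ^ r < b by rewrite bE ltn_exp2l.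
have r0 : 0 < 2 ^ r by rewrite expn_gt0.
have p0 : 0 < b ^ (t %/ e) by rewrite expn_gt0; lia.
suff -> : 2 ^ r = 1 by rewrite muln1.
have : b - 1 %| 2 ^ r - 1.
  have : b - 1 %| (b ^ (t %/ e) - 1) * 2 ^ r by rewrite dvdn_mulr.
  move=> H'; move: H; rewrite (_ : _ * _ - 1 = (b ^ (t %/ e) - 1) * 2 ^ r + (2 ^ r - 1)); last first.
    by rewrite -/r mulnBl mul1n; have := leq_pmull (2 ^ r) p0; lia.
  by rewrite dvdn_addr.
by move=> /dvdn_leq; lia.
Qed.

Lemma digit_code b (f : nat -> nat) k : 1 < b -> (forall j, j < k -> f j < b) ->
  exists2 w, w < b ^ k & forall j, j < k -> (w %/ b ^ j) %% b = f j.
Proof.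
move=> b1; elim: k f => [|k IH] f Hf; first by exists 0.
have [w wk Hw] := IH (fun j => f j.+1) (fun j jk => Hf j.+1 jk).
have f0 := Hf 0 (ltn0Sn k); have b0 : 0 < b by lia.
exists (f 0 + w * b) => [|[|j] jk].
- by rewrite expnSr; nia.
- by rewrite expn0 divn1 addnC modnMDl modn_small.
- by rewrite expnS divnMA addnC divnMDl // (divn_small f0) addn0 Hw.
Qed.

Section SmallStates.
Variables (e b K B : nat).
Hypotheses (e0 : 0 < e) (bE : b = 2 ^ e) (BE : B = b ^ K) (Kb : K < b).

Lemma b_gt1 : 1 < b. Proof. by rewrite bE -{1}(expn0 2) ltn_exp2l. Qed.

Lemma powrP i x : i < b -> powr b i x <-> x = b ^ i.
Proof using e0 bE.
move=> ib; have b1 := b_gt1.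
split=> [[/(pwP _ e0 bE)[j ->]]|->].
  move=> [w [wx [H0 [HS Hj]]]]; have Hk k : k <= j -> dgv b w (b ^ k) = k.
    elim: k => [|k IH] kj; first by rewrite expn0.
    by rewrite expnSr HS ?IH ?ltn_exp2l //; [exact: ltnW|apply/(pwP _ e0 bE); exists k].
  by rewrite -Hj Hk.
split; first by apply/(pwP _ e0 bE); exists i.
have [w wk Hw] := @digit_code b id i.+1 b1 (fun j ji => leq_ltn_trans (ji : j <= i) ib).
exists w; rewrite -expnS; split=> //; split; first by rewrite -(expn0 b) /dgv Hw.
split=> [y lt /(pwP _ e0 bE)[j yE]|]; last by rewrite /dgv Hw.
move: lt; rewrite yE ltn_exp2l // => ji; rewrite -expnSr /dgv !Hw //; exact: ltnW.
Qed.

Lemma expbE i : i <= K -> expb b B i = b ^ i.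
Proof.
move=> iK; have b1 := b_gt1; have ib : i < b by lia.
apply: mu_eq; [by rewrite ltnS BE leq_exp2l|exact/powrP|by move=> z _ /powrP; apply].
Qed.

Lemma dgE w i : i <= K -> dg b B w i = (w %/ b ^ i) %% b.
Proof. by move=> iK; rewrite /dg /dgv expbE. Qed.

Lemma code_ex k f : k <= K -> (forall j, j < k -> f j < b) ->
  exists2 w, w < B & forall j, j < k -> dg b B w j = f j.
Proof.
move=> kK Hf; have [w wk Hw] := digit_code b_gt1 Hf; exists w => [|j jk].
  by apply: leq_trans wk _; rewrite BE leq_pexp2l //; have := b_gt1; lia.
by rewrite dgE ?Hw //; lia.
Qed.

Definition runs (F : nat -> nat -> nat) i k s := foldl (fun s j => F j s) s (iota i k).

Lemma runsS F i k s : runs F i k.+1 s = F (i + k) (runs F i k s).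
Proof. by rewrite /runs -addn1 iotaD foldl_cat /=. Qed.

Lemma runsD F i k k' s : runs F i (k + k') s = runs F (i + k) k' (runs F i k s).
Proof. by rewrite /runs iotaD foldl_cat. Qed.

Lemma runs_lt F i k s : (forall i s, s < b -> F i s < b) -> s < b -> runs F i k s < b.
Proof. by move=> HF sb; elim: k => // k IH; rewrite runsS; apply: HF. Qed.

Lemma blkE F i s : (forall i s, s < b -> F i s < b) -> s < b -> blk b B K F i s = runs F i K s.
Proof.
move=> HF sb; apply: mu_eq; first exact: runs_lt.
  have [w wk Hw] := @digit_code b (fun j => runs F i j s) K.+1 b_gt1 (fun j _ => runs_lt i j HF sb).
  have {}Hw j : j <= K -> dg b B w j = runs F i j s by move=> jK; rewrite dgE ?Hw.
  exists w; rewrite BE -expnS; split=> //; split; first by rewrite -BE Hw.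
  split; first by rewrite -BE Hw.
  by move=> j jK; rewrite -BE !Hw ?runsS //; lia.
move=> z zb [w [_ [H0 [HK HS]]]]; rewrite -HK.
have : K <= K by []; elim: {-2}K => [|k IH] kK; first by rewrite H0.
by rewrite HS // runsS IH //; lia.
Qed.

Lemma levE c F i s : (forall i s, s < b -> F i s < b) -> s < b ->
  lev b B K c F i s = runs F (K ^ c * i) (K ^ c) s.
Proof.
move=> HF; elim: c i s => [|c IH] i s sb.
  by rewrite /= expn0 mul1n /runs /=.
rewrite /= blkE //; last by move=> j t tb; rewrite IH // runs_lt.
rewrite expnSr -mulnA; move: (K * i) => i0.
suff H k : runs (lev b B K c F) i0 k s = runs F (K ^ c * i0) (K ^ c * k) s by apply: H.
elim: k => [|k IHk]; first by rewrite muln0.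
by rewrite runsS IHk IH ?runs_lt // mulnDr -runsD mulnS addnC.
Qed.

Variable L : nat.
Hypothesis (bL : b <= K ^ L).

Lemma summodE T q f : T <= b -> 0 < q -> q <= b -> summod L b B K T q f = (\sum_(i < T) f i) %% q.
Proof.
move=> Tb q0 qb; rewrite /summod levE //; last 2 first.
- by move=> i s _; apply: leq_trans qb; rewrite ltn_mod.
- by have := b_gt1; lia.
rewrite muln0; have H k : runs (fun i s => (s + ite (i < T) (f i) 0) %% q) 0 k 0 = (\sum_(i < k) ite (i < T) (f i) 0) %% q.
  elim: k => [|k IH]; first by rewrite big_ord0 mod0n.
  by rewrite runsS IH big_ord_recr /= add0n modnDml.
rewrite H; congr (_ %% _); rewrite (big_ord_widen _ f (leq_trans Tb bL)) [RHS]big_mkcond.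
by apply: eq_bigr => i _; rewrite /ite asboolb.
Qed.

Lemma prodmodE T q f : T <= b -> 0 < q -> q <= b -> prodmod L b B K T q f = (\prod_(i < T) f i) %% q.
Proof.
move=> Tb q0 qb; rewrite /prodmod levE //; last 2 first.
- by move=> i s _; apply: leq_trans qb; rewrite ltn_mod.
- by apply: leq_trans qb; rewrite ltn_mod.
rewrite muln0; have H k : runs (fun i s => (s * ite (i < T) (f i) 1) %% q) 0 k (1 %% q) = (\prod_(i < k) ite (i < T) (f i) 1) %% q.
  elim: k => [|k IH]; first by rewrite big_ord0.
  by rewrite runsS IH big_ord_recr /= add0n modnMml.
rewrite H; congr (_ %% _); rewrite (big_ord_widen _ f (leq_trans Tb bL)) [RHS]big_mkcond.
by apply: eq_bigr => i _; rewrite /ite asboolb.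
Qed.

Lemma bigsumE bd T (f : nat -> nat) : T <= b -> \sum_(i < T) f i < bd ->
  (forall z, (forall q, q < b -> 0 < q -> q %| z) -> z = 0 \/ bd <= z) ->
  bigsum L b B K bd T f = \sum_(i < T) f i.
Proof.
move=> Tb Sb Hl; apply: mu_eq => //.
  by move=> q qb q0; rewrite summodE // ltnW.
move=> z zb Hz; set S := \sum_(i < T) f i.
have H q : q < b -> 0 < q -> (q %| z - S) /\ (q %| S - z).
  move=> qb q0; have := Hz q qb q0; rewrite summodE // 1?ltnW // => E.
  have [le|/ltnW le] := leqP S z.
    have -> : S - z = 0 by apply/eqP.
    by rewrite dvdn0 -eqn_mod_dvd // /S E.
  have -> : z - S = 0 by apply/eqP.
  by rewrite dvdn0 -eqn_mod_dvd // /S E.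
have [h1|h1] := Hl _ (fun q qb q0 => (H q qb q0).1); have [h2|h2] := Hl _ (fun q qb q0 => (H q qb q0).2); lia.
Qed.

End SmallStates.

(** * Singularity of small matrices *)

Section Singularity.
Variables (L b B K p : nat) (M : nat -> nat -> nat).

(* [M + p K] is congruent to [M] mod [p] and diagonally dominant, so that its
   leading minors do not vanish over the integers. *)
Definition shifted i j := M i j + ite (i = j) (p * K) 0.
(** The digits of [w] solve, mod [q], the system of the leading block of size [i + 1] with the last
    unit vector on the right. *)
Definition pivot_code q i w := forall l, l < i.+1 ->
  summod L b B K i.+1 q (fun j => shifted l j * dg b B w j) = ite (l = i) 1 0.
(** Solvability of all the systems is a sufficient test: by telescoping it already makes the
    determinant invertible mod [q]. The prime [p] is excluded because [crr_coef] divides by it. *)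
Definition good_prime q := prime q /\ (q <> p /\ forall i, i < K -> exists w, w < B /\ pivot_code q i w).
(* The last entry of the last column of the inverse of the leading block of size
   [i + 1], which is a quotient of consecutive leading minors; their product over
   [i] is the inverse of the determinant mod [q]. *)
Definition pivot_inv q i := dg b B (mu B (pivot_code q i)) i.
Definition pivot_prod q := prodmod L b B K K q (pivot_inv q).
Definition cofactor_prod q := prodmod L b B K b q (fun q' => ite (good_prime q' /\ q' <> q) q' 1).
(** As [pivot_prod] is the inverse of the determinant, this is the determinant divided by
    [p * (Q / q)] mod [q], with [Q] the product of the good primes: the Chinese remainder
    coefficient of the determinant over [p]. *)
Definition crr_coef q := mu q (fun c => (c * (pivot_prod q * p * cofactor_prod q)) %% q = 1).
Definition crr_scale := p * (4 * b + 8) + 1.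
Definition crr_sum := bigsum L b B K (b * crr_scale + 1) b
  (fun q => ite (good_prime q) ((crr_coef q * crr_scale) %/ q) 0).
Definition singular := (crr_sum + b + 1) %% crr_scale <= b + 2.

End Singularity.

Section SingularityClosure.
Variables (J : Type) (ain aout : nat) (ar : J -> nat).
Notation W := (world ain aout ar).
Variable L : nat.

Local Ltac dext ::= match goal with
  | |- dterm (fun w => dg _ _ _ _) => refine (dterm_dg _ _ _ _)
  | |- dterm (fun w => summod _ (@?b w) (@?B w) (@?K w) (@?T w) (@?q w) (@?f w)) =>
      refine (@dterm_summod _ _ _ _ _ _ b B K T q f _ _ _ _ _ _)
  | |- dterm (fun w => prodmod _ (@?b w) (@?B w) (@?K w) (@?T w) (@?q w) (@?f w)) =>
      refine (@dterm_prodmod _ _ _ _ _ _ b B K T q f _ _ _ _ _ _)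
  | |- dterm (fun w => bigsum _ (@?b w) (@?B w) (@?K w) (@?bd w) (@?T w) (@?f w)) =>
      refine (@dterm_bigsum _ _ _ _ _ _ b B K T bd f _ _ _ _ _ _)
  end.

Lemma dpred_pivot_code r (b B K p q i u : W r -> nat) M : dterm b -> dterm B -> dterm K -> dterm p ->
  dt2 M -> dterm q -> dterm i -> dterm u ->
  dpred (fun w => pivot_code L (b w) (B w) (K w) (p w) (M w) (q w) (i w) (u w)).
Proof. by move=> db dB dK dp dM dq di du; rewrite /pivot_code /shifted; dfn. Qed.

Lemma dpred_good_prime r (b B K p q : W r -> nat) M : dterm b -> dterm B -> dterm K -> dterm p ->
  dt2 M -> dterm q -> dpred (fun w => good_prime L (b w) (B w) (K w) (p w) (M w) (q w)).
Proof.
move=> db dB dK dp dM dq; rewrite /good_prime; dfn.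
by apply: (dpred_pivot_code (M := fun w => M (wren h (wren h0 w)))); dfn.
Qed.

Lemma dterm_pivot_prod r (b B K p q : W r -> nat) M : dterm b -> dterm B -> dterm K -> dterm p ->
  dt2 M -> dterm q -> dterm (fun w => pivot_prod L (b w) (B w) (K w) (p w) (M w) (q w)).
Proof.
move=> db dB dK dp dM dq; rewrite /pivot_prod /pivot_inv; dfn.
by apply: (dpred_pivot_code (M := fun w => M (wren h (wren h0 w)))); dfn.
Qed.

Lemma dterm_cofactor_prod r (b B K p q : W r -> nat) M : dterm b -> dterm B -> dterm K -> dterm p ->
  dt2 M -> dterm q -> dterm (fun w => cofactor_prod L (b w) (B w) (K w) (p w) (M w) (q w)).
Proof.
move=> db dB dK dp dM dq; rewrite /cofactor_prod; dfn.
by apply: (dpred_good_prime (M := fun w => M (wren h w))); dfn.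
Qed.

Lemma dpred_singular r (b B K p : W r -> nat) M : dterm b -> dterm B -> dterm K -> dterm p ->
  dt2 M -> dpred (fun w => singular L (b w) (B w) (K w) (p w) (M w)).
Proof.
move=> db dB dK dp dM; rewrite /singular /crr_sum /crr_coef /crr_scale; dfn.
- by apply: (dpred_good_prime (M := fun w => M (wren h w))); dfn.
- by apply: (dterm_pivot_prod (M := fun w => M (wren h (wren h0 w)))); dfn.
- by apply: (dterm_cofactor_prod (M := fun w => M (wren h (wren h0 w)))); dfn.
Qed.

End SingularityClosure.

(** * Numbers as elements of a prime field *)

Section PrimeField.
Import GRing.Theory.
Local Open Scope ring_scope.
Variables (p : nat) (pp : prime p).

Lemma Fp_natE x y : (x%:R == y%:R :> 'F_p) = (x == y %[mod p])%N.
Proof. by rewrite -val_eqE /= !val_Fp_nat. Qed.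

Lemma Fp_nat0 x : (x%:R == 0 :> 'F_p) = (p %| x)%N.
Proof. by rewrite -[0]/(0%:R) Fp_natE mod0n. Qed.

Lemma Fp_int0 (x : int) : (x%:~R == 0 :> 'F_p) = (p%:Z %| x)%Z.
Proof.
rewrite dvdzE; case: x => x /=; first exact: Fp_nat0.
by rewrite NegzE mulrNz oppr_eq0; apply: Fp_nat0.
Qed.

Lemma Fp_lt (x : 'F_p) : (val x < p)%N.
Proof. by have := ltn_ord x; rewrite {2}Fp_cast. Qed.

Lemma Fp_valK (x : 'F_p) : (val x)%:R = x.
Proof. exact: natr_Zp. Qed.

End PrimeField.

(** * Correctness of the singularity test *)

Section SingularityCorrect.
Import Order.TTheory GRing.Theory Num.Theory.
Local Open Scope ring_scope.
Variables (L e b K B p : nat) (M : nat -> nat -> nat).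
Hypotheses (e0 : (0 < e)%N) (bE : b = (2 ^ e)%N) (BE : B = (b ^ K)%N) (Kb : (K < b)%N) (bL : (b <= K ^ L)%N).
Hypotheses (pp : prime p) (Mp : forall i j, (i < K)%N -> (j < K)%N -> (M i j < p)%N).
Variable nu : nat.
Hypotheses (nu1 : (K * (p * K.+1) <= 2 ^ nu)%N) (nu2 : (b * crr_scale b p + 1 <= 2 ^ nu)%N).
Hypothesis (nub : (K * K * nu + K * nu + nu + 3 <= size (primes_below b))%N).

Notation A := (shifted K p M).
Notation good := (good_prime L b B K p M).
Let Z i : 'M[int]_i := lmx (fun i j => (A i j)%:Z) i.

Lemma det_Z_neq0 i : (i <= K)%N -> \det (Z i) != 0.
Proof.
move=> iK; apply: diag_dominant_det => l; have lK : (l < K)%N by apply: leq_trans iK.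
rewrite !mxE /shifted iteT //.
have p0 := prime_gt0 pp.
apply: (@le_lt_trans _ _ (\sum_(j < i | j != l) p%:Z)).
  apply: ler_sum => j jl; rewrite mxE /shifted iteF; last by move/val_inj => e1; rewrite e1 eqxx in jl.
  by rewrite addn0 ger0_norm // lez_nat ltnW // Mp // (leq_trans (ltn_ord j)).
rewrite sumr_const cardC1 card_ord -mulr_natr natz -PoszM.
have -> : `|(M l l + p * K)%N%:Z| = (M l l + p * K)%N%:Z by [].
rewrite ltz_nat; have : (i.-1 < K)%N by case: (i) l iK {lK} => [[]|].
by move=> H; apply: (@leq_trans (p * K)%N); [rewrite ltn_pmul2l|apply: leq_addl].
Qed.

Lemma det_Z_bound i : (i <= K)%N -> (`|\det (Z i)| <= 2 ^ (K * nu))%N.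
Proof.
move=> iK; apply: leq_trans (@det_int_bound _ _ (p * K.+1) _) _.
  move=> l j; rewrite mxE /= /shifted mulnS leq_add //.
    by rewrite ltnW // Mp //; apply: leq_trans iK.
  by rewrite /ite; case: asboolP.
have [->|i0] := posnP i; first by rewrite expn0 expn_gt0.
apply: (@leq_trans ((2 ^ nu) ^ i)); last by rewrite -expnM leq_exp2l // mulnC leq_mul2r iK orbT.
by rewrite leq_exp2r //; apply: leq_trans nu1; rewrite leq_mul2r iK orbT.
Qed.

Lemma pivot_codeP q i w : prime q -> (q <= b)%N -> (i < K)%N ->
  pivot_code L b B K p M q i w <->
  lmx (fun i j => (A i j)%:R : 'F_q) i.+1 *m (\col_j (dg b B w j)%:R) = delta_mx ord_max 0.
Proof.
move=> qp qb iK; have q1 := prime_gt1 qp.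
have S l : summod L b B K i.+1 q (fun j => A l j * dg b B w j)%N = ((\sum_(j < i.+1) (A l j * dg b B w j)) %% q)%N.
  by rewrite (summodE e0 bE BE Kb bL) //; [apply: leq_trans iK (ltnW Kb)|lia].
split=> [H|H l li].
  apply/matrixP => l c; rewrite ord1 !mxE.
  have := H l (ltn_ord l); rewrite S => E.
  transitivity ((\sum_(j < i.+1) (A l j * dg b B w j))%N%:R : 'F_q).
    by rewrite natr_sum; apply: eq_bigr => j _; rewrite !mxE natrM.
  transitivity ((ite (l = i :> nat) 1 0)%:R : 'F_q); first by apply/eqP; rewrite Fp_natE // -E modn_mod.
  rewrite eqxx andbT -val_eqE /= /ite; case: asboolP => [->|/eqP/negbTE->] //; by rewrite eqxx.
rewrite S; have := congr1 (fun N : 'cV_i.+1 => N (Ordinal li) 0) H; rewrite !mxE eqxx andbT -val_eqE /= => E.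
have /eqP : ((\sum_(j < i.+1) (A l j * dg b B w j))%N%:R : 'F_q) == (l == i)%:R.
  by rewrite -E natr_sum; apply/eqP/eq_bigr => j _; rewrite !mxE natrM.
move/eqP; rewrite Fp_natE // => /eqP ->.
by rewrite /ite; case: asboolP => [->|/eqP/negbTE->]; rewrite ?eqxx /=; [exact: modn_small|exact: mod0n].
Qed.

Lemma intr_det_Z (R : comNzRingType) i : (\det (Z i))%:~R = \det (lmx (fun i j => (A i j)%:R : R) i).
Proof. by rewrite -det_map_mx; congr (\det _); apply/matrixP => l j; rewrite !mxE. Qed.

Lemma good_primeI q : prime q -> (q <= b)%N -> q <> p ->
  (forall i, (i < K)%N -> ~~ (q%:Z %| \det (Z i.+1))%Z) -> good q.
Proof.
move=> qp qb qnp H; split=> //; split=> // i iK.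
have [v Hv] : exists v : 'cV_i.+1, lmx (fun i j => (A i j)%:R : 'F_q) i.+1 *m v = delta_mx ord_max 0.
  by apply: lmx_solvable; rewrite -intr_det_Z Fp_int0 // H.
pose f j := val (v (inord j) 0).
have [w wB Hw] := code_ex e0 bE BE Kb (k := i.+1) (f := f) iK (fun j _ => leq_trans (Fp_lt qp _) qb).
exists w; split=> //; apply/(pivot_codeP _ qp qb iK); rewrite -Hv; congr (_ *m _).
by apply/matrixP => j c; rewrite ord1 !mxE Hw // /f inord_val Fp_valK.
Qed.

Lemma pivot_prodE q : (q <= b)%N -> good q ->
  (pivot_prod L b B K p M q)%:R * (\det (Z K))%:~R = 1 :> 'F_q.
Proof.
move=> qb [qp [qnp H]]; have q1 := prime_gt1 qp; rewrite /pivot_prod (prodmodE e0 bE BE Kb bL) //; [|by apply: ltnW|by apply: ltnW].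
rewrite intr_det_Z mulrC.
have -> : ((\prod_(i < K) pivot_inv L b B K p M q i) %% q)%N%:R = (\prod_(i < K) pivot_inv L b B K p M q i)%N%:R :> 'F_q.
  by apply/eqP; rewrite Fp_natE // modn_mod.
rewrite natr_prod.
pose v i : 'cV['F_q]_i.+1 := \col_j (dg b B (mu B (pivot_code L b B K p M q i)) j)%:R.
rewrite (eq_bigr (fun i : 'I_K => v i ord_max 0)); last by move=> i _; rewrite mxE.
apply: lmx_pivots => i iK; apply/(pivot_codeP _ qp qb iK).
by have [w [wB Hw]] := H i iK; apply: (mu_ex _).2; exists w.
Qed.

Definition good_seq := [seq q <- iota 0 b | `[<good q>]].

Lemma mem_good_seq q : (q \in good_seq) = `[<good q>] && (q < b)%N.
Proof. by rewrite mem_filter mem_iota. Qed.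

Lemma good_seq_prime : all prime good_seq.
Proof. by apply/allP => q; rewrite mem_good_seq => /andP[/asboolP[]]. Qed.

Lemma good_seq_uniq : uniq good_seq.
Proof. by rewrite filter_uniq // iota_uniq. Qed.

(** Only [p] and the divisors of a leading minor are lost. The product of the [K] minors has at most
    [K * K * nu + 1] prime divisors, which gives the first term of [nub]; the primes that remain
    must have a product above [H] times the determinant, hence the terms [K * nu + nu]. *)
Lemma size_good_seq : (K * nu + nu <= size good_seq)%N.
Proof.
pose Y := (\prod_(i < K) `|\det (Z i.+1)|)%N.
have Y0 : (0 < Y)%N by apply: prodn_cond_gt0 => i _; rewrite absz_gt0 det_Z_neq0.
have YK : (Y < 2 ^ (K * K * nu + 1))%N.
  apply: (@leq_ltn_trans (\prod_(i < K) 2 ^ (K * nu))%N); first by apply: leq_prod => i _; apply: det_Z_bound.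
  by rewrite prod_nat_const card_ord -expnM ltn_exp2l // addn1 ltnS mulnAC.
have sp : all prime (primes_below b) by apply/allP => q; rewrite mem_primes_below => /andP[].
have := size_prime_divisors (uniq_primes_below b) sp Y0 YK.
rewrite size_filter => le.
have E := count_predC (fun q => q %| Y)%N (primes_below b).
have : {subset [seq q <- primes_below b | ~~ (q %| Y)%N] <= p :: good_seq}.
  move=> q; rewrite mem_filter mem_primes_below inE => /and3P[qY qp qb].
  have [//|qnp] := eqVneq q p; rewrite mem_good_seq qb andbT; apply/asboolP.
  apply: good_primeI => //; [exact: ltnW|exact/eqP|].
  move=> i iK; apply: contra qY; rewrite dvdzE /= => d.
  by rewrite /Y (bigD1 (Ordinal iK)) //= dvdn_mulr.
move=> /(uniq_leq_size (filter_uniq _ (uniq_primes_below b))).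
rewrite size_filter /=.
have -> : count (fun q => ~~ (q %| Y)%N) (primes_below b) = count (predC (fun q => q %| Y)%N) (primes_below b) by [].
move: nub E le; set s := size (primes_below b); set c1 := count _ _; set c2 := count _ _.
by move: (K * K * nu)%N (K * nu)%N => x y; lia.
Qed.

Lemma crr_coefP q : q \in good_seq ->
  (q%:Z %| (crr_coef L b B K p M q * p * ((\prod_(q <- good_seq) q) %/ q))%N%:Z - \det (Z K))%Z.
Proof.
move=> qi; have := qi; rewrite mem_good_seq => /andP[/asboolP gq qb].
have qp : prime q by case: gq. have qnp : q <> p by case: gq => _ [].
have q0 := prime_gt0 qp; have q1 := prime_gt1 qp.
set Q := (\prod_(q <- _) q)%N.
have QE : (Q %/ q = \prod_(q' <- good_seq | q' != q) q')%N.
  by rewrite /Q (bigD1_seq q) //= ?good_seq_uniq // mulKn.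
have cE : (cofactor_prod L b B K p M q = (Q %/ q) %% q)%N.
  rewrite /cofactor_prod (prodmodE e0 bE BE Kb bL) // 1?ltnW // QE; congr (_ %% _)%N.
  rewrite big_filter_cond (_ : iota 0 b = index_iota 0 b); last by rewrite /index_iota subn0.
  rewrite big_mkord [RHS]big_mkcond /=; apply: eq_bigr => i _.
  rewrite /ite; case: asboolP => [[g /eqP n]|H].
    by rewrite asboolT // n.
  by case: ifP => // /andP[/asboolP g /eqP n]; case: H.
set c := crr_coef L b B K p M q.
have pi1 := pivot_prodE (ltnW qb) gq; set pv := pivot_prod L b B K p M q in pi1.
have pv0 : (pv%:R : 'F_q) != 0 by apply/eqP => e1; move/eqP: pi1; rewrite e1 mul0r eq_sym oner_eq0.
have p0 : (p%:R : 'F_q) != 0 by rewrite Fp_nat0 // dvdn_prime2 //; apply/eqP.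
have Q0 : ((Q %/ q)%N%:R : 'F_q) != 0.
  rewrite Fp_nat0 // QE Euclid_dvd_prod // big_has_cond; apply/negP => /hasP[q' q'i /andP[nq]].
  by rewrite dvdn_prime2 ?(allP good_seq_prime) // eq_sym (negbTE nq).
have mR : ((Q %/ q) %% q)%N%:R = (Q %/ q)%N%:R :> 'F_q by apply/eqP; rewrite Fp_natE // modn_mod.
have [clt cP] : (c < q)%N /\ ((c * (pv * p * cofactor_prod L b B K p M q)) %% q = 1)%N.
  pose x := (pv%:R * p%:R * (Q %/ q)%N%:R : 'F_q)^-1.
  apply: (@mu_ex q (fun c => ((c * (pv * p * cofactor_prod L b B K p M q)) %% q = 1)%N)); exists (val x); first exact: Fp_lt.
  rewrite -[RHS](modn_small q1); apply/eqP; rewrite -Fp_natE // cE !natrM mR Fp_valK.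
  by rewrite /x mulVf // !mulf_neq0.
have : (c%:R * p%:R * (Q %/ q)%N%:R : 'F_q) = (\det (Z K))%:~R.
  have /eqP : (c%:R * (pv%:R * p%:R * (Q %/ q)%N%:R) : 'F_q) == 1.
    by rewrite -mR -cE -!natrM -[1]/(1%:R) Fp_natE // cP modn_small.
  move=> E; apply: (mulfI pv0); rewrite pi1 -[RHS]E; ring.
by move/eqP; rewrite -subr_eq0 -Fp_int0 // rmorphB /= -!natrM; apply.
Qed.

Lemma singularP : singular L b B K p M <-> \det (\matrix_(i < K, j < K) ((M i j)%:R : 'F_p)) = 0.
Proof.
have b1 := b_gt1 e0 bE; have p1 := prime_gt1 pp.
have -> : \det (\matrix_(i < K, j < K) ((M i j)%:R : 'F_p)) = (\det (Z K))%:~R.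
  rewrite intr_det_Z; congr (\det _); apply/matrixP => i j; rewrite !mxE /shifted natrD.
  suff -> : (ite (i = j :> nat) (p * K) 0)%:R = 0 :> 'F_p by rewrite addr0.
  by apply/eqP; rewrite Fp_nat0 // /ite; case: asboolP; rewrite ?dvdn0 // dvdn_mulr.
set H := crr_scale b p.
set c := crr_coef L b B K p M.
have SE : crr_sum L b B K p M = (\sum_(q <- good_seq) (c q * H) %/ q)%N.
  have E1 : (\sum_(q < b) ite (good q) ((c q * H) %/ q) 0 = \sum_(q <- good_seq) (c q * H) %/ q)%N.
    rewrite big_filter (_ : iota 0 b = index_iota 0 b); last by rewrite /index_iota subn0.
    by rewrite big_mkord [RHS]big_mkcond; apply: eq_bigr => i _; rewrite /ite; case: asboolP.
  rewrite /crr_sum (bigsumE e0 bE BE Kb bL (f := fun q => ite (good q) ((crr_coef L b B K p M q * H) %/ q) 0)) //.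
    apply: (@leq_ltn_trans (\sum_(q < b) H)%N); last by rewrite sum_nat_const card_ord addn1.
    apply: leq_sum => q _; rewrite /ite; case: asboolP => // gq.
    case: gq => qp _; have q0 := prime_gt0 qp.
    have clt : (crr_coef L b B K p M q <= q)%N by apply: mu_le.
    by apply: (@leq_trans ((q * H) %/ q)%N); [rewrite leq_div2r // leq_mul2r clt orbT|rewrite mulKn].
  move=> z; apply: (zero_of_small_divisors (k := nu)) => //.
  by move: nub; move: (K * K * nu)%N (K * nu)%N => x y; lia.
have pg : p \notin good_seq by rewrite mem_good_seq negb_and; apply/orP; left; apply/asboolP => -[_ []].
have sz : (size good_seq <= b)%N by rewrite -[X in (_ <= X)%N](size_iota 0 b) size_filter count_size.
have HQ : (H * `|\det (Z K)| <= \prod_(q <- good_seq) q)%N.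
  apply: leq_trans (prod_primes_ge good_seq_prime).
  apply: (@leq_trans (2 ^ (K * nu + nu))); last by rewrite leq_exp2l // size_good_seq.
  rewrite addnC expnD leq_mul ?det_Z_bound //; apply: leq_trans nu2.
  by rewrite -/H; nia.
have key := crr_dvd good_seq_uniq good_seq_prime pp pg sz (erefl : H = _) HQ crr_coefP.
rewrite /singular SE -/H; rewrite -key -Fp_int0 //; split=> [/eqP|->] //.
Qed.

End SingularityCorrect.

(** * Updating an inverse *)

Section Update.
Variables (L b B K m p : nat) (N D : nat -> nat -> nat) (s t r : nat).

(** The queried row [s] is included so that its coordinate occurs among the unknowns of the small
    system. *)
Definition affected i := i < m /\ (i = s \/ exists j, j < m /\ (D i j <> 0 \/ D j i <> 0)).
(* The digits of [u] are residues mod [q] that enumerate the affected indices;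
   [listed q u a = m] when position [a] is unused. *)
Definition listed q u a := mu m (fun i => affected i /\ i %% q = dg b B u a).
Definition valid_list q u :=
  (forall i, i < m -> affected i -> exists a, a < K /\ listed q u a = i) /\
  (forall a, a < K -> forall a', a' < K -> listed q u a < m -> listed q u a = listed q u a' -> a = a').
Definition restrict q u (X : nat -> nat -> nat) a a' :=
  ite (listed q u a < m /\ listed q u a' < m) (X (listed q u a) (listed q u a')) 0.
(** The Woodbury matrix [1 + N D] on the listed positions. Its sums are polynomial in [n] but not in
    [K], too large for a small state, which is why [bigsum] is needed. *)
Definition schur q u a a' := (bigsum L b B K (K * (p * p) + 1) K
  (fun a'' => restrict q u N a a'' * restrict q u D a'' a') + ite (a = a') 1 0) %% p.
(** The matrix of [cramer_singular] for the position that lists [s]; [p - r] stands for [- r]. *)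
Definition cramer_mx q u a a' := ite (listed q u a' = s)
  ((ite (listed q u a < m) (N (listed q u a) t) 0 + (p - r) * schur q u a a') %% p) (schur q u a a').
Definition updates := exists q, q < b /\ exists u, u < B /\
  (valid_list q u /\ (~ singular L b B K p (schur q u) /\ singular L b B K p (cramer_mx q u))).

End Update.

Section UpdateClosure.
Variables (J : Type) (ain aout : nat) (ar : J -> nat).
Notation W := (world ain aout ar).
Variable L : nat.

Local Ltac dext ::= match goal with
  | |- dterm (fun w => dg _ _ _ _) => refine (dterm_dg _ _ _ _)
  | |- dterm (fun w => bigsum _ (@?b w) (@?B w) (@?K w) (@?bd w) (@?T w) (@?f w)) =>
      refine (@dterm_bigsum _ _ _ _ _ _ b B K T bd f _ _ _ _ _ _)
  end.

Lemma dterm_listed x (b B m s q u a : W x -> nat) D : dterm b -> dterm B -> dterm m ->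
  dt2 D -> dterm s -> dterm q -> dterm u -> dterm a ->
  dterm (fun w => listed (b w) (B w) (m w) (D w) (s w) (q w) (u w) (a w)).
Proof. by move=> db dB dm dD ds dq du da; rewrite /listed /affected; dfn. Qed.

Lemma dpred_valid_list x (b B K m s q u : W x -> nat) D : dterm b -> dterm B -> dterm K -> dterm m ->
  dt2 D -> dterm s -> dterm q -> dterm u ->
  dpred (fun w => valid_list (b w) (B w) (K w) (m w) (D w) (s w) (q w) (u w)).
Proof.
move=> db dB dK dm dD ds dq du; rewrite /valid_list /affected; dfn.
- by apply: (dterm_listed (D := fun w => D (wren h (wren h0 w)))); dfn.
all: by apply: (dterm_listed (D := fun w => D (wren h (wren h0 w)))); dfn.
Qed.

Lemma dterm_schur x (b B K m p s q u a a' : W x -> nat) N D : dterm b -> dterm B -> dterm K -> dterm m -> dterm p ->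
  dt2 N -> dt2 D -> dterm s -> dterm q -> dterm u -> dterm a -> dterm a' ->
  dterm (fun w => schur L (b w) (B w) (K w) (m w) (p w) (N w) (D w) (s w) (q w) (u w) (a w) (a' w)).
Proof.
move=> db dB dK dm dp dN dD ds dq du da da'; rewrite /schur /restrict; dfn.
all: by apply: (dterm_listed (D := fun w => D (wren h w))); dfn.
Qed.

Lemma dterm_cramer_mx x (b B K m p s t r q u a a' : W x -> nat) N D : dterm b -> dterm B -> dterm K -> dterm m -> dterm p ->
  dt2 N -> dt2 D -> dterm s -> dterm t -> dterm r -> dterm q -> dterm u -> dterm a -> dterm a' ->
  dterm (fun w => cramer_mx L (b w) (B w) (K w) (m w) (p w) (N w) (D w) (s w) (t w) (r w) (q w) (u w) (a w) (a' w)).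
Proof.
move=> db dB dK dm dp dN dD ds dt dr dq du da da'; rewrite /cramer_mx; dfn.
all: try (by apply: dterm_listed); by apply: dterm_schur.
Qed.

Lemma dpred_updates x (b B K m p s t r : W x -> nat) N D : dterm b -> dterm B -> dterm K -> dterm m -> dterm p ->
  dt2 N -> dt2 D -> dterm s -> dterm t -> dterm r ->
  dpred (fun w => updates L (b w) (B w) (K w) (m w) (p w) (N w) (D w) (s w) (t w) (r w)).
Proof.
move=> db dB dK dm dp dN dD ds dt dr; rewrite /updates; dfn.
- by apply: (dpred_valid_list (D := fun w => D (wren h (wren h0 w)))); dfn.
- apply: (dpred_singular L (M := fun w => schur L (b (wren h (wren h0 w))) (B (wren h (wren h0 w))) (K (wren h (wren h0 w))) (m (wren h (wren h0 w))) (p (wren h (wren h0 w)))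
    (N (wren h (wren h0 w))) (D (wren h (wren h0 w))) (s (wren h (wren h0 w))) (x0 (wren h0 w)) (x1 w))); dfn.
  by apply: (dterm_schur (N := fun w => N (wren h (wren h0 (wren h1 w)))) (D := fun w => D (wren h (wren h0 (wren h1 w))))); dfn.
apply: (dpred_singular L (M := fun w => cramer_mx L (b (wren h (wren h0 w))) (B (wren h (wren h0 w))) (K (wren h (wren h0 w))) (m (wren h (wren h0 w))) (p (wren h (wren h0 w)))
    (N (wren h (wren h0 w))) (D (wren h (wren h0 w))) (s (wren h (wren h0 w))) (t (wren h (wren h0 w))) (r (wren h (wren h0 w))) (x0 (wren h0 w)) (x1 w))); dfn.
by apply: (dterm_cramer_mx (N := fun w => N (wren h (wren h0 (wren h1 w)))) (D := fun w => D (wren h (wren h0 (wren h1 w))))); dfn.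
Qed.

End UpdateClosure.

(** * Correctness of the update *)

Section UpdateCorrect.
Import Order.TTheory GRing.Theory Num.Theory.
Local Open Scope ring_scope.
Variables (L e b K B p m nu : nat) (N D : nat -> nat -> nat).
Hypotheses (e0 : (0 < e)%N) (bE : b = (2 ^ e)%N) (BE : B = (b ^ K)%N) (Kb : (K < b)%N) (bL : (b <= K ^ L)%N).
Hypothesis (pp : prime p).
Hypotheses (nu1 : (K * (p * K.+1) <= 2 ^ nu)%N) (nu2 : (b * crr_scale b p + 1 <= 2 ^ nu)%N).
Hypothesis (nu3 : (K * (p * p) + 1 <= 2 ^ nu)%N) (nu4 : (m <= 2 ^ nu)%N).
Hypothesis (nub : (K * K * nu + K * nu + nu + 3 <= size (primes_below b))%N).
Variables (d : nat) (lab : 'I_d -> nat).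
Hypotheses (lab_lt : forall i, (lab i < m)%N) (lab_inj : injective lab).
Hypothesis (lab_surj : forall x, (x < m)%N -> exists i, lab i = x).
Variables (Bm Dm : 'M['F_p]_d).
Hypotheses (Bu : Bm \in unitmx) (DmE : forall i j, Dm i j = (D (lab i) (lab j))%:R).
Hypothesis (NE : forall i j, invmx Bm i j = (N (lab i) (lab j))%:R).
Hypotheses (Dp : forall i j, (i < m)%N -> (j < m)%N -> (D i j < p)%N).
Hypotheses (Np : forall i j, (i < m)%N -> (j < m)%N -> (N i j < p)%N).
Variables (s t : 'I_d) (r : nat).
Hypothesis (rp : (r < p)%N).

Notation aff := (affected m D (lab s)).
Notation ls := (listed b B m D (lab s)).
Notation valid := (valid_list b B K m D (lab s)).

Lemma valid_list_ex (E : seq nat) : (size E <= K)%N -> (forall i, aff i -> i \in E) ->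
  exists q, (q < b)%N /\ exists u, (u < B)%N /\ valid q u.
Proof.
move=> EK HE; pose E' := undup [seq i <- E | `[<aff i>]].
have mE i : (i \in E') = `[<aff i>].
  by rewrite mem_undup mem_filter; case: asboolP => // /HE ->.
have uE : uniq E' by apply: undup_uniq.
have szE : (size E' <= K)%N.
  by apply: leq_trans (size_undup _) (leq_trans _ EK); rewrite size_filter count_size.
have Em : all (ltn^~ m) E' by apply/allP => i; rewrite mE => /asboolP[].
have [|q [qp qb qinj]] := mod_injective_prime (b := b) Em nu4.
  apply: leq_trans nub; have : (size E' * size E' * nu <= K * K * nu)%N by rewrite !leq_mul.
  by move: (size E' * size E' * nu)%N (K * K * nu)%N (K * nu)%N => x y z; lia.
have q0 := prime_gt0 qp.
pose f a := if (a < size E')%N then (nth 0 E' a %% q)%N else q.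
have [|u uB Hu] := code_ex e0 bE BE Kb (k := K) (f := f) (leqnn K).
  by move=> j _; rewrite /f; case: ifP => // _; apply: leq_trans (ltn_pmod _ q0) (ltnW qb).
exists q; split=> //; exists u; split=> //.
have lsE a : (a < K)%N -> ls q u a = if (a < size E')%N then nth 0 E' a else m.
  move=> aK; case: ifP => aE.
    have ai : nth 0 E' a \in E' by apply: mem_nth.
    apply: mu_eq; first exact: (allP Em).
      by split; [apply/asboolP; rewrite -mE|rewrite Hu // /f aE].
    move=> z zm [az]; rewrite Hu // /f aE => e1; apply: qinj => //.
    by rewrite mE; apply/asboolP.
  apply/eqP; rewrite eqn_leq mu_le leqNgt; apply/negP => /muP[_ e1].
  have := ltn_pmod (ls q u a) q0; have -> : (ls q u a %% q = q)%N by rewrite [LHS]e1 Hu // /f aE.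
  by rewrite ltnn.
split=> [i im ai|a aK a' a'K].
  have iE : i \in E' by rewrite mE; apply/asboolP.
  have iK : (index i E' < K)%N by apply: leq_trans szE; rewrite index_mem.
  by exists (index i E'); split=> //; rewrite lsE // index_mem iE nth_index.
rewrite !lsE //; case: ifP => aE; last by rewrite ltnn.
case: ifP => a'E am e1; last by rewrite e1 ltnn in am.
by apply/eqP; rewrite -(nth_uniq 0 aE a'E uE) e1.
Qed.

Section ValidList.
Variables (q u : nat).
Hypothesis (Hv : valid q u).
Let P : 'M['F_p]_(d, K) := \matrix_(i, a) (lab i == ls q u a)%:R.

Lemma sel_cases (a : 'I_K) : (exists2 i, lab i = ls q u a & col a P = delta_mx i 0) \/
  (~ (ls q u a < m)%N /\ col a P = 0).
Proof.
have [lt|ge] := boolP (ls q u a < m)%N; [left|right].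
  have [i iE] := lab_surj lt; exists i => //.
  by apply/matrixP => j c; rewrite !mxE ord1 eqxx andbT -iE (inj_eq lab_inj).
split; first exact/negP.
apply/matrixP => j c; rewrite !mxE; case: eqP => // e1.
by move: ge; rewrite -e1 lab_lt.
Qed.

Lemma sel_restrict (X : nat -> nat -> nat) (Xm : 'M['F_p]_d) : (forall i j, Xm i j = (X (lab i) (lab j))%:R) ->
  forall a a', (P^T *m Xm *m P) a a' = (restrict b B m D (lab s) q u X a a')%:R.
Proof.
move=> XE a a'.
have -> : (P^T *m Xm *m P) a a' = ((col a P)^T *m Xm *m col a' P) 0 0.
  rewrite tr_col -row_mul [LHS]mxE [RHS]mxE; apply: eq_bigr => j _.
  by rewrite [row _ _ _ _]mxE [col _ _ _ _]mxE.
rewrite /restrict; have [[i iE ->]|[ni ->]] := sel_cases a; last first.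
  by rewrite trmx0 !mul0mx mxE iteF // => -[].
have [[j jE ->]|[nj ->]] := sel_cases a'; last first.
  by rewrite mulmx0 mxE iteF // => -[].
rewrite iteT; last by rewrite -iE -jE.
by rewrite trmx_delta -rowE -colE !mxE XE iE jE.
Qed.

Lemma sel_col (X : nat -> nat) (v : 'cV['F_p]_d) : (forall i, v i 0 = (X (lab i))%:R) ->
  forall a, (P^T *m v) a 0 = (ite (ls q u a < m)%N (X (ls q u a)) 0)%:R.
Proof.
move=> XE a; have -> : (P^T *m v) a 0 = ((col a P)^T *m v) 0 0.
  by rewrite tr_col -row_mul [RHS]mxE.
have [[i iE ->]|[ni ->]] := sel_cases a; last by rewrite trmx0 mul0mx mxE iteF.
rewrite iteT; last by rewrite -iE.
by rewrite trmx_delta -rowE mxE XE iE.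
Qed.

Lemma sel_id i j : aff (lab i) -> (P *m P^T) i j = (i == j)%:R.
Proof.
move=> ai; have [a [aK aE]] := Hv.1 _ (lab_lt i) ai.
rewrite mxE (bigD1 (Ordinal aK)) //= !mxE /= aE eqxx mul1r big1 ?addr0.
  by rewrite (inj_eq lab_inj) eq_sym.
move=> a' na; rewrite !mxE; case: eqP => [e1|]; last by rewrite mul0r.
case/eqP: na; apply: val_inj => /=; apply/esym.
by apply: (Hv.2 _ aK) => //; rewrite ?aE.
Qed.

Lemma sel_right : Dm *m (P *m P^T) = Dm.
Proof.
apply/matrixP => x j; rewrite mxE (bigD1 j) //=.
have H i : Dm x i != 0 -> aff (lab i).
  move=> nz; split=> //; right; exists (lab x); split=> //; right => e1.
  by rewrite DmE e1 eqxx in nz.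
have -> : Dm x j * (P *m P^T) j j = Dm x j.
  by have [->|nz] := eqVneq (Dm x j) 0; rewrite ?mul0r // sel_id ?eqxx ?mulr1 //; apply: H.
rewrite big1 ?addr0 // => i ij; have [->|nz] := eqVneq (Dm x i) 0; rewrite ?mul0r //.
by rewrite sel_id ?(negbTE ij) ?mulr0 //; apply: H.
Qed.

(** Permits inserting [P *m P^T] between the old inverse and [Dm], so that the Woodbury matrix is a
    product of two matrices of size [K]. *)
Lemma sel_left : (P *m P^T) *m Dm = Dm.
Proof.
have PS : (P *m P^T)^T = P *m P^T by rewrite trmx_mul trmxK.
apply/matrixP => i y; rewrite mxE (bigD1 i) //=.
have H j : Dm j y != 0 -> aff (lab j).
  move=> nz; split=> //; right; exists (lab y); split=> //; left => e1.
  by rewrite DmE e1 eqxx in nz.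
have -> : (P *m P^T) i i * Dm i y = Dm i y.
  by have [->|nz] := eqVneq (Dm i y) 0; rewrite ?mulr0 // sel_id ?eqxx ?mul1r //; apply: H.
rewrite big1 ?addr0 // => j ij; have [->|nz] := eqVneq (Dm j y) 0; rewrite ?mulr0 //.
by rewrite -PS mxE sel_id ?(negbTE ij) ?mul0r //; apply: H.
Qed.

Notation G := (schur L b B K m p N D (lab s) q u).
Notation C := (cramer_mx L b B K m p N D (lab s) (lab t) r q u).

Lemma restrict_lt (X : nat -> nat -> nat) a a' :
  (forall i j, (i < m)%N -> (j < m)%N -> (X i j < p)%N) -> (restrict b B m D (lab s) q u X a a' < p)%N.
Proof. by move=> HX; rewrite /restrict /ite; case: asboolP => [[]|_]; [exact: HX|exact: prime_gt0]. Qed.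

Lemma schurE (a a' : 'I_K) : (G a a')%:R = (1%:M + P^T *m invmx Bm *m Dm *m P) a a' :> 'F_p.
Proof.
have -> : P^T *m invmx Bm *m Dm *m P = (P^T *m invmx Bm *m P) *m (P^T *m Dm *m P).
  by rewrite -[in LHS]sel_left !mulmxA.
pose F a'' := (restrict b B m D (lab s) q u N a a'' * restrict b B m D (lab s) q u D a'' a')%N.
have lt x y : (x < p)%N -> (y < p)%N -> (x * y <= p * p)%N by move=> ? ?; apply: leq_mul; apply: ltnW.
have p0 := prime_gt0 pp.
have SE : bigsum L b B K (K * (p * p) + 1) K F = (\sum_(a'' < K) F a'')%N.
  apply: (bigsumE e0 bE BE Kb bL); first exact: ltnW.
    rewrite addn1 ltnS -[X in (_ <= X * _)%N](card_ord K) -sum_nat_const.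
    by apply: leq_sum => c _; apply: lt; apply: restrict_lt.
  move=> z; apply: (zero_of_small_divisors (k := nu)) => //.
  by apply: leq_trans nub; move: (K * K * nu)%N (K * nu)%N => x y; lia.
transitivity ((\sum_(a'' < K) F a'' + ite (a = a' :> nat) 1 0)%N%:R : 'F_p).
  by apply/eqP; rewrite Fp_natE // /schur modn_mod -/F SE.
rewrite natrD addrC [in RHS]mxE [X in _ = X + _]mxE [X in _ = _ + X]mxE; congr (_ + _).
  by rewrite /ite; case: asboolP => [/val_inj->|ne]; rewrite ?eqxx //; case: eqP => // e1; case: ne; rewrite e1.
rewrite natr_sum; apply: eq_bigr => c _; rewrite natrM.
by rewrite (sel_restrict NE) (sel_restrict DmE).
Qed.

Lemma updates_valid :
  (~ singular L b B K p G /\ singular L b B K p C) <-> (Bm + Dm \in unitmx) /\ invmx (Bm + Dm) s t = r%:R.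
Proof.
have p0 := prime_gt0 pp.
have Glt a a' : (G a a' < p)%N by rewrite /schur ltn_mod.
have Clt a a' : (C a a' < p)%N by rewrite /cramer_mx /ite; case: asboolP; rewrite ?ltn_mod.
rewrite (singularP e0 bE BE Kb bL pp (M := G) (fun i j _ _ => Glt i j) nu1 nu2 nub).
rewrite (singularP e0 bE BE Kb bL pp (M := C) (fun i j _ _ => Clt i j) nu1 nu2 nub).
set Gm := 1%:M + P^T *m invmx Bm *m Dm *m P.
have -> : \matrix_(i < K, j < K) ((G i j)%:R : 'F_p) = Gm by apply/matrixP => a a'; rewrite mxE schurE.
have as_ : aff (lab s) by split=> //; left.
have [a [aK aE]] := Hv.1 _ (lab_lt s) as_.
have uniqa (a' : 'I_K) : (ls q u a' = lab s) <-> a' = Ordinal aK.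
  split=> [e1|->//]; apply: val_inj => /=.
  by apply: (Hv.2 _ (ltn_ord a') _ aK); rewrite ?e1 ?lab_lt.
pose T : 'cV['F_p]_d := delta_mx t 0.
pose c := P^T *m (invmx Bm *m T).
have -> : \matrix_(i < K, j < K) ((C i j)%:R : 'F_p) =
    \matrix_(i, j) (if j == Ordinal aK then c i 0 - r%:R * Gm i j else Gm i j).
  apply/matrixP => i j; rewrite [LHS]mxE [RHS]mxE /cramer_mx /ite; case: asboolP => [/uniqa ->|ne].
    rewrite eqxx -/(ite _ _ _); set x := ite _ _ _.
    transitivity ((x + (p - r) * G i (Ordinal aK))%N%:R : 'F_p).
      by apply/eqP; rewrite Fp_natE // modn_mod.
    rewrite natrD natrM natrB 1?ltnW // (_ : p%:R = 0) ?sub0r ?mulNr; last by apply/eqP; rewrite Fp_nat0.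
    congr (_ - _ * _); last by rewrite schurE.
    rewrite /c (sel_col (X := fun x => N x (lab t))) //.
    by move=> k; rewrite /T -colE mxE NE.
  by case: eqP => [e1|_]; [case: ne; apply/uniqa|rewrite schurE].
have DU := @woodbury_unit _ _ _ Bm Dm P Bu sel_right.
have DG : (\det Gm <> 0) <-> Gm \in unitmx by rewrite unitmxE unitfE; split=> /eqP.
have sol (BDu : Bm + Dm \in unitmx) := @woodbury_solution _ _ _ Bm Dm P Bu sel_right T BDu.
have zE : (P^T *m (invmx (Bm + Dm) *m T)) (Ordinal aK) 0 = invmx (Bm + Dm) s t.
  have -> : (P^T *m (invmx (Bm + Dm) *m T)) (Ordinal aK) 0 = ((col (Ordinal aK) P)^T *m (invmx (Bm + Dm) *m T)) 0 0.
    by rewrite tr_col -row_mul [RHS]mxE.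
  have [[i iE ->]|[]] := sel_cases (Ordinal aK); last by rewrite /= aE lab_lt.
  by rewrite trmx_delta -rowE mxE -colE mxE (lab_inj (etrans iE aE)).
split=> [[/DG Gu /eqP]|[BDu rE]].
  have BDu : Bm + Dm \in unitmx by rewrite -DU.
  by rewrite (cramer_singular _ _ Gu (sol BDu)) zE => /eqP.
have Gu : Gm \in unitmx by rewrite DU.
split; first exact/DG.
by apply/eqP; rewrite (cramer_singular _ _ Gu (sol BDu)) zE rE.
Qed.

End ValidList.

Lemma updates_sound : updates L b B K m p N D (lab s) (lab t) r ->
  (Bm + Dm \in unitmx) /\ invmx (Bm + Dm) s t = r%:R.
Proof. by move=> [q [qb [u [uB [Hv /(updates_valid Hv)]]]]]. Qed.

Lemma updates_complete (E : seq nat) : (size E <= K)%N -> (forall i, aff i -> i \in E) ->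
  (Bm + Dm \in unitmx) -> invmx (Bm + Dm) s t = r%:R -> updates L b B K m p N D (lab s) (lab t) r.
Proof.
move=> EK HE H1 H2; have [q [qb [u [uB Hv]]]] := valid_list_ex EK HE.
by exists q; split=> //; exists u; split=> //; split=> //; apply/updates_valid.
Qed.

End UpdateCorrect.

(** * Choice of the parameters *)

Section Dimensions.

(* digits in base [b = c ^ 2], sequences of length [K], [B = b ^ K] *)
Definition good_params K0 n K c B := K0 <= K /\ (pow2 c /\ (K ^ 5 <= c /\ (c <= K ^ 6 /\
  (powr (c * c) K B /\ n <= B)))).

(** Since [n <= B <= K ^ (12 * K)], every fixed power of [n] is below [2 ^ nu] with [nu] a multiple
    of [K * K]; so the test needs a number of primes of order [K ^ 4]. With [b = c * c = 4 ^ g],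
    [many_primes] provides [c], which is at least [K ^ 5], and [K0 <= K] absorbs the constants. *)
Lemma good_paramsP l cp K0 n K c B : (24 * cp + 12 * l + 64) * 3 + 3 <= K0 ->
  good_params K0 n K c B ->
  exists e nu, [/\ 0 < e, c * c = 2 ^ e, B = (c * c) ^ K, K < c * c & c * c <= K ^ 12] /\
   forall p, 0 < p -> p <= n ^ cp ->
    [/\ K * (p * K.+1) <= 2 ^ nu, c * c * crr_scale (c * c) p + 1 <= 2 ^ nu,
     K * (p * p) + 1 <= 2 ^ nu, n ^ l <= 2 ^ nu &
     K * K * nu + K * nu + nu + 3 <= size (primes_below (c * c))].
Proof.
set C := 24 * cp + 12 * l + 64 => CK [K0K [/pow2P[g ->] [K5 [K6 [Bp nB]]]]].
have K1 : 67 <= K by lia.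
have KE : K < 2 ^ K by apply: ltn_expl.
have g5 : 5 <= g.
  rewrite -(@leq_exp2l 2) //; apply: leq_trans K5; rewrite leq_exp2r //; lia.
have bE : 2 ^ g * 2 ^ g = 2 ^ (g + g) by rewrite expnD.
have b4 : 2 ^ g * 2 ^ g = 4 ^ g by rewrite bE -[4]/(2 ^ 2) -expnM; congr (2 ^ _); lia.
have Kc : K <= 2 ^ g by apply: leq_trans K5; rewrite -{1}(expn1 K) leq_exp2l //; lia.
have c1 : 1 < 2 ^ g by lia.
have Kb : K < 2 ^ g * 2 ^ g by nia.
have e0 : 0 < g + g by lia.
move/(powrP e0 bE _ Kb): Bp nB => BE nB.
have bK : 2 ^ g * 2 ^ g <= K ^ 12 by rewrite -[12]/(6 + 6) expnD leq_mul.
have K2 j : K ^ j <= 2 ^ (K * j) by rewrite expnM; case: j => // j; rewrite leq_exp2r // ltnW.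
have n12 : n <= 2 ^ (12 * (K * K)).
  apply: leq_trans nB _; rewrite BE; apply: (@leq_trans ((K ^ 12) ^ K)); first by rewrite leq_exp2r; lia.
  by rewrite -expnM; apply: leq_trans (K2 _) _; rewrite leq_exp2l //; lia.
have KK : K <= K * K by nia.
exists (g + g), (C * (K * K)); split=> [//|p p0 pn].
have pK : p <= 2 ^ (12 * cp * (K * K)).
  apply: leq_trans pn _; have [->|cp0] := posnP cp; first by rewrite expn0 expn_gt0.
  apply: (@leq_trans ((2 ^ (12 * (K * K))) ^ cp)); first by rewrite leq_exp2r.
  by rewrite -expnM leq_exp2l //; nia.
have b12 : 2 ^ g * 2 ^ g <= 2 ^ (12 * (K * K)).
  by apply: leq_trans bK _; apply: leq_trans (K2 _) _; rewrite leq_exp2l //; nia.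
split.
- apply: (@leq_trans (2 ^ K * (2 ^ (12 * cp * (K * K)) * 2 ^ K))); first by rewrite !leq_mul // ltnW.
  by rewrite -!expnD leq_exp2l // /C; nia.
- set b := 2 ^ g * 2 ^ g in Kb bK b12 *; rewrite /crr_scale.
  apply: (@leq_trans (2 ^ 4 * (2 ^ (12 * (K * K)) * 2 ^ (12 * (K * K)) * 2 ^ (12 * cp * (K * K))))).
    apply: (@leq_trans (2 ^ 4 * (b * b * p))); last by rewrite !leq_mul.
    rewrite -[2 ^ 4]/16; nia.
  by rewrite -!expnD leq_exp2l // /C; nia.
- apply: (@leq_trans (2 * (2 ^ K * (2 ^ (12 * cp * (K * K)) * 2 ^ (12 * cp * (K * K)))))).
    apply: (@leq_trans (2 * (K * (p * p)))); first nia.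
    by rewrite !leq_mul // ltnW.
  by rewrite -!expnD -expnS leq_exp2l // /C; nia.
- have [->|l0] := posnP l; first by rewrite expn0 expn_gt0.
  apply: (@leq_trans ((2 ^ (12 * (K * K))) ^ l)); first by rewrite leq_exp2r.
  by rewrite -expnM leq_exp2l // /C; nia.
- rewrite b4; apply: leq_trans (many_primes (ltnW g5)); apply: leq_trans K5.
  apply: (@leq_trans (K * (K * K * (K * K)))); last by rewrite -[K ^ 5]/(K * (K * (K * (K * K)))); nia.
  have : C * 3 + 3 <= K by lia.
  move: KK K1; set y := K * K => KK K1 CK'.
  apply: (@leq_trans ((C * 3 + 3) * (y * y))); last by rewrite leq_mul2r CK' orbT.
  have h1 : K * (C * y) <= y * (C * y) by rewrite leq_mul2r KK orbT.
  have h2 : C * y <= y * (C * y) by rewrite leq_pmull //; lia.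
  have h3 : 1 <= y * y by rewrite muln_gt0; lia.
  have -> : (C * 3 + 3) * (y * y) = 3 * (y * (C * y)) + 3 * (y * y) by ring.
  by move: (y * (C * y)) (K * (C * y)) (C * y) (y * y) h1 h2 h3 => a1 a2 a3 a4; clear; lia.
Qed.

(** [c] is the least power of 2 from [K ^ 5] on, hence at most [K ^ 6]. Then
    [B <= (K ^ K) ^ 12 <= n ^ (12 * c5)], and the additional 1 in the exponent makes the bounds
    strict, as quantification requires. *)
Lemma good_params_ex K0 n K c5 : 2 <= K0 -> K0 <= K -> n <= K ^ K -> K ^ K <= n ^ c5 -> 1 < n ->
  exists c B, [/\ good_params K0 n K c B, c < n ^ (12 * c5 + 1) & B < n ^ (12 * c5 + 1)].
Proof.
move=> K02 K0K nK Kn n1; have K2 : 2 <= K by lia.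
pose g := up_log 2 (K ^ 5).
have K51 : 1 < K ^ 5 by rewrite -{1}(exp1n 5) ltn_exp2r.
have /andP[g1 g2] : 2 ^ g.-1 < K ^ 5 <= 2 ^ g by apply: up_log_bounds.
have g0 : 0 < g by rewrite lt0n; apply/eqP => e0; move: g2; rewrite e0 expn0; lia.
have c6 : 2 ^ g <= K ^ 6.
  by rewrite -(prednK g0) expnS expnS; apply: leq_mul => //; apply: ltnW.
have Kc : K < 2 ^ g * 2 ^ g.
  apply: (@leq_trans (K ^ 2)); first by nia.
  rewrite expnS expn1; apply: leq_mul; apply: leq_trans g2; rewrite -{1}(expn1 K) leq_exp2l //; lia.
have bE : 2 ^ g * 2 ^ g = 2 ^ (g + g) by rewrite expnD.
pose B := (2 ^ g * 2 ^ g) ^ K.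
have e0 : 0 < g + g by lia.
have B12 : B <= n ^ (12 * c5).
  apply: (@leq_trans ((K ^ 12) ^ K)).
    by rewrite leq_exp2r; [rewrite -[12]/(6 + 6) expnD leq_mul|lia].
  rewrite -expnM mulnC expnM [12 * c5]mulnC expnM leq_exp2r //.
have cB : 2 ^ g <= B.
  apply: (@leq_trans (2 ^ g * 2 ^ g)); first by rewrite leq_pmulr // expn_gt0.
  by rewrite -{1}(expn1 (2 ^ g * 2 ^ g)) leq_exp2l; [lia|nia].
have lt : n ^ (12 * c5) < n ^ (12 * c5 + 1) by rewrite ltn_exp2l // addn1.
exists (2 ^ g), B; split.
- split=> //; split; first by apply/pow2P; exists g.
  split=> //; split=> //; split; first exact/(powrP e0 bE _ Kc).
  apply: leq_trans nK _; rewrite leq_exp2r; last lia.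
  exact: ltnW.
- by apply: leq_ltn_trans lt; apply: leq_trans B12.
- exact: leq_ltn_trans lt.
Qed.

(* [k = O(log n / log log n)], without logarithms *)
Definition self_power_bounded (k : nat -> nat) := exists C n0, forall n, n0 <= n ->
  forall K, n <= K ^ K -> k n <= C * K.

(** [K] is a constant multiple of the least [Ks] with [n <= Ks ^ Ks]; the factor only raises the
    exponent [c5]. For the finitely many [n] below the threshold nothing is known about [k n], and
    [K] is instead large enough to list all [n ^ l] indices. *)
Lemma self_power_dimension k l K0 : self_power_bounded k ->
  exists c5, forall n, 1 < n -> exists K,
    [/\ K0 <= K, (2 * k n + 3 <= K) \/ (n ^ l <= K), n <= K ^ K & K ^ K <= n ^ c5].
Proof.
move=> [C [n0 HC]]; pose C2 := K0 + (2 * C + 3) + n0 ^ l + 1.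
exists ((4 * C2 + 4) * C2) => n n1.
have ex : exists K, n <= K ^ K by exists n; apply: ltnW; apply: ltn_expl.
have [Ks nK Kmin] := ex_minnP ex.
have Ks2 : 2 <= Ks by case: Ks nK {Kmin} => [|[|]] //; rewrite ?exp1n; lia.
(* For [Ks >= 3] one has [Ks <= Ks.-1 ^ 2] and [2 * Ks <= 4 * Ks.-1], while minimality gives
   [Ks.-1 ^ Ks.-1 < n]. *)
have Kb : Ks ^ Ks <= n ^ 4.
  have [le|gt] := leqP Ks 2.
    have -> : Ks = 2 by lia.
    by apply: (@leq_trans (n ^ 2)); [rewrite leq_exp2r|rewrite leq_exp2l].
  have lt : Ks.-1 ^ Ks.-1 < n by rewrite ltnNge; apply/negP => /Kmin; lia.
  apply: (@leq_trans ((Ks.-1 ^ Ks.-1) ^ 4)); last by rewrite leq_exp2r // ltnW.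
  apply: (@leq_trans ((Ks.-1 ^ 2) ^ Ks)); first by rewrite leq_exp2r; [rewrite -mulnn; nia|lia].
  by rewrite -!expnM leq_exp2l; lia.
exists (C2 * Ks); split.
- rewrite /C2; nia.
- have [le|lt] := leqP n0 n; [left|right].
    by have := HC n le Ks nK; rewrite /C2; nia.
  apply: (@leq_trans (n0 ^ l)); last by rewrite /C2; nia.
  by case: (l) => // l'; rewrite leq_exp2r // ltnW.
- apply: leq_trans nK _; apply: (@leq_trans ((C2 * Ks) ^ Ks)).
    by rewrite leq_exp2r; [rewrite leq_pmull // /C2; lia|lia].
  rewrite leq_pexp2l //; last by rewrite leq_pmull // /C2; lia.
  by rewrite muln_gt0 /C2; lia.
- have C20 : 0 < C2 by rewrite /C2; lia.
  have -> : (C2 * Ks) ^ (C2 * Ks) = (C2 ^ Ks * Ks ^ Ks) ^ C2.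
    by rewrite -expnMn -expnM [Ks * C2]mulnC.
  rewrite [X in _ <= X]expnM leq_exp2r // expnD leq_mul //.
  apply: (@leq_trans ((2 ^ C2) ^ Ks)); first by rewrite leq_exp2r; [apply: ltnW; apply: ltn_expl|lia].
  rewrite -expnM [C2 * Ks]mulnC expnM expnM leq_exp2r //.
  by apply: leq_trans Kb; rewrite leq_exp2r //; lia.
Qed.

End Dimensions.

(** * Hybrid matrices *)

Section Hybrid.
Import Order.TTheory GRing.Theory Num.Theory.
Local Open Scope ring_scope.
Variables (d m : nat) (lab : 'I_d -> nat).
Hypothesis (lab_lt : forall i, (lab i < m)%N).

Definition pos i j := (lab i * m + lab j)%N.
Definition shift_on a i j := (i == j) && ~~ (pos i j + m * m < a)%N.

(* Up to age [m ^ 2] the entries of [A] are added one by one to [x], from then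
   on the occurrences of [x] are removed one by one. *)
Definition hyb (R : comNzRingType) (A : 'M[int]_d) a (x : R) : 'M[R]_d :=
  \matrix_(i, j) (x *+ shift_on a i j + (A i j)%:~R *+ (pos i j < a)%N).

Lemma pos_lt i j : (pos i j < m * m)%N.
Proof.
rewrite /pos; have := lab_lt i; have := lab_lt j.
by move: (lab i) (lab j) => x y; nia.
Qed.

Lemma hyb_0 (R : comNzRingType) A (x : R) : hyb A 0 x = x%:M.
Proof. by apply/matrixP => i j; rewrite !mxE /shift_on andbT mulr0n addr0; case: (i == j). Qed.

Lemma hyb_late (R : comNzRingType) A a : (m * m <= a)%N -> hyb A a (0 : R) = map_mx intr A.
Proof.
move=> ma; apply/matrixP => i j; rewrite !mxE mul0rn add0r.
by rewrite (leq_trans (pos_lt i j) ma) mulr1n.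
Qed.

Lemma hyb_end (R : comNzRingType) A (x : R) : hyb A (2 * (m * m)) x = map_mx intr A.
Proof.
apply/matrixP => i j; rewrite !mxE /shift_on.
have lt := pos_lt i j.
have -> : (pos i j + m * m < 2 * (m * m))%N by lia.
have -> : (pos i j < 2 * (m * m))%N by lia.
by rewrite andbF mulr0n add0r mulr1n.
Qed.

Definition hybP (F : fieldType) (A : 'M[int]_d) a : 'M[{poly F}]_d := hyb A a 'X.

Lemma horner_det_hybP (F : fieldType) A a (x : F) : (\det (hybP F A a)).[x] = \det (hyb A a x).
Proof.
rewrite -[LHS]/(horner_eval x _) -det_map_mx; congr (\det _).
apply/matrixP => i j; rewrite !mxE rmorphD !rmorphMn /= rmorph_int.
by congr (_ *+ _ + _); apply: hornerX.
Qed.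

Lemma size_det_hybP (F : fieldType) A a : (size (\det (hybP F A a)) <= d.+1)%N.
Proof.
rewrite /determinant; apply: (leq_trans (size_sum _ _ _)); apply/bigmax_leqP => s _.
have -> : (-1) ^+ s * \prod_i hybP F A a i (s i) = ((-1) ^+ s) *: \prod_i hybP F A a i (s i) :> {poly F}.
  by rewrite -mul_polyC rmorphXn rmorphN1.
apply: (leq_trans (size_scale_leq _ _)).
apply: (leq_trans (size_prod_leq _ _)).
have le : (\sum_(i < d) size (hybP F A a i (s i)) <= \sum_(i < d) 2)%N.
  apply: leq_sum => i _; rewrite mxE.
  apply: (leq_trans (size_polyD _ _)); rewrite geq_max; apply/andP; split.
    by case: (shift_on _ _ _); rewrite ?mulr1n ?mulr0n ?size_polyX ?size_poly0.
  have -> : (A i (s i))%:~R = ((A i (s i))%:~R)%:P :> {poly F} by rewrite rmorph_int.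
  case: (_ < _)%N; rewrite ?mulr1n ?mulr0n ?size_poly0 //.
  exact: leq_trans (size_polyC_leq1 _) _.
rewrite leq_subLR; apply: (@leq_trans (\sum_(i < d) 2).+1); first by rewrite ltnS.
by rewrite sum_nat_const card_ord; lia.
Qed.

Lemma det_hybP_neq0 (F : fieldType) A a : (\det (map_mx intr A : 'M[F]_d) != 0 \/ (a <= m * m)%N) ->
  \det (hybP F A a) != 0.
Proof.
have [le|gt] := leqP a (m * m); last first.
  case=> [dA|//]; apply: contra dA => /eqP e; rewrite -(@hyb_late F A a (ltnW gt)) -horner_det_hybP e.
  by rewrite horner0.
move=> _; pose C : 'M[F]_d := \matrix_(i, j) (- ((A i j)%:~R *+ (pos i j < a)%N)).
have -> : hybP F A a = char_poly_mx C.
  apply/matrixP => i j; rewrite !mxE /shift_on.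
  have -> : (pos i j + m * m < a)%N = false by apply/negbTE; rewrite -leqNgt; lia.
  by rewrite andbT rmorphN opprK rmorphMn /= rmorph_int.
exact: monic_neq0 (char_poly_monic C).
Qed.

(** The product of the polynomials is nonzero and its degree is below [p], so it cannot vanish on
    the whole field. *)
Lemma common_nonroot p (fs : seq {poly 'F_p}) c : prime p ->
  (forall f, f \in fs -> f != 0 /\ (size f <= c.+1)%N) -> (size fs * c < p)%N ->
  exists x : 'F_p, forall f, f \in fs -> f.[x] != 0.
Proof.
move=> pp Hf cp; pose g := \prod_(f <- fs) f.
have [g0 gs] : g != 0 /\ (size g <= (size fs * c).+1)%N.
  rewrite /g; elim: fs Hf {cp g} => [|f fs IH] Hf; first by rewrite big_nil oner_neq0 size_poly1.
  have [|g0 gs] := IH _; first by move=> f' Hf'; apply: Hf; rewrite inE Hf' orbT.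
  have [f0 fs0] := Hf f (mem_head _ _).
  rewrite big_cons mulf_neq0 //; split=> //; rewrite size_mul // mulSn.
  apply: (@leq_trans (c.+1 + (size fs * c).+1).-1); last by rewrite addSn addnS.
  by rewrite -!subn1 leq_sub2r // leq_add.
have [/existsP[x gx]|] := boolP [exists x : 'F_p, g.[x] != 0].
  exists x => f ff; apply: contra gx => /eqP e.
  by rewrite /g horner_prod (big_rem f) //= e mul0r.
rewrite negb_exists => /forallP H.
have gr : all (root g) (enum 'F_p) by apply/allP => x _; rewrite rootE; have := H x; rewrite negbK.
have := max_poly_roots g0 gr (enum_uniq _); rewrite -cardE card_Fp // => lt.
by have := leq_trans lt gs; rewrite ltnS leqNgt cp.
Qed.

Lemma adj_int_bound (A : 'M[int]_d) c i j : (0 < c)%N -> (forall i j, `|A i j| <= c)%N ->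
  (`|\adj A i j| <= (d * c) ^ d)%N.
Proof.
move=> c0 Ac; rewrite mxE /cofactor abszM abszX abszN1 exp1n mul1n.
apply: leq_trans (det_int_bound (c := c) _) _; first by move=> x y; rewrite !mxE.
have : (0 < d)%N by apply: leq_trans (ltn_ord i).
case: (d) => // d' _ /=.
apply: (@leq_trans ((d'.+1 * c) ^ d')%N); last by rewrite leq_pexp2l // muln_gt0.
by case: (d') => // d2; rewrite leq_exp2r // leq_mul2r leqnSn orbT.
Qed.

(** Counting back from the present, the [i]-th matrix met the thread that is now complete at age
    [2 * (m * m) - i]. *)
Lemma survivor (hist : seq 'M[int]_d) A0 c k g (s t : 'I_d) : (0 < c)%N -> (3 < g)%N ->
  (forall A, A \in A0 :: hist -> (forall i j, `|A i j| <= c)%N /\ \det A != 0) ->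
  \adj A0 s t != 0 -> ((d * c) ^ d <= 2 ^ k)%N ->
  ((m * m).+2 * k + (2 * (m * m)).+1 * d + 2 < 2 ^ g)%N ->
  exists p, [/\ prime p, (p < 4 ^ g)%N & exists x : 'F_p,
    (forall i, (i <= 2 * (m * m))%N -> (i < size (A0 :: hist))%N ->
       hyb (nth A0 (A0 :: hist) i) (2 * (m * m) - i) x \in unitmx) /\
    invmx (map_mx intr A0 : 'M['F_p]_d) s t != 0].
Proof.
move=> c0 g3 HA adj0 dk Hg; set h := A0 :: hist.
(* Older matrices met the thread at an age below [m * m], where the determinant is a monic
   polynomial in [x] whatever they are. *)
pose h1 := take (m * m).+1 h.
pose Z := (`|\adj A0 s t| * \prod_(A <- h1) `|\det A|)%N.
have h1h A : A \in h1 -> A \in h by apply: mem_take.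
have Z0 : (0 < Z)%N.
  rewrite muln_gt0 absz_gt0 adj0 big_seq_cond; apply: prodn_cond_gt0 => A /andP[/h1h/HA[_ dA] _].
  by rewrite absz_gt0.
have Zk : (Z < 2 ^ ((m * m).+2 * k + 1))%N.
  rewrite addn1 expnS; apply: (@leq_ltn_trans (2 ^ ((m * m).+2 * k))); last by rewrite ltn_Pmull ?expn_gt0.
  rewrite mulSn expnD; apply: leq_mul.
    by apply: leq_trans dk; apply: adj_int_bound => //; have [] := HA A0 (mem_head _ _).
  apply: (@leq_trans (2 ^ (size h1 * k))); last by rewrite leq_exp2l // leq_mul2r size_take_min geq_minl orbT.
  elim: h1 h1h {Z0 Z} => [|A h1 IH] H; first by rewrite big_nil.
  rewrite big_cons /= mulSn expnD leq_mul ?IH //; last by move=> A' A'h; apply: H; rewrite inE A'h orbT.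
  by apply: leq_trans dk; apply: det_int_bound; have [] := HA A (H A (mem_head _ _)).
(* One polynomial of degree at most [d] per age must be avoided by [x], so the field needs at least
   [y] elements; discarding the primes below [y] costs at most [y] of them. *)
pose y := ((2 * (m * m)).+1 * d).+1.
pose ps := [seq p <- primes_below (4 ^ g) | (y <= p)%N].
have psp : all prime ps by apply/allP => p; rewrite mem_filter mem_primes_below => /and3P[].
have ups : uniq ps by rewrite filter_uniq // uniq_primes_below.
have szp : ((m * m).+2 * k + 1 < size ps)%N.
  have E := count_predC (fun p => y <= p)%N (primes_below (4 ^ g)).
  have le : (count (predC (fun p => y <= p)%N) (primes_below (4 ^ g)) <= y)%N.
    rewrite -size_filter -[X in (_ <= X)%N](size_iota 0 y); apply: uniq_leq_size.
      by rewrite filter_uniq // uniq_primes_below.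
    by move=> p; rewrite mem_filter mem_iota /= -ltnNge => /andP[].
  have := many_primes g3; rewrite [size ps]size_filter.
  have yE : y = ((2 * (m * m)).+1 * d).+1 by [].
  move: E le Hg yE; clearbody y; move: ((m * m).+2 * k)%N ((2 * (m * m)).+1 * d)%N (2 ^ g)%N => z1 z2 z3.
  set c1 := count (predC _) _; set c2 := count _ _; set c3 := size _; clearbody c1 c2 c3; lia.
have [p pps pZ] := prime_avoiding ups psp Z0 Zk szp.
have pp : prime p by apply: (allP psp).
move: pps; rewrite mem_filter mem_primes_below => /and3P[yp _ pg].
move: pZ; rewrite Euclid_dvdM // negb_or => /andP[padj pdet].
exists p; split=> //.
pose f i := \det (hybP 'F_p (nth A0 h i) (2 * (m * m) - i)).
pose cnt := minn (2 * (m * m)).+1 (size h).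
have dA i : (i <= m * m)%N -> (i < size h)%N -> \det (map_mx intr (nth A0 h i) : 'M['F_p]_d) != 0.
  move=> im ih; rewrite det_map_mx /= Fp_int0 // dvdzE /=.
  apply: contra pdet => pd; rewrite Euclid_dvd_prod // big_has; apply/hasP.
  exists (nth A0 h i) => //; rewrite -(nth_take A0 (im : (i < (m * m).+1)%N)).
  by apply: mem_nth; rewrite size_take_min leq_min ltnS im ih.
have [||x Hx] := @common_nonroot p [seq f i | i <- iota 0 cnt] d pp.
- move=> q /mapP[i]; rewrite mem_iota /= add0n leq_min ltnS => /andP[i2 ih] ->.
  split; last exact: size_det_hybP.
  apply: det_hybP_neq0; have [im|im] := leqP i (m * m); [left; exact: dA|right].
  by rewrite leq_subLR mul2n -addnn leq_add2r ltnW.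
- rewrite size_map size_iota; apply: leq_trans yp; rewrite /y ltnS leq_mul2r geq_minl orbT //.
exists x; split=> [i i2 ih|].
  rewrite unitmxE unitfE -horner_det_hybP; apply: Hx; apply/mapP; exists i => //.
  by rewrite mem_iota /= add0n leq_min ltnS i2 ih.
have A0u : map_mx intr A0 \in (unitmx : {pred 'M['F_p]_d}).
  by rewrite unitmxE unitfE; apply: (dA 0).
rewrite /invmx A0u mxE mulf_neq0 //; first by rewrite invr_eq0; apply: (dA 0).
by rewrite -map_mx_adj mxE Fp_int0 // dvdzE.
Qed.

End Hybrid.

(** * The dynamic program *)

Section Program.
Variables (l d cp cb K0 : nat).

(** Number of digits of an age: [2 * n ^ (2 * l) < n ^ (2 * l + 2)] for [n >= 2]. *)
Definition ca := 2 * l + 2.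
(* [Some true]: the threads; [Some false]: a copy of the previous input;
   [None]: a nullary flag, empty until the first change. *)
Definition xar (j : option bool) : nat :=
  match j with
  | Some true => ca + (cp + (cp + (l + (l + cp))))
  | Some false => l + (l + d.+1)
  | None => 0
  end.
Notation W := (world (l + (l + d.+1)) (l + l) xar).
Definition threadR : symbol (option bool) := Aux (Some (Some true)).
Definition oldR : symbol (option bool) := Aux (Some (Some false)).
Definition flagR : symbol (option bool) := Aux (Some None).

Definition code n a p x i j v :=
  a + n ^ ca * (p + n ^ cp * (x + n ^ cp * (i + n ^ l * (j + n ^ l * v)))).
Definition ecode n i j sg v := i + n ^ l * (j + n ^ l * (sg + n * v)).

Definition absval r (w : W r) S i j := mu (wn w ^ d) (fun v =>
  relnum w S (ecode (wn w) i j 0 v) \/ relnum w S (ecode (wn w) i j 1 v)).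
Definition negval r (w : W r) S i j :=
  exists v, v < wn w ^ d /\ relnum w S (ecode (wn w) i j 1 v).
Definition emod r (w : W r) S p i j :=
  ite (negval w S i j) ((p - absval w S i j %% p) %% p) (absval w S i j %% p).
Definition isflag r (w : W r) := relnum w flagR 0.
(** At the first change no previous input is stored. It is replaced by the diagonal of the new input
    with zeros turned into ones, which agrees with the new input outside the change when the initial
    matrix is diagonal and invertible. *)
Definition oldmod r (w : W r) p i j := ite (isflag w) (emod w oldR p i j)
  (ite (i = j) (ite (absval w Input i i = 0) (1 %% p) (emod w Input p i i)) 0).
Definition hybn (E : nat -> nat -> nat) m a p x i j :=
  (ite (i = j /\ ~ (i * m + j + m * m < a)) x 0 + ite (i * m + j < a) (E i j) 0) %% p.
Definition oldH r (w : W r) a p x i j := hybn (oldmod w p) (wn w ^ l) a p x i j.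
Definition newH r (w : W r) a p x i j := hybn (emod w Input p) (wn w ^ l) a.+1 p x i j.
Definition dltn r (w : W r) a p x i j := (newH w a p x i j + (p - oldH w a p x i j)) %% p.
Definition invn r (w : W r) a p x i j := ite (isflag w)
  (mu p (fun v => relnum w threadR (code (wn w) a p x i j v)))
  (ite (i = j) (mu p (fun v => (v * oldH w a p x i i) %% p = 1 %% p)) 0).
(** A living thread stores all entries of its inverse, so the presence of some value at position
    [(0, 0)] is a sufficient test. At the first change the hybrids are diagonal and invertibility is
    read off the diagonal. *)
Definition alive r (w : W r) a p x :=
  (isflag w /\ exists v, v < p /\ relnum w threadR (code (wn w) a p x 0 0 v)) \/
  (~ isflag w /\ forall i, i < wn w ^ l -> oldH w a p x i i <> 0).
Definition thread r (w : W r) a p x i j v : Prop :=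
  prime p /\ (x < p /\ (v < p /\
  ((a = 0 /\ (0 < x /\ ((i = j /\ (v * x) %% p = 1) \/ (i <> j /\ v = 0)))) \/
   (0 < a /\ (a <= 2 * (wn w ^ l * wn w ^ l) /\ (alive w (a - 1) p x /\
    exists K, K < wn w ^ cb /\ exists c, c < wn w ^ cb /\ exists B, B < wn w ^ cb /\
      (good_params K0 (wn w) K c B /\
       updates 12 (c * c) B K (wn w ^ l) p (invn w (a - 1) p x) (dltn w (a - 1) p x) i j v))))))).

Lemma dpred_relnum_ren r r' (al : W r' -> W r) S (y : W r' -> nat) : renaming al -> dterm y ->
  dpred (fun w => relnum (al w) S (y w)).
Proof.
move=> ra dy; apply: (dp1_at (P := fun w => relnum (al w) S)) => //.
exact: (dp1_ren (dp1_relnum S) ra).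
Qed.

Local Ltac dext ::= match goal with
  | |- dpred (fun w => relnum (@?a w) _ (@?y w)) => refine (@dpred_relnum_ren _ _ a _ y _ _)
  | |- dpred (fun w => pow2 _) => refine (dpred_pow2 _)
  | |- dpred (fun w => powr _ _ _) => refine (dpred_powr _ _ _)
  end.

Section Closed.
Variables (r r' : nat) (al : W r' -> W r).
Hypothesis ra : renaming al.

Lemma dterm_absval S (i j : W r' -> nat) : dterm i -> dterm j ->
  dterm (fun w => absval (al w) S (i w) (j w)).
Proof. by move=> di dj; rewrite /absval /ecode; dfn. Qed.

Lemma dpred_negval S (i j : W r' -> nat) : dterm i -> dterm j ->
  dpred (fun w => negval (al w) S (i w) (j w)).
Proof. by move=> di dj; rewrite /negval /ecode; dfn. Qed.

Lemma dterm_emod S (p i j : W r' -> nat) : dterm p -> dterm i -> dterm j ->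
  dterm (fun w => emod (al w) S (p w) (i w) (j w)).
Proof.
move=> dp di dj; have da := dterm_absval S di dj; have dn := dpred_negval S di dj.
by rewrite /emod; dfn.
Qed.

Lemma dpred_isflag : dpred (fun w => isflag (al w)).
Proof. by rewrite /isflag; dfn. Qed.

Lemma dterm_oldmod (p i j : W r' -> nat) : dterm p -> dterm i -> dterm j ->
  dterm (fun w => oldmod (al w) (p w) (i w) (j w)).
Proof.
move=> dp di dj; have df := dpred_isflag; have d1 := dterm_emod oldR dp di dj.
have d2 := dterm_emod Input dp di di; have d3 := dterm_absval Input di di.
by rewrite /oldmod; dfn.
Qed.

Lemma dterm_oldH (a p x i j : W r' -> nat) : dterm a -> dterm p -> dterm x -> dterm i -> dterm j ->
  dterm (fun w => oldH (al w) (a w) (p w) (x w) (i w) (j w)).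
Proof.
by move=> da dp dx di dj; have d1 := dterm_oldmod dp di dj; rewrite /oldH /hybn; dfn.
Qed.

Lemma dterm_dltn (a p x i j : W r' -> nat) : dterm a -> dterm p -> dterm x -> dterm i -> dterm j ->
  dterm (fun w => dltn (al w) (a w) (p w) (x w) (i w) (j w)).
Proof.
move=> da dp dx di dj; have d1 := dterm_oldH da dp dx di dj; have d2 := dterm_emod Input dp di dj.
by rewrite /dltn /newH /hybn; dfn.
Qed.

End Closed.

Lemma dterm_invn r r' (al : W r' -> W r) (a p x i j : W r' -> nat) : renaming al ->
  dterm a -> dterm p -> dterm x -> dterm i -> dterm j ->
  dterm (fun w => invn (al w) (a w) (p w) (x w) (i w) (j w)).
Proof.
move=> ra da dp dx di dj; have df := dpred_isflag ra.
rewrite /invn /code; dfn.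
by apply: (dterm_oldH (al := fun w => al (wren h w))); dfn.
Qed.

Lemma dpred_alive r r' (al : W r' -> W r) (a p x : W r' -> nat) : renaming al ->
  dterm a -> dterm p -> dterm x -> dpred (fun w => alive (al w) (a w) (p w) (x w)).
Proof.
move=> ra da dp dx; have df := dpred_isflag ra.
rewrite /alive /code; dfn.
by apply: (dterm_oldH (al := fun w => al (wren h w))); dfn.
Qed.

Lemma dpred_thread r r' (al : W r' -> W r) (a p x i j v : W r' -> nat) : renaming al ->
  dterm a -> dterm p -> dterm x -> dterm i -> dterm j -> dterm v ->
  dpred (fun w => thread (al w) (a w) (p w) (x w) (i w) (j w) (v w)).
Proof.
move=> ra da dp dx di dj dv; have d1 := dpred_alive ra (dterm_sub da (dterm1 _ _ _ _)) dp dx.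
rewrite /thread /good_params; dfn.
apply: (dpred_updates 12 (b := fun w => x1 (wren h1 w) * x1 (wren h1 w))
  (N := fun w => invn (al (wren h (wren h0 (wren h1 w)))) (a (wren h (wren h0 (wren h1 w))) - 1)
         (p (wren h (wren h0 (wren h1 w)))) (x (wren h (wren h0 (wren h1 w)))))
  (D := fun w => dltn (al (wren h (wren h0 (wren h1 w)))) (a (wren h (wren h0 (wren h1 w))) - 1)
         (p (wren h (wren h0 (wren h1 w)))) (x (wren h (wren h0 (wren h1 w)))))); dfn.
- by apply: (dterm_invn (al := fun w => al (wren h (wren h0 (wren h1 (wren h2 w)))))); dfn.
- by apply: (dterm_dltn (al := fun w => al (wren h (wren h0 (wren h1 (wren h2 w)))))); dfn.
Qed.

Definition decode n (y : nat) : nat * nat * nat * nat * nat * nat :=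
  let y1 := y %/ n ^ ca in let y2 := y1 %/ n ^ cp in let y3 := y2 %/ n ^ cp in let y4 := y3 %/ n ^ l in
  (y %% n ^ ca, y1 %% n ^ cp, y2 %% n ^ cp, y3 %% n ^ l, y4 %% n ^ l, y4 %/ n ^ l).

Definition thread_at r (w : W r) y :=
  let: (a, p, x, i, j, v) := decode (wn w) y in thread w a p x i j v.

(** All relations are redefined simultaneously, so the answer cannot read the new threads; it
    evaluates their defining formula at full age instead. *)
Definition answer_at r (w : W r) y := exists p, p < wn w ^ cp /\ exists x, x < p /\ exists v,
  v < p /\ (v <> 0 /\ thread w (2 * (wn w ^ l * wn w ^ l)) p x (y %% wn w ^ l) (y %/ wn w ^ l) v).

Lemma dterm_whole r : dterm (fun w : W r => dval (we w)).
Proof.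
apply: dterm_ext (dterm_numv _ _ _ (enum 'I_r)) => w _; rewrite /numv.
by rewrite (map_tnth_enum (we w)).
Qed.

Lemma thread_formula r : exists f : formula (l + (l + d.+1)) (l + l) xar r,
  forall w : W r, 1 < wn w -> (sat f w <-> thread_at w (dval (we w))).
Proof.
have dw := dterm_whole r.
by apply: (dpred_thread (al := fun w => w) (a := fun w => dval (we w) %% wn w ^ ca)); dfn.
Qed.

Lemma answer_formula r : exists f : formula (l + (l + d.+1)) (l + l) xar r,
  forall w : W r, 1 < wn w -> (sat f w <-> answer_at w (dval (we w))).
Proof.
have dw := dterm_whole r; change (dpred (fun w : W r => answer_at w (dval (we w)))).
pose y (w : W r) := dval (we w); have dy : dterm y by exact: dw.
have -> : (fun w : W r => answer_at w (dval (we w))) = (fun w : W r => answer_at w (y w)) by [].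
rewrite /answer_at; dfn.
by apply: (dpred_thread (al := fun w => wren h (wren h0 (wren h1 w)))); dfn.
Qed.

Lemma input_formula r : exists f : formula (l + (l + d.+1)) (l + l) xar r,
  forall w : W r, 1 < wn w -> (sat f w <-> relnum w Input (dval (we w))).
Proof. by have dw := dterm_whole r; apply: dpred_relnum. Qed.

Lemma true_formula r : exists f : formula (l + (l + d.+1)) (l + l) xar r,
  forall w : W r, 1 < wn w -> (sat f w <-> True).
Proof. exact: (dpred_const _ _ _ _ True). Qed.

Lemma decode_code n a p x i j v : a < n ^ ca -> p < n ^ cp -> x < n ^ cp -> i < n ^ l -> j < n ^ l ->
  decode n (code n a p x i j v) = (a, p, x, i, j, v).
Proof.
move=> Ha Hp Hx Hi Hj; rewrite /decode /code.
have dv M y z : y < M -> (y + M * z) %/ M = z.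
  by move=> yM; rewrite addnC mulnC divnMDl ?divn_small ?addn0 //; apply: leq_ltn_trans yM.
have md M y z : y < M -> (y + M * z) %% M = y.
  by move=> yM; rewrite addnC mulnC modnMDl modn_small.
by rewrite !dv // !md.
Qed.

Lemma code_lt n a p x i j v : a < n ^ ca -> p < n ^ cp -> x < n ^ cp -> i < n ^ l -> j < n ^ l -> v < n ^ cp ->
  code n a p x i j v < n ^ xar (Some true).
Proof.
have H M y M' z : y < M -> z < M' -> y + M * z < M * M'.
  move=> yM zM; apply: (@leq_trans (M + M * z)); first by rewrite ltn_add2r.
  by rewrite -mulnS leq_mul2l zM orbT.
move=> ? ? ? ? ? ?; rewrite /code /= (expnD n ca) (expnD n cp) (expnD n cp) (expnD n l) (expnD n l).
by do 5![apply: (H) => //].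
Qed.

End Program.

(** * Indices and entries as numbers *)

Section Labels.
Variables (l d n : nat).
Hypothesis n1 : 1 < n.
Notation dim := #|idx l n|.

Definition lab (i : 'I_dim) : nat := dval (tval (enum_val i : l.-tuple 'I_n)).

Lemma lab_lt i : lab i < n ^ l.
Proof. by have := dval_lt (tval (enum_val i : l.-tuple 'I_n)); rewrite size_tuple. Qed.

Lemma lab_inj : injective lab.
Proof.
move=> i j /dval_inj; rewrite !size_tuple => /(_ erefl) /val_inj.
exact: enum_val_inj.
Qed.

Lemma lab_surj x : x < n ^ l -> exists i, lab i = x.
Proof.
move=> /(dval_surj (ltnW n1))[u uE]; exists (enum_rank (u : idx l n)).
by rewrite /lab enum_rankK.
Qed.

Lemma lab_rank (u : idx l n) : lab (enum_rank u) = dval (tval (u : l.-tuple 'I_n)).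
Proof. by rewrite /lab enum_rankK. Qed.

Lemma dval_cat (u v : seq 'I_n) : dval (u ++ v) = dval u + n ^ size u * dval v.
Proof. by elim: u => [|a u IH] /=; rewrite ?mul1n // IH expnS mulnDr addnA mulnA. Qed.

Lemma dval_sum k (u : k.-tuple 'I_n) : \sum_(i < k) tnth u i * n ^ i = dval u.
Proof.
elim: k u => [|k IH] u; first by rewrite big_ord0 (tuple0 u).
case/tupleP: u => a u; rewrite big_ord_recl /= tnth0 expn0 muln1 -IH big_distrr /=; congr (_ + _).
by apply: eq_bigr => i _; rewrite tnthS expnS mulnCA.
Qed.

Definition mrel (R : {set (l + (l + d.+1)).-tuple 'I_n}) y := exists u : (l + (l + d.+1)).-tuple 'I_n, u \in R /\ dval u = y.

Lemma mem_matrix_rel (A : 'M[int]_dim) (r c : idx l n) sg (u : d.-tuple 'I_n) :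
  (cat_tuple r (cat_tuple c (cons_tuple sg u)) \in matrix_rel d A) = encodes sg u (entry A r c).
Proof.
rewrite inE; apply/idP/idP => [|H]; last first.
  apply/existsP; exists r; apply/existsP; exists c; apply/existsP; exists sg; apply/existsP; exists u.
  by rewrite eqxx.
move=> /existsP[r' /existsP[c' /existsP[sg' /existsP[u' /andP[/eqP/(congr1 val) /= E H]]]]].
move/eqP: E; rewrite eqseq_cat ?size_tuple // => /andP[/eqP/val_inj er].
rewrite eqseq_cat ?size_tuple // => /andP[/eqP/val_inj ec] /eqP[es /val_inj eu].
by rewrite er ec es eu.
Qed.

Lemma mrelP (A : 'M[int]_dim) i j (sg v : nat) : sg <= 1 -> v < n ^ d ->
  mrel (matrix_rel d A) (ecode l n (lab i) (lab j) sg v) <-> sg = (A i j < 0)%R :> nat /\ v = `|A i j|%N.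
Proof.
move=> sg1 vd; have sn : sg < n by apply: leq_ltn_trans n1.
have [u uE] := dval_surj (ltnW n1) vd.
pose t := cat_tuple (enum_val i : l.-tuple 'I_n) (cat_tuple (enum_val j : l.-tuple 'I_n) (cons_tuple (Ordinal sn) u)).
have tE : dval t = ecode l n (lab i) (lab j) sg v.
  by rewrite /t /= !dval_cat /= !size_tuple uE.
have -> : mrel (matrix_rel d A) (ecode l n (lab i) (lab j) sg v) <-> t \in matrix_rel d A.
  split=> [[t' [t'R]]|tR]; last by exists t.
  rewrite -tE => /dval_inj; rewrite !size_tuple => /(_ erefl)/val_inj e.
  by rewrite -e.
rewrite mem_matrix_rel /encodes /entry !enum_valK dval_sum uE /=.
by split=> [/andP[/eqP-> /eqP->]|[-> ->]]; rewrite ?eqxx.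
Qed.

End Labels.

Section Entries.
Variables (l d cp r : nat) (w : world (l + (l + d.+1)) (l + l) (xar l d cp) r).
Hypothesis n1 : 1 < wn w.
Notation dim := #|idx l (wn w)|.
Variables (S : symbol (option bool)) (A : 'M[int]_dim).
Hypothesis SA : forall y, relnum w S y <-> mrel (matrix_rel d A) y.
Hypothesis bA : forall i j, `|A i j| < wn w ^ d.

Lemma absvalE i j : absval w S (lab i) (lab j) = `|A i j|%N.
Proof.
apply: mu_eq => //.
  case: (boolP (A i j < 0)%R) => s; [right|left]; apply/SA/mrelP => //.
    by rewrite s.
  by rewrite (negbTE s).
by move=> z zd [/SA/(mrelP n1)|/SA/(mrelP n1)] H; case: H.
Qed.

Lemma negvalE i j : negval w S (lab i) (lab j) <-> (A i j < 0)%R.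
Proof.
split=> [[v [vd /SA/(mrelP n1) H]]|s].
  by case: H => //; case: (A i j < 0)%R.
by exists `|A i j|%N; split=> //; apply/SA/mrelP => //; rewrite s.
Qed.

Import Order.TTheory GRing.Theory Num.Theory.
Lemma emodE p i j : prime p ->
  emod w S p (lab i) (lab j) < p /\ ((emod w S p (lab i) (lab j))%:R = (A i j)%:~R :> 'F_p)%R.
Proof.
move=> pp; have p0 := prime_gt0 pp.
have md x : ((x %% p)%N%:R = x%:R :> 'F_p)%R by apply/eqP; rewrite Fp_natE // modn_mod.
rewrite /emod absvalE /ite; case: asboolP => [/negvalE s|s]; rewrite ltn_mod p0; split=> //.
  rewrite md natrB; last by rewrite ltnW // ltn_mod.
  have -> : (p%:R = 0 :> 'F_p)%R by apply/eqP; rewrite Fp_nat0.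
  have E : (A i j = - (`|A i j|%N%:Z))%R by rewrite ltz0_abs // opprK.
  by rewrite md sub0r [in RHS]E mulrNz.
rewrite md; have : (0 <= A i j)%R by rewrite leNgt; apply/negP => s'; apply: s; apply/negvalE.
by move=> /gez0_abs {2}<-.
Qed.

End Entries.

Section HybridNumbers.
Import GRing.Theory.
Local Open Scope ring_scope.
Variables (l n p : nat) (pp : prime p).
Notation dim := #|idx l n|.
Variables (E : nat -> nat -> nat) (A : 'M[int]_dim).
Hypothesis EA : forall i j, (E (lab i) (lab j))%:R = (A i j)%:~R :> 'F_p.

Lemma hybn_lt a x i j : (hybn E (n ^ l) a p x i j < p)%N.
Proof. by rewrite /hybn ltn_mod prime_gt0. Qed.

Lemma hybnE a x i j : (hybn E (n ^ l) a p x (lab i) (lab j))%:R = hyb (n ^ l) (@lab l n) A a (x%:R : 'F_p) i j.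
Proof.
rewrite /hybn mxE.
have -> y : ((y %% p)%N%:R = y%:R :> 'F_p)%R by apply/eqP; rewrite Fp_natE // modn_mod.
rewrite natrD /shift_on /pos; congr (_ + _).
  rewrite /ite; case: asboolP => [[/lab_inj -> /negP ->]|H]; first by rewrite eqxx.
  have [e|_] := eqVneq i j; last by [].
  by rewrite e in H *; case: ltnP => //= ge; case: H; split=> //; rewrite ltnNge ge.
by rewrite /ite asboolb; case: ifP => // _; rewrite EA.
Qed.

End HybridNumbers.

(** * One step of a thread *)

Section Step.
Import Order.TTheory GRing.Theory Num.Theory.
Local Open Scope ring_scope.
Variables (l d cp c5 K0 r : nat).
Notation cb := (12 * c5 + 1)%N.
Notation W := (world (l + (l + d.+1)) (l + l) (xar l d cp)).
Variable (w : W r).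
Hypothesis n1 : (1 < wn w)%N.
Hypothesis K0_large : ((24 * cp + 12 * l + 64) * 3 + 3 <= K0)%N.
Notation n := (wn w).
Notation m := (n ^ l)%N.
Notation dim := #|idx l n|.
Notation F := (2 * (m * m))%N.

Definition hybF (n0 : nat) (A : 'M[int]_#|idx l n0|) a p x := hyb (n0 ^ l) (@lab l n0) A a (x%:R : 'F_p).

(* Common to an ordinary update and to the first one, where the flag is unset and
   the inverses of the hybrids of a diagonal matrix are computed directly. *)
Definition effective (A : 'M[int]_dim) (Al : nat -> nat -> nat -> Prop) := forall p, prime p ->
  (forall i j, (oldmod w p (lab i) (lab j))%:R = (A i j)%:~R :> 'F_p) /\
  forall a x, (p < n ^ cp)%N -> (x < p)%N -> (a < F)%N ->
    (alive w a p x <-> Al a p x) /\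
    (Al a p x -> hybF A a p x \in unitmx /\
      forall i j, (invn w a p x (lab i) (lab j) < p)%N /\
        (invn w a p x (lab i) (lab j))%:R = invmx (hybF A a p x) i j).

Variables (A A' : 'M[int]_dim) (Al : nat -> nat -> nat -> Prop) (kk : nat).
Hypothesis (eff : effective A Al).
Hypothesis (HI : wI w = matrix_rel d A').
Hypothesis (bA' : forall i j, (`|A' i j| < n ^ d)%N).
Hypothesis (aff : affects_at_most kk (A' - A)).
Hypothesis (HK : exists K, [/\ (K0 <= K)%N, (2 * kk + 3 <= K)%N \/ (m <= K)%N, (n <= K ^ K)%N & (K ^ K <= n ^ c5)%N]).

Lemma input_mrel y : relnum w Input y <-> mrel (matrix_rel d A') y.
Proof. by rewrite -HI. Qed.

Lemma dltn_lt p a x i j : prime p -> (dltn w a p x i j < p)%N.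
Proof. by move=> pp; rewrite /dltn ltn_mod prime_gt0. Qed.

Lemma dltnE p a x i j : prime p ->
  (hybF A' a.+1 p x - hybF A a p x) i j = (dltn w a p x (lab i) (lab j))%:R.
Proof.
move=> pp; have [E1 _] := eff pp.
have EA' i' j' : (emod w Input p (lab i') (lab j'))%:R = (A' i' j')%:~R :> 'F_p.
  exact: (emodE n1 input_mrel bA' _ _ pp).2.
have -> : (hybF A' a.+1 p x - hybF A a p x) i j = hybF A' a.+1 p x i j - hybF A a p x i j.
  by rewrite mxE [X in _ + X]mxE.
rewrite /dltn /hybF -(hybnE pp EA') -(hybnE pp E1).
transitivity ((newH w a p x (lab i) (lab j) + (p - oldH w a p x (lab i) (lab j)))%N%:R : 'F_p); last first.
  by apply/eqP; rewrite Fp_natE // modn_mod.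
rewrite natrD natrB; last by rewrite ltnW // /oldH hybn_lt.
by have -> : (p%:R = 0 :> 'F_p) by [apply/eqP; rewrite Fp_nat0]; rewrite sub0r.
Qed.

(** Consecutive hybrids differ inside the change and at the one position that ageing switches, which
    is [a %% (m * m)] in both phases. Hence [2 * kk + 3]: the rows and columns of the change, the
    row and column of that position, and [s]. *)
Lemma affected_list K p a x (s : 'I_dim) : prime p -> (2 * kk + 3 <= K)%N \/ (m <= K)%N ->
  exists2 E : seq nat, (size E <= K)%N & forall i, affected m (dltn w a p x) (lab s) i -> i \in E.
Proof.
move=> pp [HkK|mK]; last first.
  by exists (iota 0 m); [rewrite size_iota|move=> i [im _]; rewrite mem_iota].
have [rows [cols [szr szc HD]]] := aff.
pose a' := (a %% (m * m))%N.
exists ([:: lab s; (a' %/ m)%N; (a' %% m)%N] ++ [seq lab i | i <- enum rows] ++ [seq lab i | i <- enum cols]).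
  rewrite !size_cat !size_map -!cardE /=; apply: leq_trans HkK.
  by move: szr szc; move: #|rows| #|cols| => x1 x2; lia.
have main i j : (dltn w a p x (lab i) (lab j) <> 0)%N ->
    [\/ (lab i = a' %/ m)%N /\ (lab j = a' %% m)%N | i \in rows /\ j \in cols].
  move=> nz; have Hne : (hybF A' a.+1 p x - hybF A a p x) i j != 0.
    by rewrite dltnE // Fp_nat0 //; apply/negP => /dvdn_leq dv; have := dltn_lt a x (lab i) (lab j) pp; lia.
  have [D0|Dn] := eqVneq ((A' - A) i j) 0; last by right; apply: HD.
  left; have AA : A' i j = A i j by apply/eqP; rewrite -subr_eq0; move: D0; rewrite !mxE => ->.
  have posE : (pos m (@lab l n) i j = a \/ pos m (@lab l n) i j + m * m = a)%N.
    apply: contrapT => /not_orP[/eqP h1 /eqP h2]; case/eqP: Hne.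
    rewrite !mxE AA /shift_on (ltnS _ a) (ltnS _ a).
    rewrite [(pos _ _ _ _ <= a)%N]leq_eqVlt (negbTE h1) [(pos _ _ _ _ + m * m <= a)%N]leq_eqVlt (negbTE h2) /=.
    by rewrite subrr.
  have plt := pos_lt (@lab_lt l n) i j.
  have aE : a' = pos m (@lab l n) i j.
    by rewrite /a'; case: posE => <-; [rewrite modn_small|rewrite modnDr modn_small].
  have m0 : (0 < m)%N by apply: leq_ltn_trans (lab_lt i).
  rewrite aE /pos divnMDl // divn_small ?lab_lt // addn0 modnMDl modn_small ?lab_lt //.
move=> i0 [im [->|[j0 [jm Hd]]]]; first by rewrite mem_head.
have [i iE] := lab_surj n1 im; have [j jE] := lab_surj n1 jm; subst i0 j0.
rewrite !inE !mem_cat; case: Hd => /main[[e1 e2]|[hr hc]].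
- by rewrite -e1 eqxx !orbT.
- by rewrite (map_f (@lab l n)) ?mem_enum // !orbT.
- by rewrite -e2 eqxx !orbT.
- by rewrite (map_f (@lab l n) (s := enum cols)) ?mem_enum // !orbT.
Qed.

Definition alive' a p x := [/\ prime p, (x < p)%N &
  (a = 0%N /\ (0 < x)%N) \/ [/\ (0 < a)%N, Al a.-1 p x & hybF A' a p x \in unitmx]].

Lemma thread_step a p x i j v : (a <= F)%N -> (p < n ^ cp)%N ->
  thread cb K0 w a p x (lab i) (lab j) v <->
  [/\ alive' a p x, (v < p)%N & invmx (hybF A' a p x) i j = v%:R].
Proof.
move=> aF pn; rewrite /thread /alive'.
have [pp|np] := boolP (prime p); last by split=> [[]|[[]]].
have p0 := prime_gt0 pp; have p1 := prime_gt1 pp.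
have [xp|nx] := boolP (x < p)%N; last by split=> [[_ []]|[[]]].
have [vp|nv] := boolP (v < p)%N; last by split=> [[_ [_ []]]|[]].
case: a aF => [|a] aF.
  have hE : hybF A' 0 p x = (x%:R)%:M by apply: hyb_0.
  have xz : (x%:R == 0 :> 'F_p) = (x == 0)%N.
    by rewrite Fp_nat0 //; apply/idP/eqP => [/dvdn_leq|->]; [lia|rewrite dvdn0].
  have inv : (0 < x)%N -> invmx (hybF A' 0 p x) = ((x%:R)^-1)%:M.
    by move=> x0; rewrite hE invmx_scalar.
  split=> [[_ [_ [_ [[_ [x0 H]]|[]//]]]]|[[_ _ [[_ x0]|[]//]] _]].
    split=> //; first by split=> //; left.
    rewrite inv // mxE; case: H => [[/lab_inj <- H]|[ne ->]].
      rewrite eqxx mulr1n; apply: (mulfI (_ : (x%:R : 'F_p) != 0)); first by rewrite xz -lt0n.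
      rewrite mulfV; last by rewrite xz -lt0n.
      by apply/eqP; rewrite -natrM -[1]/(1%:R) Fp_natE // mulnC H modn_small.
    by have [e|//] := eqVneq i j; case: ne; rewrite e.
  rewrite inv // mxE => E; do 3![split=> //]; left; do 2![split=> //].
  have [e|ne] := eqVneq i j; [left|right].
    rewrite e eqxx mulr1n in E *; split=> //.
    have /eqP : (v%:R * x%:R : 'F_p) == 1 by rewrite -E mulVf // xz -lt0n.
    by move/eqP; rewrite -natrM -[1]/(1%:R) Fp_natE // [X in _ == X]modn_small // => /eqP.
  split; first by move/lab_inj/eqP; rewrite (negbTE ne).
  rewrite (negbTE ne) mulr0n in E.
  have : (v%:R == 0 :> 'F_p) by rewrite -E.
  by rewrite Fp_nat0 // => /dvdn_leq; lia.
have [E1 /(_ a x pn xp aF) [E2 E3]] := eff pp.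
rewrite subn1 /= E2.
have key K c B : good_params K0 n K c B -> Al a p x -> exists e nu,
   [/\ (0 < e)%N, (c * c = 2 ^ e)%N, (B = (c * c) ^ K)%N, (K < c * c)%N & (c * c <= K ^ 12)%N] /\
   [/\ (K * (p * K.+1) <= 2 ^ nu)%N, (c * c * crr_scale (c * c) p + 1 <= 2 ^ nu)%N,
     (K * (p * p) + 1 <= 2 ^ nu)%N, (m <= 2 ^ nu)%N &
     (K * K * nu + K * nu + nu + 3 <= size (primes_below (c * c)))%N].
  by move=> /(good_paramsP K0_large)[e [nu [H1 H2]]] _; exists e, nu; split=> //; apply: H2; rewrite // ltnW.
have DE i' j' := @dltnE p a x i' j' pp.
have Dp i' j' : (i' < m)%N -> (j' < m)%N -> (dltn w a p x i' j' < p)%N by move=> _ _; apply: dltn_lt.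
have BD : hybF A a p x + (hybF A' a.+1 p x - hybF A a p x) = hybF A' a.+1 p x by rewrite addrC subrK.
split=> [[_ [_ [_ [[]//|[_ [_ [al [K [Kn [c [cn [B [Bn [gp up]]]]]]]]]]]]]]|[[_ _ [[]//|[_ al hu]]] _ iE]].
  have [hu Ninv] := E3 al.
  have NE i' j' : invmx (hybF A a p x) i' j' = (invn w a p x (lab i') (lab j'))%:R by rewrite (Ninv i' j').2.
  have Np i' j' : (i' < m)%N -> (j' < m)%N -> (invn w a p x i' j' < p)%N.
    by move=> /(lab_surj n1)[i2 <-] /(lab_surj n1)[j2 <-]; have [] := Ninv i2 j2.
  have [e [nu [[e0 bE BE Kb bL] [u1 u2 u3 u4 u5]]]] := key _ _ _ gp al.
  have := updates_sound e0 bE BE Kb bL pp u1 u2 u3 u4 u5 (@lab_lt l n) (@lab_inj l n) (lab_surj n1) hu DE NE Dp Np vp up.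
  by rewrite BD => -[H1 H2]; split=> //; split=> //; right.
have [hu0 Ninv] := E3 al.
have NE i' j' : invmx (hybF A a p x) i' j' = (invn w a p x (lab i') (lab j'))%:R by rewrite (Ninv i' j').2.
have Np i' j' : (i' < m)%N -> (j' < m)%N -> (invn w a p x i' j' < p)%N.
  by move=> /(lab_surj n1)[i2 <-] /(lab_surj n1)[j2 <-]; have [] := Ninv i2 j2.
do 3![split=> //]; right; split=> //; split=> //; split=> //.
(* Soundness above held for any guessed parameters; here one guess that can list all affected
   indices is produced. *)
have [K [K0K Kd nK Kn]] := HK.
have K02 : (2 <= K0)%N by apply: leq_trans K0_large; lia.
have [c [B [gp cn Bn]]] := good_params_ex K02 K0K nK Kn n1.
have Klt : (K < n ^ cb)%N.
  apply: leq_ltn_trans (_ : n ^ (12 * c5) < _)%N; last by rewrite ltn_exp2l // addn1.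
  apply: (@leq_trans (K ^ K)); first by case: (K) => // K'; rewrite expnS leq_pmulr // expn_gt0.
  by apply: leq_trans Kn _; rewrite leq_exp2l //; lia.
exists K; split=> //; exists c; split=> //; exists B; split=> //; split=> //.
have [e [nu [[e0 bE BE Kb bL] [u1 u2 u3 u4 u5]]]] := key _ _ _ gp al.
have [E szE HE] := affected_list a x i pp Kd.
apply: (updates_complete e0 bE BE Kb bL pp u1 u2 u3 u4 u5 (@lab_lt l n) (@lab_inj l n) (lab_surj n1) hu0 DE NE Dp Np vp szE HE).
  by rewrite BD.
by rewrite BD.
Qed.

End Step.

(** * The invariant on states *)

Section States.
Import Order.TTheory GRing.Theory Num.Theory.
Local Open Scope ring_scope.
Variables (l d cp n : nat).
Hypothesis n1 : (1 < n)%N.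
Notation W := (world (l + (l + d.+1)) (l + l) (xar l d cp)).
Notation st := (aux_state (l + l) (xar l d cp)).
Notation m := (n ^ l)%N.
Notation dim := #|idx l n|.
Notation F := (2 * (m * m))%N.

(** [h] runs from the newest matrix to the oldest; entry [k] was current when the thread had age
    [a - k]. *)
Definition survives (h : seq 'M[int]_dim) a p x := forall k, (k <= a)%N -> (k < size h)%N ->
  hybF (nth 0 h k) (a - k) p x \in unitmx.

Definition xrel (X : st n) y := exists u : (xar l d cp (Some true)).-tuple 'I_n, u \in X (Some (Some true)) /\ dval u = y.

(** Which threads are alive also depends on the initial state, so the set [Al] is only bounded:
    above by the invertibility of the current hybrid, below by the survival of the recorded
    history. *)
Definition good_state (X : st n) (A : 'M[int]_dim) (hist : seq 'M[int]_dim) :=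
  [/\ X (Some None) = finset.setT, X (Some (Some false)) = matrix_rel d A &
   exists Al : nat -> nat -> nat -> Prop, forall a p x, (a <= F)%N -> prime p -> (p < n ^ cp)%N -> (x < p)%N ->
    [/\ Al a p x -> hybF A a p x \in unitmx, survives (A :: hist) a p x -> Al a p x &
     forall i j v, (v < p)%N -> xrel X (code l cp n a p x (lab i) (lab j) v) <-> Al a p x /\ invmx (hybF A a p x) i j = v%:R]].

Definition bounded (A : 'M[int]_dim) := forall i j, (`|A i j| < n ^ d)%N.

Lemma Fp_val_uniq p (pp : prime p) (z : 'F_p) v : (v < p)%N -> z = v%:R -> v = val z.
Proof. by move=> vp ->; rewrite /= val_Fp_nat // modn_small. Qed.

Lemma effective_good r (I : {set (l + (l + d.+1)).-tuple 'I_n}) (X : st n) (e : r.-tuple 'I_n) A hist :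
  good_state X A hist -> bounded A ->
  exists2 Al, @effective l d cp r (World I X e) A Al &
    forall a p x, (a <= F)%N -> prime p -> (p < n ^ cp)%N -> (x < p)%N -> survives (A :: hist) a p x -> Al a p x.
Proof.
move=> [X1 X2 [Al HAl]] bA; exists Al; last first.
  by move=> a p x aF pp pn xp; have [_ H _] := HAl a p x aF pp pn xp.
set w := World I X e.
have fl : isflag w by exists [tuple]; rewrite /= X1 inE.
have oldE y : relnum w oldR y <-> mrel (matrix_rel d A) y by rewrite -X2.
move=> p pp; split=> [i j|a x pn xp aF].
  by rewrite /oldmod iteT //; have [] := emodE (w := w) n1 oldE bA i j pp.
have [H1 _ H3] := HAl a p x (ltnW aF) pp pn xp.
have m0 : (0 < m)%N by rewrite expn_gt0; lia.
have [i0 i0E] := lab_surj n1 m0.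
split.
  split=> [[[_ [v [vp]]]|[]//]|al].
    by rewrite -{1 2}i0E => /(H3 _ _ _ vp)[].
  left; split=> //; exists (val (invmx (hybF A a p x) i0 i0)); split; first exact: Fp_lt.
  by rewrite -{1 2}i0E; apply/H3; rewrite ?Fp_lt // Fp_valK.
move=> al; split=> [|i j]; first exact: H1.
have E : invn w a p x (lab i) (lab j) = val (invmx (hybF A a p x) i j).
  rewrite /invn iteT //; apply: mu_eq; first exact: Fp_lt.
    by apply/H3; rewrite ?Fp_lt // Fp_valK.
  by move=> z zp /(H3 _ _ _ zp)[_]; apply: Fp_val_uniq.
by rewrite E Fp_lt // Fp_valK.
Qed.

Lemma effective_init r (I : {set (l + (l + d.+1)).-tuple 'I_n}) (X : st n) (e : r.-tuple 'I_n) (A' : 'M[int]_dim) :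
  (forall S, X S = finset.set0) -> I = matrix_rel d A' -> bounded A' ->
  let A := \matrix_(i, j) (if i == j then (if A' i i == 0 then 1 else A' i i) else 0) in
  @effective l d cp r (World I X e) A (fun a p x => hybF A a p x \in unitmx).
Proof.
move=> X0 IE bA' A p pp; set w := World I X e.
have nfl : ~ isflag w by move=> [u]; rewrite /= X0 inE => -[].
have inE' y : relnum w Input y <-> mrel (matrix_rel d A') y by rewrite -IE.
have E1 i j : (oldmod w p (lab i) (lab j))%:R = (A i j)%:~R :> 'F_p.
  rewrite /oldmod iteF // mxE; have [->|ne] := eqVneq i j; last by rewrite iteF // => /lab_inj/eqP; rewrite (negbTE ne).
  rewrite iteT // (absvalE (w := w) n1 inE' bA'); case: eqP => [->|nz].
    by rewrite iteT //; apply/eqP; rewrite -[1%:~R]/(1%:R) Fp_natE // modn_mod.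
  by rewrite iteF; [have [] := emodE (w := w) n1 inE' bA' j j pp|move/eqP; rewrite absz_eq0 => /eqP].
split=> [//|a x pn xp aF].
have p1 := prime_gt1 pp.
have diagE (f : 'I_dim -> 'F_p) i j : diag_mx (\row_i f i) i j = f i *+ (i == j).
  by rewrite mxE; congr (_ *+ _); rewrite mxE.
have hdiag : hybF A a p x = diag_mx (\row_i hybF A a p x i i).
  apply/matrixP => i j; rewrite diagE; have [->|ne] := eqVneq i j; first by rewrite mulr1n.
  by rewrite mulr0n mxE /shift_on (negbTE ne) mulr0n add0r mxE (negbTE ne) mul0rn.
have oldHE i : (oldH w a p x (lab i) (lab i))%:R = hybF A a p x i i by apply: hybnE.
have oldH0 i : (oldH w a p x (lab i) (lab i) <> 0)%N <-> hybF A a p x i i != 0.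
  rewrite -oldHE Fp_nat0 //; split=> [nz|/negP nd e0]; last by apply: nd; rewrite e0 dvdn0.
  by apply/negP => /dvdn_leq dv; have := hybn_lt l n pp (oldmod w p) a x (lab i) (lab i); rewrite -/(oldH w a p x _ _); lia.
have unitE : (hybF A a p x \in unitmx) <-> forall i, hybF A a p x i i != 0.
  have detE : \det (hybF A a p x) = \prod_i hybF A a p x i i.
    by rewrite {1}hdiag det_diag; apply: eq_bigr => i _; rewrite mxE.
  rewrite unitmxE unitfE detE; split=> [/prodf_neq0 H i|H]; first exact: H.
  exact/prodf_neq0.
split.
  split=> [[[]//|[_ H]]|/unitE H]; last by right; split=> // y /(lab_surj n1)[i <-]; apply/oldH0.
  by apply/unitE => i; apply/oldH0; apply: H; apply: lab_lt.
move=> hu; split=> // i j; have hnz := unitE.1 hu.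
have invE : invmx (hybF A a p x) = diag_mx (\row_i (hybF A a p x i i)^-1).
  have mulE : hybF A a p x *m diag_mx (\row_i (hybF A a p x i i)^-1) = 1%:M.
    have rE (f : 'I_dim -> 'F_p) i' : (\row_i f i) 0 i' = f i' by rewrite mxE.
    rewrite {1}hdiag mulmx_diag; apply/matrixP => i' j'; rewrite diagE [RHS]mxE.
    by have [_|_] := eqVneq i' j'; rewrite ?mulr0n // !mulr1n !rE mulfV.
  by rewrite -[LHS]mulmx1 -mulE mulmxA mulVmx // mul1mx.
rewrite /invn iteF // invE diagE; have [->|ne] := eqVneq i j; last first.
  by rewrite iteF ?prime_gt0 // => /lab_inj/eqP; rewrite (negbTE ne).
rewrite iteT // mulr1n.
have E : mu p (fun v => ((v * oldH w a p x (lab j) (lab j)) %% p = 1 %% p)%N) = val ((hybF A a p x j j)^-1).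
  have P v : ((v * oldH w a p x (lab j) (lab j)) %% p = 1 %% p)%N <-> v%:R = (hybF A a p x j j)^-1 :> 'F_p.
    have -> : ((v * oldH w a p x (lab j) (lab j)) %% p = 1 %% p)%N <-> v%:R * hybF A a p x j j = 1 :> 'F_p.
      by rewrite -oldHE -natrM -[1]/(1%:R); split=> [H|/eqP]; [apply/eqP; rewrite Fp_natE // H|rewrite Fp_natE // => /eqP].
    split=> [H|->]; last by rewrite mulVf.
    by rewrite -[LHS](mulfK (hnz j)) H mul1r.
  apply: mu_eq; first exact: Fp_lt.
    by apply/P; rewrite Fp_valK.
  by move=> z zp /P; move/esym; apply: Fp_val_uniq.
by rewrite E Fp_lt // Fp_valK.
Qed.

End States.

(** * One round of the program *)

Section Rounds.
Import Order.TTheory GRing.Theory Num.Theory.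
Local Open Scope ring_scope.
Variables (l d n c5 kk : nat).
Hypotheses (n1 : (1 < n)%N).
(* [n ^ cw] bounds the number of primes to avoid, see [prime_budget]. *)
Definition cw := (4 * l + d + 5)%N.
(** The primes range below [4 ^ g], where [2 ^ g] is the least power of 2 from [n ^ cw] on and hence
    at most [n ^ (cw + 1)]. *)
Definition cpr := (2 * cw + 2)%N.
Definition K0r := ((24 * cpr + 12 * l + 64) * 3 + 3)%N.
Notation cp := cpr.
Notation cb := (12 * c5 + 1)%N.
Notation W := (world (l + (l + d.+1)) (l + l) (xar l d cp)).
Notation st := (aux_state (l + l) (xar l d cp)).
Notation m := (n ^ l)%N.
Notation dim := #|idx l n|.
Notation F := (2 * (m * m))%N.
Hypothesis (HK : exists K, [/\ (K0r <= K)%N, (2 * kk + 3 <= K)%N \/ (m <= K)%N, (n <= K ^ K)%N & (K ^ K <= n ^ c5)%N]).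

Definition hist_ok (h : seq 'M[int]_dim) := forall A, A \in h ->
  (forall i j, (`|A i j| <= n ^ d)%N) /\ \det A != 0.

Section Round.
Variables (I : {set (l + (l + d.+1)).-tuple 'I_n}) (X X' : st n).
Hypothesis HX1 : forall e, e \in X' (Some None).
Hypothesis HX2 : forall e, e \in X' (Some (Some false)) <-> relnum (World I X e) Input (dval e).
Hypothesis HX3 : forall e, e \in X' (Some (Some true)) <-> thread_at cb K0r (World I X e) (dval e).
Hypothesis HX4 : forall e, e \in X' None <-> answer_at cb K0r (World I X e) (dval e).
Variables (A A' : 'M[int]_dim) (hist : seq 'M[int]_dim) (Al : nat -> nat -> nat -> Prop).
Hypothesis (eff : @effective l d cp 0 (World I X [tuple]) A Al).
Hypothesis (surv : forall a p x, (a <= F)%N -> prime p -> (p < n ^ cp)%N -> (x < p)%N ->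
   survives (A :: hist) a p x -> Al a p x).
Hypothesis (HI : I = matrix_rel d A').
Hypothesis (bA' : bounded d A').
Hypothesis (aff : affects_at_most kk (A' - A)).

Lemma step_at r (e : r.-tuple 'I_n) a p x i j v : (a <= F)%N -> (p < n ^ cp)%N ->
  thread cb K0r (World I X e) a p x (lab i) (lab j) v <->
  [/\ alive' (w := World I X e) A' Al a p x, (v < p)%N & invmx (hybF A' a p x) i j = v%:R].
Proof. exact: (@thread_step l d cp c5 K0r r (World I X e) n1 (leqnn _) A A' Al kk eff HI bA' aff HK). Qed.

Notation live := (alive' (w := World I X [tuple]) A' Al).

Lemma live_survives a p x : (a <= F)%N -> prime p -> (p < n ^ cp)%N -> (x < p)%N ->
  survives (A' :: A :: hist) a p x -> live a p x.
Proof.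
move=> aF pp pn xp sv; split=> //; case: a aF sv => [|a] aF sv; [left|right].
  split=> //; have := sv 0%N isT isT; rewrite /= subn0 /hybF hyb_0 unitmxE det_scalar unitfE => H.
  rewrite lt0n; apply/eqP => x0; move: H; rewrite x0; apply/negP; rewrite negbK expf_eq0 eqxx andbT.
  have m0 : (0 < m)%N by rewrite expn_gt0; lia.
  by have [i _] := lab_surj n1 m0; apply: leq_trans (ltn_ord i).
split=> //; last by have := sv 0%N isT isT; rewrite /= subn0.
apply: surv; rewrite ?(ltnW aF) // => k ka kh.
by have := sv k.+1 ka kh; rewrite subSS.
Qed.

Lemma age_lt a : (a <= F)%N -> (a < n ^ ca l)%N.
Proof.
move=> aF; apply: (leq_ltn_trans aF); rewrite -expnD addnn -mul2n /ca expnD.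
have y0 : (0 < n ^ (2 * l))%N by rewrite expn_gt0; lia.
have : (2 ^ 2 <= n ^ 2)%N by rewrite leq_exp2r.
by move: (n ^ (2 * l))%N (n ^ 2)%N y0 => y z; nia.
Qed.

Lemma xrel_round a p x i j v : (a <= F)%N -> prime p -> (p < n ^ cp)%N -> (x < p)%N -> (v < p)%N ->
  xrel X' (code l cp n a p x (lab i) (lab j) v) <-> live a p x /\ invmx (hybF A' a p x) i j = v%:R.
Proof.
move=> aF pp pn xp vp; have an := age_lt aF; have xn := ltn_trans xp pn; have vn := ltn_trans vp pn.
have dc := decode_code v an pn xn (lab_lt i) (lab_lt j).
split=> [[u [/HX3]]|[H1 H2]].
  rewrite /thread_at => H uE; move: H; rewrite (_ : decode _ _ _ _ = (a, p, x, lab i, lab j, v)); last by rewrite uE.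
  by move=> /step_at[//|//|? ? ?]; split.
have [u uE] := dval_surj (ltnW n1) (code_lt d an pn xn (lab_lt i) (lab_lt j) vn).
exists u; split=> //; apply/HX3; rewrite /thread_at (_ : decode _ _ _ _ = (a, p, x, lab i, lab j, v)); last by rewrite uE.
by apply/step_at.
Qed.

Lemma good_round : good_state X' A' (A :: hist).
Proof.
split.
- by apply/setP => e; rewrite HX1 inE.
- apply/setP => e; apply/idP/idP => [/HX2[u [uI /dval_inj]]|eI]; last by apply/HX2; exists e; rewrite /= HI.
  by rewrite !size_tuple => /(_ erefl)/val_inj <-; rewrite -HI.
exists live => a p x aF pp pn xp; split.
- move=> [_ _ [[-> x0]|[]//]]; rewrite /hybF hyb_0 unitmxE det_scalar unitfE expf_neq0 // Fp_nat0 //.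
  by apply/negP => /dvdn_leq; lia.
- exact: live_survives.
- by move=> i j v vp; apply: xrel_round.
Qed.

Lemma prime_budget : exists g, [/\ (3 < g)%N, (4 ^ g <= n ^ cp)%N &
  ((m * m).+2 * (n * (l + d) * m) + (2 * (m * m)).+1 * dim + 2 < 2 ^ g)%N].
Proof.
pose g := up_log 2 (n ^ cw).
have w1 : (1 < n ^ cw)%N by rewrite -{1}(exp1n cw) ltn_exp2r // /cw; lia.
have /andP[g1 g2] : (2 ^ g.-1 < n ^ cw <= 2 ^ g)%N by apply: up_log_bounds.
have g0 : (0 < g)%N by rewrite lt0n; apply/eqP => e0; move: g2; rewrite e0 expn0; lia.
exists g; split.
- rewrite -(@leq_exp2l 2) //; apply: leq_trans g2; apply: (@leq_trans (2 ^ cw)%N).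
    by rewrite leq_exp2l // /cw; lia.
  by rewrite leq_exp2r // /cw; lia.
- rewrite -[4%N]/(2 ^ 2)%N -expnM mulnC expnM /cp (_ : 2 * cw + 2 = (cw.+1) * 2)%N; last lia.
  rewrite expnM leq_exp2r // -(prednK g0) expnS [X in (_ <= X)%N]expnS leq_mul //; exact: ltnW.
have dimE : dim = m by rewrite card_tuple card_ord.
rewrite dimE; apply: leq_trans g2; pose E := (4 * l + d + 1)%N.
have m0 : (0 < m)%N by rewrite expn_gt0; lia.
have ld : (l + d <= n ^ (l + d))%N by apply: ltnW; apply: ltn_expl.
have y0 : (0 < n ^ E)%N by rewrite expn_gt0; lia.
have t1 : ((m * m).+2 * (n * (l + d) * m) <= 3 * n ^ E)%N.
  apply: (@leq_trans (3 * (m * m) * (n * n ^ (l + d) * m))%N).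
    by rewrite !leq_mul //; nia.
  rewrite -mulnA leq_mul2l /=; rewrite -expnS -!expnD leq_exp2l // /E; lia.
have t2 : ((2 * (m * m)).+1 * m <= 3 * n ^ E)%N.
  apply: (@leq_trans (3 * (m * m * m))%N); first by nia.
  by rewrite leq_mul2l /= -!expnD leq_exp2l // /E; lia.
apply: (@leq_trans (16 * n ^ E)%N).
  apply: (@leq_ltn_trans (3 * n ^ E + 3 * n ^ E + 2)%N); first by rewrite leq_add2r leq_add.
  by move: (n ^ E)%N y0 => y; lia.
rewrite (_ : cw = 4 + E)%N; last by rewrite /cw /E; lia.
by rewrite expnD leq_mul2r -[16%N]/(2 ^ 4)%N leq_exp2r // n1 orbT.
Qed.

Lemma answer_round : hist_ok (A' :: A :: hist) -> X' None = inverse_support A'.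
Proof.
move=> hok; have [bA dA] := hok A' (mem_head _ _).
have Qu : overQ A' \in unitmx by rewrite unitmxE unitfE det_map_mx /= intr_eq0.
apply/setP => e.
pose s : idx l n := [tuple tnth e (lshift l i) | i < l]; pose t : idx l n := [tuple tnth e (rshift l i) | i < l].
have eE : e = cat_tuple s t.
  apply: eq_from_tnth => i; rewrite -(splitK i); case: (fintype.split i) => k /=.
    by rewrite tnth_lshift tnth_mktuple.
  by rewrite tnth_rshift tnth_mktuple.
clearbody s t; set i := enum_rank s; set j := enum_rank t.
have numE : dval e = (lab i + n ^ l * lab j)%N by rewrite eE /= dval_cat size_tuple !lab_rank.
have numm : (dval e %% n ^ l = lab i)%N by rewrite numE addnC mulnC modnMDl modn_small // lab_lt.
have numd : (dval e %/ n ^ l = lab j)%N.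
  by rewrite numE addnC mulnC divnMDl ?divn_small ?addn0 ?lab_lt // expn_gt0; lia.
(* Over the rationals the inverse and the integer adjugate have the same support, and the adjugate
   can be reduced mod [p]. *)
have -> : (e \in inverse_support A') = (\adj A' i j != 0).
  rewrite inE; have -> : \adj A' i j != 0 = (entry (invmx (overQ A')) s t != 0).
    have invE : invmx (overQ A') i j = (\det A')%:~R^-1 * (\adj A' i j)%:~R.
      by rewrite /invmx Qu mxE /overQ det_map_mx -map_mx_adj; congr (_ * _); rewrite mxE.
    have nd : (\det A')%:~R != 0 :> rat by rewrite intr_eq0.
    by rewrite /entry -/i -/j invE mulf_eq0 (negbTE (invr_neq0 nd)) intr_eq0.
  apply/existsP/idP => [[s' /existsP[t' /andP[/eqP e1 H]]]|H]; last first.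
    by exists s; apply/existsP; exists t; rewrite eE eqxx.
  move: e1; rewrite eE => /(congr1 val)/eqP; rewrite /= eqseq_cat ?size_tuple // => /andP[/eqP/val_inj -> /eqP/val_inj ->].
  exact: H.
apply/idP/idP => [/HX4|ad].
  (* Soundness holds for every prime: a nonzero residue in the inverse of [A'] mod [p] refutes that
     the adjugate entry is 0. *)
  rewrite /answer_at /= numm numd => -[p [pn [x [xp [v [vp [v0]]]]]]].
  move=> /step_at[//|//|[pp _ H] _].
  have F0 : (0 < F)%N by rewrite !muln_gt0 !expn_gt0; lia.
  have Nu : map_mx intr A' \in (unitmx : {pred 'M['F_p]_dim}).
    case: H => [[e0]|[_ _]]; first by rewrite e0 in F0.
    by rewrite /hybF hyb_end //; apply: lab_lt.
  rewrite /hybF hyb_end; last exact: lab_lt.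
  rewrite /invmx Nu mxE -map_mx_adj mxE => vE; apply: contra_notN v0 => /eqP ad.
  move: vE; rewrite ad mulr0 => /esym/eqP; rewrite Fp_nat0 // => /dvdn_leq; lia.
have [g [g3 gn Hg]] := prime_budget.
have dimE : dim = m by rewrite card_tuple card_ord.
(* Crude bound from [n <= 2 ^ n]; the logarithm of the determinants only has to be polynomial in
   [n]. *)
have Hk : ((dim * n ^ d) ^ dim <= 2 ^ (n * (l + d) * m))%N.
  have mono k x y : (x <= y)%N -> (x ^ k <= y ^ k)%N by case: k => // k xy; rewrite leq_exp2r.
  by rewrite dimE -expnD !expnM; apply: (mono); apply: (mono); apply: ltnW; apply: ltn_expl.
have c0 : (0 < n ^ d)%N by rewrite expn_gt0; lia.
have [p [pp pg [x [sx ix]]]] := @survivor _ _ _ (@lab_lt l n) (A :: hist) A' _ _ _ i j c0 g3 hok ad Hk Hg.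
have pn := leq_trans pg gn.
have xp := Fp_lt pp x.
have sv : survives [:: A', A & hist] F p (val x).
  move=> k kF kh; rewrite /hybF Fp_valK; have := sx k kF kh.
  by rewrite (set_nth_default 0).
have lv := live_survives (leqnn _) pp pn xp sv.
apply/HX4; exists p; split=> //; exists (val x); split=> //.
pose y := invmx (hybF A' F p (val x)) i j.
exists (val y); split; first exact: Fp_lt.
have yE : y = invmx (map_mx intr A') i j by rewrite /y /hybF hyb_end //; apply: lab_lt.
split; first by move=> y0; move: ix; rewrite -yE -(Fp_valK y) y0 eqxx.
by rewrite /= numm numd; apply/step_at => //; split=> //; rewrite ?Fp_lt // Fp_valK.
Qed.

End Round.

(** With an empty history the invariant asks only for the current hybrids, so the inverse of each
    invertible one can be stored at once, for every age. *)
Lemma good_start (A : 'M[int]_dim) : bounded d A -> exists X : st n, good_state X A [::].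
Proof.
move=> bA.
pose ideal a p x i j v := exists i' j', [/\ lab i' = i, lab j' = j, hybF A a p x \in unitmx & invmx (hybF A a p x) i' j' = v%:R].
pose ideal_at y := let: (a, p, x, i, j, v) := decode l cp n y in ideal a p x i j v.
pose X : st n := fun R => match R return {set (aux_arity (l + l) (xar l d cp) R).-tuple 'I_n} with
  | Some (Some true) => [set u : (xar l d cp (Some true)).-tuple 'I_n | `[< ideal_at (dval u) >]]%SET
  | Some (Some false) => matrix_rel d A
  | Some None => finset.setT
  | None => finset.set0
  end.
exists X; split=> //; exists (fun a p x => hybF A a p x \in unitmx) => a p x aF pp pn xp; split=> //.
  by move=> sv; have := sv 0%N isT isT; rewrite subn0.
move=> i j v vp; have an := age_lt aF; have xn := ltn_trans xp pn; have vn := ltn_trans vp pn.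
have dc := decode_code v an pn xn (lab_lt i) (lab_lt j).
split=> [[u [/= uX uE]]|[H1 H2]].
  move: uX; rewrite inE uE => /asboolP; rewrite /ideal_at dc => -[i' [j' [/lab_inj -> /lab_inj -> H1 H2]]].
  by split.
have [u uE] := dval_surj (ltnW n1) (code_lt d an pn xn (lab_lt i) (lab_lt j) vn).
by exists u; split=> //=; rewrite inE uE; apply/asboolP; rewrite /ideal_at dc; exists i, j.
Qed.

End Rounds.

From mathcomp Require Import all_reals all_analysis.

Import Order.TTheory GRing.Theory Num.Theory.
Import numFieldNormedType.Exports.

Local Open Scope classical_set_scope.
Local Open Scope ring_scope.

(** * The asymptotic bound *)

(** With [x = ln n] and [y = ln x], suppose [K < x / y]. Then [ln K <= y], so [K * ln K < x],
    contradicting [n <= K ^ K]. *)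
Lemma self_power_bounded_bigO (R : realType) (k : nat -> nat) :
  (fun n : nat => (k n)%:R : R^o) =O_\oo (fun n : nat => ln n%:R / ln (ln n%:R) : R^o) ->
  self_power_bounded k.
Proof.
move=> /eqO_exP[C C0 [n0 _ Hn0]].
have [C' CC'] : exists C' : nat, C <= C'%:R by exists (Num.truncn C).+1; rewrite ltW // truncnS_gt.
(* Above [exp (exp 1)] the iterated logarithm [y] is at least 1, so that [x / y <= x]. *)
pose n1 := (Num.truncn (expR (expR 1) : R)).+1.
exists C', (n0 + (100 + n1))%N => n nn K nK.
have n100 : (100 <= n)%N by lia.
have nn1 : (n1 <= n)%N by lia.
have := Hn0 n (leq_trans (leq_addr _ _) nn); rewrite ger0_norm //.
set x := ln n%:R; set y := ln x => Hk.
have n0R : 0 < n%:R :> R by rewrite ltr0n; lia.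
have x1 : expR 1 <= x.
  rewrite -[expR 1](expRK (expR 1)) ler_ln ?posrE ?expR_gt0 //.
  by apply: (@le_trans _ _ n1%:R); [rewrite ltW // truncnS_gt|rewrite ler_nat].
have x0 : 0 < x by apply: lt_le_trans (expR_gt0 1) x1.
have y1 : 1 <= y by rewrite -[1](expRK 1) ler_ln ?posrE ?expR_gt0.
have K0 : 0 < K%:R :> R by rewrite ltr0n lt0n; apply/eqP => e0; move: nK; rewrite e0 expn0; lia.
have HK : x / y <= K%:R.
  rewrite leNgt; apply/negP => lt.
  have xy : x / y <= x by rewrite ler_pdivrMr ?ler_peMr //; lra.
  have lK : ln (K%:R : R) <= y by rewrite ler_ln ?posrE // (le_trans (ltW lt)).
  have : x <= ln (K%:R : R) * K%:R by rewrite mulr_natr -lnXn // ler_ln ?posrE ?exprn_gt0 // -natrX ler_nat.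
  rewrite leNgt => /negP; apply.
  apply: (@le_lt_trans _ _ (y * K%:R)); first by rewrite ler_wpM2r // ltW.
  by move: lt; rewrite ltr_pdivlMr ?[_ * y]mulrC //; lra.
rewrite -(ler_nat R) natrM; apply: le_trans Hk _.
have ay : 0 <= x / y by rewrite divr_ge0 // ?ltW //; lra.
by rewrite (ger0_norm ay) ler_pM // ltW.
Qed.

(** * Runs of the program *)

Section Runs.
Variables (l d n c5 kk : nat).
Hypotheses (n1 : (1 < n)%N).
Hypothesis (HK : exists K, [/\ (K0r l d <= K)%N, (2 * kk + 3 <= K)%N \/ (n ^ l <= K)%N, (n <= K ^ K)%N & (K ^ K <= n ^ c5)%N]).
Notation dim := #|idx l n|.
Notation cb := (12 * c5 + 1)%N.
Notation form := (formula (l + (l + d.+1)) (l + l) (xar l d (cpr l d))).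
Variables (fX : form (xar l d (cpr l d) (Some true))) (fO : form (xar l d (cpr l d) (Some false)))
  (fF : form 0) (fA : form (l + l)).
Hypothesis HfX : forall w, (1 < wn w)%N -> (sat fX w <-> thread_at cb (K0r l d) w (dval (we w))).
Hypothesis HfO : forall w, (1 < wn w)%N -> (sat fO w <-> relnum w Input (dval (we w))).
Hypothesis HfF : forall w, (1 < wn w)%N -> (sat fF w <-> True).
Hypothesis HfA : forall w, (1 < wn w)%N -> (sat fA w <-> answer_at cb (K0r l d) w (dval (we w))).

Definition prog : dynprog (l + (l + d.+1)) (l + l) :=
  @DynProg (l + (l + d.+1)) (l + l) (option bool : finType) (xar l d (cpr l d)) (fun R =>
    match R return form (aux_arity (l + l) (xar l d (cpr l d)) R) with
    | Some (Some true) => fX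
    | Some (Some false) => fO
    | Some None => fF
    | None => fA
    end).

Lemma admissible_ok (A : 'M[int]_dim) : admissible d A ->
  bounded d A /\ (forall i j, (`|A i j| <= n ^ d)%N) /\ \det A != 0.
Proof.
move=> [bA uA]; split=> //; split=> [i j|]; first exact: ltnW.
by move: uA; rewrite unitmxE unitfE det_map_mx /= intr_eq0.
Qed.

Lemma update_ok (X : state prog n) (A A' : 'M[int]_dim) hist Al :
  @effective l d (cpr l d) 0 (World (matrix_rel d A') X [tuple]) A Al ->
  (forall a p x, (a <= 2 * (n ^ l * n ^ l))%N -> prime p -> (p < n ^ cpr l d)%N -> (x < p)%N ->
     survives (A :: hist) a p x -> Al a p x) ->
  admissible d A' -> affects_at_most kk (A' - A) -> hist_ok d (A :: hist) ->
  good_state (update X (matrix_rel d A')) A' (A :: hist) /\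
  answer (update X (matrix_rel d A')) = inverse_support A'.
Proof.
move=> eff sv adm aff hok; have [bA' okA'] := admissible_ok adm.
set X' := update _ _.
have H1 e : e \in X' (Some None) by rewrite inE; exact: (proj2 (@HfF (World (matrix_rel d A') X e) n1) I).
have H2 e : e \in X' (Some (Some false)) <-> relnum (World (matrix_rel d A') X e) Input (dval e).
  by rewrite inE; apply: (HfO (w := World (matrix_rel d A') X e)).
have H3 e : e \in X' (Some (Some true)) <-> thread_at cb (K0r l d) (World (matrix_rel d A') X e) (dval e).
  by rewrite inE; apply: (HfX (w := World (matrix_rel d A') X e)).
have H4 e : e \in X' None <-> answer_at cb (K0r l d) (World (matrix_rel d A') X e) (dval e).
  by rewrite inE; apply: (HfA (w := World (matrix_rel d A') X e)).
split; first exact: (good_round n1 HK H1 H2 H3 eff sv erefl bA' aff).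
apply: (answer_round n1 HK H4 eff sv erefl bA' aff).
by move=> B; rewrite inE => /orP[/eqP->|]; [|exact: hok].
Qed.

Lemma run_ok (Ds : seq 'M[int]_dim) : forall (X : state prog n) A hist,
  good_state X A hist -> hist_ok d (A :: hist) -> bounded d A -> Ds <> [::] ->
  (forall D, D \in Ds -> affects_at_most kk D) ->
  (forall B, B \in scanl +%R A Ds -> admissible d B) ->
  answer (run X [seq matrix_rel d B | B <- scanl +%R A Ds]) = inverse_support (last A (scanl +%R A Ds)).
Proof.
elim: Ds => // D Ds IH X A hist gX hok bA _ HD Hadm.
have adm : admissible d (A + D) by apply: Hadm; rewrite mem_head.
have [Al eff sv] := effective_good n1 (matrix_rel d (A + D)) [tuple] gX bA.
have aff : affects_at_most kk (A + D - A) by rewrite addrC addKr; apply: HD; rewrite mem_head.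
have [gX' ans] := update_ok eff sv adm aff hok.
rewrite /run /= -/(run _ _); case: Ds IH HD Hadm => [|D' Ds] IH HD Hadm; first by [].
have [bAD okAD] := admissible_ok adm.
apply: (IH _ _ _ gX') => //.
- by move=> B; rewrite inE => /orP[/eqP->|]; [|exact: hok].
- by move=> D2 D2i; apply: HD; rewrite inE D2i orbT.
- by move=> B Bi; apply: Hadm; rewrite inE Bi orbT.
Qed.

Lemma run_init_ok (Ds : seq 'M[int]_dim) (X : state prog n) A0 : is_diag_mx A0 ->
  (forall S, X S = finset.set0) -> Ds <> [::] ->
  (forall D, D \in Ds -> affects_at_most kk D) ->
  (forall B, B \in A0 :: scanl +%R A0 Ds -> admissible d B) ->
  answer (run X [seq matrix_rel d B | B <- scanl +%R A0 Ds]) = inverse_support (last A0 (scanl +%R A0 Ds)).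
Proof.
move=> /is_diag_mxP dA0 X0; case: Ds => // D Ds _ HD Hadm.
have adm0 : admissible d A0 by apply: Hadm; rewrite mem_head.
have adm : admissible d (A0 + D) by apply: Hadm; rewrite !inE eqxx orbT.
have [bAD okAD] := admissible_ok adm.
have eff := effective_init n1 [tuple] X0 (erefl (matrix_rel d (A0 + D))) bAD.
set A := (\matrix_(i, j) _) in eff.
have AE i j : A i j = if i == j then (if (A0 + D) i i == 0 then 1 else (A0 + D) i i) else 0 by rewrite mxE.
have n0 : (0 < n ^ d)%N by rewrite expn_gt0; lia.
have Adiag : A = diag_mx (\row_i A i i).
  apply/matrixP => i j; rewrite [RHS]mxE [X in _ = X *+ _]mxE.
  by have [->|ne] := eqVneq i j; rewrite ?mulr1n // mulr0n AE (negbTE ne).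
have okA : hist_ok d [:: A].
  move=> B; rewrite inE => /eqP->; split=> [i j|].
    rewrite AE; case: eqP => // _; case: eqP => // _.
    by have [H _] := okAD; apply: H.
  have -> : \det A = \prod_i A i i by rewrite {1}Adiag det_diag; apply: eq_bigr => i _; rewrite mxE.
  by apply/prodf_neq0 => i _; rewrite AE eqxx; case: ifP => // /negbT.
have d0 i : A0 i i != 0.
  have [_ [_]] := admissible_ok adm0.
  have A0diag : A0 = diag_mx (\row_i A0 i i).
    apply/matrixP => i' j'; rewrite [RHS]mxE [X in _ = X *+ _]mxE.
    by have [->|ne] := eqVneq i' j'; rewrite ?mulr1n // mulr0n dA0.
  rewrite A0diag det_diag => /prodf_neq0 /(_ i isT).
  by rewrite -A0diag mxE.
(* Where the change is 0 on the diagonal, the new entry is that of [A0], nonzero by invertibility,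
   so the substitute matrix agrees with the new one there; off the diagonal both [A0] and the
   substitute vanish. *)
have aff : affects_at_most kk (A0 + D - A).
  have [rows [cols [sr sc H]]] : affects_at_most kk D by apply: HD; rewrite mem_head.
  exists rows, cols; split=> // i j; rewrite [X in X != 0](_ : _ = (A0 + D) i j - A i j); last by rewrite mxE [X in _ + X]mxE.
  move=> nz; apply: H; apply: contraNN nz => /eqP Dij.
  have [e|ne] := eqVneq i j; last by rewrite AE (negbTE ne) mxE Dij dA0 ?addr0 ?subrr.
  by rewrite AE e eqxx; move: Dij; rewrite e => Dij; rewrite !mxE Dij addr0 (negbTE (d0 j)) subrr.
have sv a p x : (a <= 2 * (n ^ l * n ^ l))%N -> prime p -> (p < n ^ cpr l d)%N -> (x < p)%N ->
    survives [:: A] a p x -> hybF A a p x \in unitmx.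
  by move=> _ _ _ _ H; have := H 0%N isT isT; rewrite subn0.
have [gX' ans] := update_ok eff sv adm aff okA.
rewrite /run /= -/(run _ _); case: Ds HD Hadm => [|D' Ds] HD Hadm; first by [].
apply: (run_ok gX') => //.
- by move=> B; rewrite inE => /orP[/eqP->|]; [|exact: okA].
- by move=> D2 D2i; apply: HD; rewrite inE D2i orbT.
- by move=> B Bi; apply: Hadm; rewrite in_cons [X in _ || X]in_cons Bi !orbT.
Qed.

End Runs.

Theorem theorem6 (R : realType) (l d : nat) (k : nat -> nat)
  (l_gt0 : (0 < l)%N)
  (kO : (fun n : nat => (k n)%:R : R^o) =O_\oo
        (fun n : nat => ln n%:R / ln (ln n%:R) : R^o)) :
  exists P : dynprog (l + (l + d.+1)) (l + l),
    forall (n : nat) (A0 : 'M[int]_#|idx l n|),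
    exists2 X0 : state P n,
      is_diag_mx A0 -> forall S, X0 S = finset.set0 &
      forall Ds : seq 'M[int]_#|idx l n|,
        Ds <> [::] ->
        (forall D, D \in Ds -> affects_at_most (k n) D) ->
        (forall A, A \in A0 :: scanl +%R A0 Ds -> admissible d A) ->
        answer (run X0 [seq matrix_rel d A | A <- scanl +%R A0 Ds])
          = inverse_support (last A0 (scanl +%R A0 Ds)).
Proof.
have [c5 HK] := self_power_dimension l (K0r l d) (self_power_bounded_bigO kO).
have [fX HfX] := thread_formula l d (cpr l d) (12 * c5 + 1) (K0r l d) (xar l d (cpr l d) (Some true)).
have [fA HfA] := answer_formula l d (cpr l d) (12 * c5 + 1) (K0r l d) (l + l).
have [fO HfO] := input_formula l d (cpr l d) (xar l d (cpr l d) (Some false)).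
have [fF HfF] := true_formula l d (cpr l d) 0.
exists (prog fX fO fF fA) => n A0.
(* Definability omits domains with fewer than two elements. For [n = 0] the answer has no tuples
   since [l > 0]; for [n = 1] all entries are below [1 ^ d], so the matrix would be 0 and not
   invertible. *)
have [n1|n1] := leqP n 1.
  exists (fun=> finset.set0) => // Ds _ _ Hadm.
  case: n n1 A0 Ds Hadm => [|[|//]] _ A0 Ds Hadm.
    by apply/setP => e; have := tnth e (Ordinal (leq_trans l_gt0 (leq_addr l l))); case.
  have [bA] := Hadm A0 (mem_head _ _).
  have A00 : A0 = 0.
    by apply/matrixP => i j; have := bA i j; rewrite exp1n ltnS leqn0 absz_eq0 mxE => /eqP.
  pose i : 'I_#|idx l 1| := enum_rank [tuple ord0 | _ < l].
  rewrite /overQ A00 map_mx0 => /mulmxV /matrixP /(_ i i).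
  by rewrite mul0mx !mxE eqxx => /eqP; rewrite eq_sym oner_eq0.
have [dA0|ndA0] := boolP (is_diag_mx A0).
  exists (fun=> finset.set0) => // Ds Ds0 HD Hadm.
  exact: (run_init_ok n1 (HK n n1) HfX HfO HfF HfA dA0).
have [adm|nadm] := pselect (admissible d A0); last first.
  by exists (fun=> finset.set0) => // Ds _ _ Hadm; case: nadm; apply: Hadm; rewrite mem_head.
have [bA okA] := admissible_ok adm.
have [X0 gX0] := good_start n1 bA.
exists X0 => // Ds Ds0 HD Hadm.
apply: (run_ok n1 (HK n n1) HfX HfO HfF HfA gX0) => //.
- by move=> B; rewrite inE => /eqP->.
- by move=> B Bi; apply: Hadm; rewrite inE Bi orbT.
Qed.
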